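(* Let $\eta=1+RS$, $\alpha=\frac{3\eta}{2}$ and $\iota=\sqrt{\frac{2\eta k_\mu}{g(\tau)}}$. Let $\gamma\in(0,1)$, $\delta\in(0,1)$, and suppose $$\lambda\ge\max\left\{\frac{6\eta R k_\mu S}{g(\tau)},\ \frac{32\alpha dR^2}{7}\right\}.$$ Let $(\theta_t)_{t\ge1}$, $(H_t)_{t\ge 1}$ be produced by the discounted online mirror descent recursion described in the context. For each $t\ge2$ define the confidence set $$\mathcal C_t(\delta):=\left\{\theta\in\mathbb R^d:\ \|\theta-\theta_t\|_{H_t}\le\beta_t(\delta)+\iota\,\mathcal V_t\right\},$$ where $$\mathcal V_t:=\sum_{p=1}^{t-1}\gamma^{(t-1-p)/2}\sqrt{\frac{1-\gamma^p}{1-\gamma}}\;\|\theta_{p+1}^\star-\theta_p^\star\|_2$$ and $$\beta_t^2(\delta):=4\lambda S^2+2\eta\left(1+\frac{R^2}{g(\tau)k_\mu}\right)\log\left(\frac{\pi^2t^2}{3\delta}\right)+2\eta\left(3\eta+\frac12\right)d\log\left(1+\frac{k_\mu(1-\gamma^{t-1})}{\lambda d\,g(\tau)(1-\gamma)}\right).$$ Then $$\Pr\left[\forall t\ge2:\ \theta_t^\star\in\mathcal C_t(\delta)\right]\ge1-\delta .$$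
   Context: Notation: $\|x\|_M:=\sqrt{x^\top Mx}$ for positive semidefinite $M$; $I_d$ is the identity. Nonstationary generalized linear bandit. Fix $d\ge1$, $R,S>0$. At each round $t=1,2,\dots$ a learner observes a set $\mathcal X_t\subset\mathbb R^d$, chooses $x_t\in\mathcal X_t$ (based on the past), and receives a reward $r_t$. There is an unknown parameter sequence $(\theta_t^\star)_{t\ge1}$ in $\mathbb R^d$, fixed independently of the reward noise (exogenous). Let $p(r\mid z)=\exp\left(\frac{rz-m(z)}{g(\tau)}+h(r,\tau)\right)$, a probability density in $r$ (with respect to a fixed reference measure) for every $z\in\mathbb R$, where $m:\mathbb R\to\mathbb R$ is convex and three times continuously differentiable and $g(\tau)>0$ is a known constant. Put $\mu:=m'$ (the link function). With $\widetilde{\mathcal F}_t:=\sigma(x_1,r_1,\dots,x_{t-1},r_{t-1},x_t)\vee\sigma(\theta_s^\star:s\ge1)$, the conditional law of $r_t$ given $\widetilde{\mathcal F}_t$ has density $p(\cdot\mid x_t^\top\theta_t^\star)$; in particular its conditional mean is $\mu(x_t^\top\theta_t^\star)$. Assumptions. (Boundedness) for all $t$: $\theta_t^\star\in\Theta:=\{\theta\in\mathbb R^d:\|\theta\|_2\le S\}$, $\|x\|_2\le1$ for all $x\in\mathcal X_t$, and $r_t\in[0,R]$ almost surely. (Bounded link) there are constants $c_\mu,k_\mu>0$ with $c_\mu\le\mu'(z)\le k_\mu$ for all $z\in[-S,S]$. (Self-concordance, a standing property of the link in this setting) $|\mu''(z)|\le R\,\mu'(z)$ for all $z\in\mathbb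 R$. Discounted online mirror descent (DOMD). Loss: $\ell_t(\theta):=\frac{m(x_t^\top\theta)-r_tx_t^\top\theta}{g(\tau)}$. Start from $\theta_1\in\Theta$ and $H_1=\lambda I_d$. For $t\ge1$ set $A_t:=\gamma H_t+(1-\gamma)\lambda I_d$, $$\widetilde\ell_t(\theta):=\ell_t(\theta_t)+\langle\nabla\ell_t(\theta_t),\theta-\theta_t\rangle+\tfrac12\|\theta-\theta_t\|^2_{\nabla^2\ell_t(\theta_t)},$$ $$\theta_{t+1}\in\arg\min_{\theta\in\Theta}\left\{\widetilde\ell_t(\theta)+\frac1{2\eta}\|\theta-\theta_t\|_{A_t}^2\right\},\qquad \eta=1+RS,$$ $$H_{t+1}:=A_t+\nabla^2\ell_t(\theta_{t+1})=A_t+\frac{\mu'(x_t^\top\theta_{t+1})}{g(\tau)}x_tx_t^\top .$$ Equivalently $H_t=\lambda I_d+\sum_{s=1}^{t-1}\gamma^{t-1-s}\nabla^2\ell_s(\theta_{s+1})$. *)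

(* Defs.v *)
From HB Require Import structures.
From mathcomp Require Import all_boot all_order all_algebra.
From mathcomp Require Import all_classical all_reals all_analysis.
From mathcomp Require Import measurable_realfun.

Set Implicit Arguments.
Unset Strict Implicit.
Unset Printing Implicit Defensive.

Import Order.TTheory GRing.Theory Num.Theory.
Import numFieldNormedType.Exports.

Local Open Scope ring_scope.
Local Open Scope classical_set_scope.

Definition dotv (R : realType) (d : nat) (x y : 'cV[R]_d) : R :=
  (x^T *m y) 0 0.

(* The norm that MathComp-Analysis puts on matrices is the sup norm. *)
Definition norm2 (R : realType) (d : nat) (x : 'cV[R]_d) : R :=
  Num.sqrt (dotv x x).

Definition wnorm (R : realType) (d : nat) (M : 'M[R]_d) (x : 'cV[R]_d) : R :=
  Num.sqrt ((x^T *m M *m x) 0 0).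

Definition ball2 (R : realType) (d : nat) (S : R) : set 'cV[R]_d :=
  [set theta | norm2 theta <= S].

Definition grad (R : realType) (d : nat) (f : 'cV[R]_d -> R) (theta : 'cV[R]_d)
    : 'cV[R]_d :=
  \col_(i < d) 'D_(delta_mx i 0) f theta.

Definition hess (R : realType) (d : nat) (f : 'cV[R]_d -> R) (theta : 'cV[R]_d)
    : 'M[R]_d :=
  \matrix_(i < d, j < d)
    'D_(delta_mx i 0) (fun u => 'D_(delta_mx j 0) f u) theta.

Definition argmin_on (T : Type) (R : realType) (D : set T) (f : T -> R)
    : set T :=
  [set u | D u /\ forall v, D v -> f u <= f v].

Definition C3 (R : realType) (m : R -> R) : Prop :=
  (forall k : nat, (k < 3)%N -> forall z : R, derivable (m^`(k)) z 1) /\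
  continuous (m^`(3)).

(* [gt] stands for the dispersion constant g(tau) and [ht] for the function
   r |-> h(r, tau). *)
Definition expfam (R : realType) (m : R -> R) (gt : R) (ht : R -> R)
    (r z : R) : R :=
  expR ((r * z - m z) / gt + ht r).

Definition is_density (R : realType) (nu : {measure set R -> \bar R})
    (f : R -> R) : Prop :=
  [/\ measurable_fun setT f, forall r, 0 <= f r
    & (\int[nu]_(r in setT) (f r)%:E = 1)%E].

(* sigma(X) for a random vector X is generated by the coordinates of X, since
   the Borel sigma-algebra of R^d is the product one. *)
Definition sigma_gen (R : realType) (d : nat) (T : Type) (X : T -> 'cV[R]_d)
    : set (set T) :=
  \bigcup_(i in [set: 'I_d])
    preimage_set_system setT (fun w => X w i 0) measurable.

Definition measurable_vec (R : realType) (d : nat) (dT : measure_display)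
    (T : measurableType dT) (X : T -> 'cV[R]_d) : Prop :=
  forall i : 'I_d, measurable_fun setT (fun w => X w i 0).

(* sigma(x_1, r_1, ..., x_{t-1}, r_{t-1}, x_t) \/ sigma(theta*_s : s >= 1);
   time starts at 1 and the index 0 of every process is unused. *)
Definition history (R : realType) (d : nat) (T : Type)
    (x : nat -> T -> 'cV[R]_d) (r : nat -> T -> R)
    (theta_star : nat -> T -> 'cV[R]_d) (t : nat) : set (set T) :=
  <<s (\bigcup_(s in [set s | (1 <= s <= t)%N]) sigma_gen (x s))
      `|` (\bigcup_(s in [set s | (1 <= s < t)%N])
             preimage_set_system setT (r s) measurable)
      `|` (\bigcup_(s in [set s | (1 <= s)%N]) sigma_gen (theta_star s)) >>.

(* The kernel (w, B) |-> \int_B f w dnu is a regular conditional distribution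
   of Y given the sigma-algebra F. *)
Definition cond_density (R : realType) (dT : measure_display)
    (T : measurableType dT) (P : probability T R) (F : set (set T))
    (Y : T -> R) (nu : {measure set R -> \bar R}) (f : T -> R -> R) : Prop :=
  forall B : set R, measurable B ->
    (forall C : set (\bar R), measurable C ->
       F ((fun w => \int[nu]_(y in B) (f w y)%:E)%E @^-1` C)) /\
    (forall A : set T, F A ->
       (P (A `&` Y @^-1` B) =
        \int[P]_(w in A) \int[nu]_(y in B) (f w y)%:E)%E).

Definition loss (R : realType) (d : nat) (m : R -> R) (gt : R)
    (x : 'cV[R]_d) (r : R) (theta : 'cV[R]_d) : R :=
  (m (dotv x theta) - r * dotv x theta) / gt.

Definition quad_approx (R : realType) (d : nat) (l : 'cV[R]_d -> R)
    (theta0 theta : 'cV[R]_d) : R :=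
  l theta0 + dotv (grad l theta0) (theta - theta0)
  + 2^-1 * wnorm (hess l theta0) (theta - theta0) ^+ 2.

Definition domd (R : realType) (d : nat) (S lambda gamma eta : R)
    (theta1 : 'cV[R]_d) (l : nat -> 'cV[R]_d -> R)
    (theta : nat -> 'cV[R]_d) (H : nat -> 'M[R]_d) : Prop :=
  [/\ theta 1%N = theta1, H 1%N = lambda%:M
    & forall t : nat, (1 <= t)%N ->
      let A := gamma *: H t + ((1 - gamma) * lambda)%:M in
      argmin_on (ball2 (d := d) S)
        (fun u => quad_approx (l t) (theta t) u
                  + (2 * eta)^-1 * wnorm A (u - theta t) ^+ 2)
        (theta t.+1) /\
      H t.+1 = A + hess (l t) (theta t.+1)].

Definition drift_penalty (R : realType) (d : nat) (gamma : R)
    (theta_star : nat -> 'cV[R]_d) (t : nat) : R :=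
  \sum_(1 <= p < t)
    gamma `^ ((t - 1 - p)%:R / 2)
    * Num.sqrt ((1 - gamma ^+ p) / (1 - gamma))
    * norm2 (theta_star p.+1 - theta_star p).

Definition beta_radius (R : realType) (d : nat)
    (S Rmax kmu gt lambda gamma eta delta : R) (t : nat) : R :=
  Num.sqrt
    (4 * lambda * S ^+ 2
     + 2 * eta * (1 + Rmax ^+ 2 / (gt * kmu))
       * ln (pi ^+ 2 * t%:R ^+ 2 / (3 * delta))
     + 2 * eta * (3 * eta + 2^-1) * d%:R
       * ln (1 + kmu * (1 - gamma ^+ (t - 1))
                 / (lambda * d%:R * gt * (1 - gamma)))).

Definition conf_set (R : realType) (d : nat) (theta_t : 'cV[R]_d)
    (H_t : 'M[R]_d) (radius : R) : set 'cV[R]_d :=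
  [set theta | wnorm H_t (theta - theta_t) <= radius].

(* Main.v *)
(** Self-concordance and the optimality condition of the update give a one-step
inequality for ||u - theta_t||_{H_t}^2 (omd_step); unrolled with discount gamma
it bounds this quantity by 4 lambda S^2 plus 2 eta times the discounted sum of
  l_s(u) - l_s(theta_{s+1}) - ||theta_{s+1} - theta_s||_{A_s}^2 / (3 eta).
As a loss depends on theta only through x_s^T theta, the loss of theta_{s+1} is
compared with that of the one-dimensional mixture of the law N(z_s, alpha v_s),
z_s = x_s^T theta_s and v_s = x_s^T A_s^-1 x_s: the mixture loses at most the
last term above plus (3 eta + 1/2) ln(1 + h_s v_s), where 1 + h_s v_s is
det H_{s+1} / det A_s, and concavity of ln det makes the discounted sum of these
logarithms telescope.  For u = theta*_t the loss of u is compared with that of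
theta*_s by a second exponential moment, which uses mu' <= R^2 / g (a consequence
of rewards in [0, R]) and costs k_mu (x_s^T (u - theta*_s))^2 / g; Minkowski's
inequality turns this cost into the drift term.  With a = 1 / (1 + K) and
K = R^2 / (g k_mu), convexity of exp combines the two moments, tempered by the
discount weights, into a single supermartingale with mean at most 1.  Markov's
inequality for each t at level 3 delta / (pi^2 t^2) and a union bound over t
conclude. *)

Require Import Defs.
From HB Require Import structures.
From mathcomp Require Import all_boot all_order all_algebra.
From mathcomp Require Import all_classical all_reals all_analysis.
From mathcomp Require Import measurable_realfun.
From mathcomp Require Import ring lra zify.

Import Order.TTheory GRing.Theory Num.Theory.
Import numFieldNormedType.Exports.
Import HBNNSimple.

Set Implicit Arguments.
Unset Strict Implicit.
Unset Printing Implicit Defensive.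

Local Open Scope ring_scope.
Local Open Scope classical_set_scope.

(** The obstacle is that theta_{s+1} depends on the reward r_s, so its loss is not predictable and
    has no conditional exponential moment of its own. The mixture is built from theta_s and A_s
    alone: its likelihood ratio against the true law has conditional mean exactly 1, and its
    comparison with theta_{s+1} holds for every value of the reward.

    The value alpha = 3 eta / 2 turns 1 / (2 alpha) into the coefficient 1 / (3 eta) left by the
    descent step, and 2 alpha + 1/2 into 3 eta + 1/2. The first lower bound on lambda pays for the
    linearisation of the link; the second keeps alpha v_s R^2 below 7/32, where the second-order
    remainder, inflated by self-concordance, has an explicit bound under the Gaussian. The discount
    weights depend on t, so each horizon has its own supermartingale and no single maximal
    inequality covers all t.

    Two technical points remain: the argmin has to be measurable for the history, and the arbitrary
    reference measure is replaced by the probability p(. | 0), for which Fubini's theorem is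
    available. *)

Section with_density.
Local Open Scope ereal_scope.
Context d (T : measurableType d) (R : realType).
Context (mu : {measure set T -> \bar R}) (f : T -> R).
Context (mf : measurable_fun setT f) (f0 : forall x, (0 <= f x)%R).

(* The proofs are arguments so that the measure structure can be inferred. *)
Definition with_density of measurable_fun setT f & (forall x, (0 <= f x)%R) :=
  fun A : set T => \int[mu]_(x in A) (f x)%:E.

Local Notation nu := (with_density mf f0).

Let nu_set0 : nu set0 = 0.
Proof. exact: integral_set0. Qed.

Let nu_ge0 A : 0 <= nu A.
Proof. by apply: integral_ge0 => x _; rewrite lee_fin. Qed.

Let nu_sigma_additive : semi_sigma_additive nu.
Proof.
move=> /= A mA tA mUA; rewrite /with_density ge0_integral_bigcup//.
- by apply: is_cvg_ereal_nneg_natsum_cond => n _ _; exact: nu_ge0.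
- exact/measurable_EFinP/measurable_funTS.
- by move=> x _; rewrite lee_fin.
Qed.

HB.instance Definition _ := isMeasure.Build _ _ _ nu
  nu_set0 nu_ge0 nu_sigma_additive.

Let sfun_integral_with_density (h : {nnsfun T >-> R}) :
  \int[nu]_x (h x)%:E = \int[mu]_x ((h x)%:E * (f x)%:E).
Proof.
under [LHS]eq_integral do rewrite fimfunE -fsumEFin//.
rewrite ge0_integral_fsum//; last 2 first.
- by move=> r; exact/measurable_EFinP/measurableT_comp.
- by move=> r y _; exact: nnfun_muleindic_ge0.
under [RHS]eq_integral.
  move=> x _; rewrite fimfunE -fsumEFin// ge0_mule_fsuml; last first.
    by move=> y; exact: nnfun_muleindic_ge0.
  over.
rewrite ge0_integral_fsum//; last 2 first.
- move=> r; apply: emeasurable_funM; last exact/measurable_EFinP.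
  exact/measurable_EFinP/measurableT_comp.
- by move=> r y _; rewrite mule_ge0// ?nnfun_muleindic_ge0// lee_fin.
apply: eq_fsbigr => r /[!inE] rh.
under [LHS]eq_integral do rewrite EFinM.
have r0 : (0 <= r)%R by case: rh => x _ <-.
under [RHS]eq_integral do rewrite EFinM -muleA.
rewrite !ge0_integralZl//.
- rewrite integral_indic// setIT/= /with_density [in LHS]integral_mkcond/=.
  congr (_ * _); apply: eq_integral => x _.
  by rewrite patchE indicE; case: ifPn => _; rewrite ?mul1e ?mul0e.
- by apply: emeasurable_funM; exact/measurable_EFinP.
- by move=> x _; rewrite mule_ge0// lee_fin.
- exact/measurable_EFinP.
Qed.

(** Stated for an arbitrary [mu], because the reference measure of the exponential family carries no
    finiteness assumption. Both sides agree on simple functions and pass to the limit by monotone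
    convergence. *)
Lemma integral_with_density (g : T -> \bar R) :
  measurable_fun setT g -> (forall x, 0 <= g x) ->
  \int[nu]_x g x = \int[mu]_x (g x * (f x)%:E).
Proof.
move=> mg g0; pose h := nnsfun_approx measurableT mg.
have gE x : g x = lim ((h n x)%:E @[n --> \oo]).
  by apply/esym/cvg_lim => //; exact: cvg_nnsfun_approx.
have nd x : nondecreasing_seq (fun n => (h n x)%:E).
  by move=> a b ab; rewrite lee_fin; exact/lefP/nd_nnsfun_approx.
have -> : \int[nu]_x g x = lim (\int[nu]_x (h n x)%:E @[n --> \oo]).
  under eq_integral do rewrite gE.
  apply: monotone_convergence => //.
  - by move=> n; exact/measurable_EFinP.
  - by move=> n x _; rewrite lee_fin.
have gfE x : g x * (f x)%:E = lim (((h n x)%:E * (f x)%:E) @[n --> \oo]).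
  by apply/esym/cvg_lim => //; apply: cvgeZr => //; exact: cvg_nnsfun_approx.
under eq_fun do rewrite sfun_integral_with_density.
apply/esym; under eq_integral do rewrite gfE.
apply: monotone_convergence => //.
- by move=> n; apply: emeasurable_funM; exact/measurable_EFinP.
- by move=> n x _; rewrite mule_ge0// lee_fin.
- move=> x _ a b ab; rewrite lee_wpmul2r ?lee_fin//.
  exact/lefP/nd_nnsfun_approx.
Qed.

End with_density.

(** * Disintegration of a joint law along a conditional density *)

Section disintegration.
Local Open Scope ereal_scope.
Context dT dS dU (T : measurableType dT) (S : measurableType dS)
  (U : measurableType dU) (R : realType).
Context (P : probability T R) (J : {mfun T >-> S}) (Y : T -> U).
Context (nu : {sigma_finite_measure set U -> \bar R}) (f : S * U -> R).
Hypotheses (mY : measurable_fun setT Y) (mf : measurable_fun setT f).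
Hypothesis f0 : forall z, (0 <= f z)%R.
Hypothesis PJY : forall A B, measurable A -> measurable B ->
  P (J @^-1` A `&` Y @^-1` B) =
  \int[P]_(w in J @^-1` A) \int[nu]_(y in B) (f (J w, y))%:E.

Let JY w := (J w, Y w).

Let mJY : measurable_fun setT JY.
Proof. exact: measurable_fun_pair. Qed.

Let law := distribution P J.

Let mf_in B : measurable B ->
  measurable_fun setT (fun s => \int[nu]_(y in B) (f (s, y))%:E).
Proof.
move=> mB.
rewrite (_ : (fun s => _) =
    fubini_F nu (fun z => (f z)%:E * (\1_B z.2)%:E)); last first.
  apply/funext => s; rewrite /fubini_F [LHS]integral_mkcond.
  apply: eq_integral => y _.
  by rewrite patchE indicE; case: ifPn => _; rewrite ?mule1 ?mule0.
apply: measurable_fun_fubini_tonelli_F.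
- apply: emeasurable_funM; first exact/measurable_EFinP.
  apply/measurable_EFinP.
  exact: (measurableT_comp (measurable_indic mB) measurable_snd).
- by move=> z; rewrite mule_ge0 ?lee_fin.
Qed.

Let law_prod A B : measurable A -> measurable B ->
  \int[law \x nu]_(z in A `*` B) (f z)%:E = P (J @^-1` A `&` Y @^-1` B).
Proof.
move=> mA mB; rewrite PJY// [LHS]integral_mkcond.
rewrite (eq_integral (fun z => (f z)%:E * ((\1_A z.1)%:E * (\1_B z.2)%:E))); last first.
  move=> [s y] _; rewrite patchE in_setX !indicE.
  by case: (s \in A); case: (y \in B); rewrite /= ?mule1 ?mule0.
rewrite fubini_tonelli1//=.
- transitivity (\int[law]_(s in A) \int[nu]_(y in B) (f (s, y))%:E).
    rewrite [RHS]integral_mkcond; apply: eq_integral => s _.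
    rewrite /fubini_F patchE; case: ifPn => sA.
      rewrite [RHS]integral_mkcond; apply: eq_integral => y _ /=.
      by rewrite indicE sA mul1e patchE indicE; case: ifPn => _;
        rewrite ?mule1 ?mule0.
    apply: integral0_eq => y _ /=.
    by rewrite indicE (negbTE sA) mul0e mule0.
  rewrite ge0_integral_pushforward//.
  + exact/measurable_funTS/mf_in.
  + by move=> s _; apply: integral_ge0 => y _; rewrite lee_fin.
- apply: emeasurable_funM; first exact/measurable_EFinP.
  apply: emeasurable_funM; apply/measurable_EFinP.
    exact: (measurableT_comp (measurable_indic mA) measurable_fst).
  exact: (measurableT_comp (measurable_indic mB) measurable_snd).
- by move=> z; rewrite !mule_ge0 ?lee_fin.
Qed.

(** By [law_prod] the two measures agree on measurable rectangles, which are stable under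
    intersection and generate the product sigma-algebra. *)
Let joint_law (C : set (S * U)) : measurable C ->
  pushforward P JY C = with_density (law \x nu) mf f0 C.
Proof.
pose m1 : {measure set (S * U) -> \bar R} :=
  distribution P (mfun_Sub (mem_set mJY)).
move=> mC; rewrite -[LHS]/(m1 C).
apply: (measure_unique [set A `*` B | A in measurable & B in measurable]
  (fun=> setT)) => //=.
- by rewrite measurable_prod_measurableType.
- move=> _ _ [A mA [B mB <-]] [A' mA' [B' mB' <-]].
  exists (A `&` A'); first exact: measurableI.
  by exists (B `&` B'); [exact: measurableI|rewrite setXI].
- by move=> _; exists setT => //; exists setT => //; rewrite setXTT.
- by rewrite bigcup_const.
- by move=> _ [A mA [B mB <-]]; rewrite [RHS]law_prod.
- by move=> _; rewrite /distribution /pushforward preimage_setT probability_setT ltry.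
Qed.

(** [J] will be the identity of the sample space into its history sigma-algebra. Conditioning thus
    becomes a statement on the product of that coarse space with the reward space, where the joint
    law has a density and Tonelli's theorem separates the two variables. *)
Lemma disintegration (g : S * U -> \bar R) :
  measurable_fun setT g -> (forall z, 0 <= g z) ->
  \int[P]_w g (J w, Y w) =
  \int[P]_w \int[nu]_y (g (J w, y) * (f (J w, y))%:E).
Proof.
move=> mg g0.
have mgf : measurable_fun setT (fun z => g z * (f z)%:E).
  by apply: emeasurable_funM => //; exact/measurable_EFinP.
have gf0 z : 0 <= g z * (f z)%:E by rewrite mule_ge0 ?lee_fin.
transitivity (\int[pushforward P JY]_z g z).
  by rewrite (ge0_integral_pushforward mJY)// preimage_setT.
transitivity (\int[with_density (law \x nu) mf f0]_z g z).
  by apply: eq_measure_integral => C mC _; exact: joint_law.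
rewrite integral_with_density// fubini_tonelli1//.
rewrite ge0_integral_pushforward// ?preimage_setT//.
- exact: measurable_fun_fubini_tonelli_F.
- by move=> s _; apply: integral_ge0.
Qed.

End disintegration.

(** * One-variable Taylor bounds and self-concordance *)

Section calculus.
Context {R : realType}.
Implicit Types (f m : R -> R) (x y z t L c k : R).

Lemma le_of_deriv_ge0 f f1 :
  (forall t, is_derive t 1 f (f1 t)) ->
  (forall t, 0 <= t <= 1 -> 0 <= f1 t) -> f 0 <= f 1.
Proof.
move=> ff1 f1_ge0.
have [|c c01 E] := @MVT R f f1 0 1 ltr01.
  by apply: derivable_within_continuous => x _; have [] := ff1 x.
rewrite -subr_ge0 E subr0 mulr1 f1_ge0//.
by move: c01; rewrite in_itv /= => /andP[/ltW -> /ltW ->].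
Qed.

Lemma taylor1_concave f f1 f2 :
  (forall t, is_derive t 1 f (f1 t)) ->
  (forall t, is_derive t 1 f1 (f2 t)) ->
  (forall t, 0 <= t <= 1 -> f2 t <= 0) -> f 1 <= f 0 + f1 0.
Proof.
move=> ff1 ff2 f2_le0.
have f1_noninc t : 0 <= t <= 1 -> f1 t <= f1 0.
  move=> /andP[t0 t1]; rewrite le_eqVlt in t0.
  case/orP: t0 => [/eqP <-//|t0].
  have [|c ct E] := @MVT R f1 f2 0 t t0.
    by apply: derivable_within_continuous => x _; have [] := ff2 x.
  rewrite -subr_le0 E subr0 mulr_le0_ge0 ?(ltW t0)// f2_le0//.
  move: ct; rewrite in_itv /= => /andP[/ltW -> /ltW ct /=].
  exact: le_trans ct t1.
have [|c c01 E] := @MVT R f f1 0 1 ltr01.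
  by apply: derivable_within_continuous => x _; have [] := ff1 x.
rewrite -lerBlDl E subr0 mulr1 f1_noninc//.
by move: c01; rewrite in_itv /= => /andP[/ltW -> /ltW ->].
Qed.

Lemma is_derive_line f f1 x y t : (forall t, is_derive t 1 f (f1 t)) ->
  is_derive t 1 (fun t => f (x + t * y)) (y * f1 (x + t * y)).
Proof.
have D : is_derive t (1 : R) (fun t => x + t * y) y.
  have -> : (fun t => x + t * y) = cst x + cst y * id.
    by apply/funext => u; rewrite [t in _ = t]/= mulrC.
  by apply: is_derive_eq; rewrite scaler0 addr0 add0r /GRing.scale/= mulr1.
move=> ff1; have := @is_derive1_comp _ _ _ t _ _ (ff1 (x + t * y)) D.
by rewrite mulrC.
Qed.

Lemma is_derive_scale_sqr c t : is_derive t 1 (fun t => c * t ^+ 2) (c * (2 * t)).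
Proof.
rewrite [X in is_derive _ _ X](_ : _ = cst c * (id ^+ 2))//.
by apply: is_derive_eq; rewrite scaler0 addr0 /GRing.scale/= mulr1 expr1.
Qed.

Lemma is_derive_scale_linear c k t : is_derive t 1 (fun t => c * (k * t)) (c * k).
Proof.
rewrite [X in is_derive _ _ X](_ : _ = cst c * (cst k * id))//.
by apply: is_derive_eq; rewrite !scaler0 !addr0 /GRing.scale/= mulr1.
Qed.

Lemma taylor2_le f f1 f2 x y L :
  (forall t, is_derive t 1 f (f1 t)) ->
  (forall t, is_derive t 1 f1 (f2 t)) ->
  (forall t, 0 <= t <= 1 -> f2 (x + t * y) <= L) ->
  f (x + y) <= f x + f1 x * y + L / 2 * y ^+ 2.
Proof.
move=> ff1 ff2 f2L; pose c := L / 2 * y ^+ 2.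
pose D t := f (x + t * y) - c * t ^+ 2.
pose D1 t := y * f1 (x + t * y) - c * (2 * t).
pose D2 t := y * (y * f2 (x + t * y)) - c * 2.
have := @taylor1_concave D D1 D2; rewrite /D /D1 !mul1r !mul0r !addr0 expr1n
  expr0n /= !mulr0 !subr0 mulr1 lerBlDr [f1 x * y]mulrC.
apply.
- move=> t; apply: is_deriveB; first exact: is_derive_line.
  exact: is_derive_scale_sqr.
- move=> t; apply: is_deriveB; last exact: is_derive_scale_linear.
  rewrite [X in is_derive _ _ X](_ : _ = cst y * (fun t => f1 (x + t * y)))//.
  have := @is_derive_line f1 f2 x y t ff2 => ?.
  by apply: is_derive_eq; rewrite scaler0 addr0.
- move=> t t01; rewrite /D2 subr_le0 mulrA -expr2.
  have -> : c * 2 = y ^+ 2 * L by rewrite /c; field.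
  by apply: ler_wpM2l; rewrite ?sqr_ge0// f2L.
Qed.

(** Equivalent to (2 - x) e^x <= 2 + x, the comparison of exp with its first diagonal Pade
    approximant. The derivative of the difference is 1 - (1 - x) e^x, which is nonnegative because 1
    - x <= e^(-x). *)
Lemma expR_pade x : 0 <= x -> x ^+ 2 / (2 + x) <= expR (- x) - 1 + x.
Proof.
move=> x0; have x2 : 0 < 2 + x by lra.
suff H : 0 <= 2 + x - (2 - x) * expR x.
  rewrite ler_pdivrMr//.
  have : 0 <= (2 + x - (2 - x) * expR x) * expR (- x) by rewrite mulr_ge0// expR_ge0.
  by rewrite mulrBl -mulrA -expRD subrr expR0; lra.
pose D t := 2 + (0 + t * x) - (2 - (0 + t * x)) * expR (0 + t * x).
pose D1 t := x * (1 - (1 - (0 + t * x)) * expR (0 + t * x)).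
have := @le_of_deriv_ge0 D D1; rewrite /D !mul1r mul0r !add0r expR0.
rewrite addr0 subr0 mulr1 subrr; apply.
- move=> t.
  pose F (u : R) := (2 + u - (2 - u) * expR u).
  pose F1 (u : R) := (1 - (1 - u) * expR u).
  have dF (u : R) : is_derive u 1 F (F1 u).
    rewrite /F [X in is_derive _ _ X](_ : _ = cst 2 + id - (cst 2 - id) * expR)//.
    by apply: is_derive_eq; rewrite /F1 /GRing.scale/= !fctE/=; ring.
  exact: (@is_derive_line F F1 0 x t dF).
- move=> t /andP[t0 t1]; rewrite /D1 mulr_ge0// add0r subr_ge0.
  have /(ler_wpM2r (expR_ge0 (t * x))) : 1 - t * x <= expR (- (t * x)).
    by rewrite expR_ge1Dx.
  by rewrite -expRD addNr expR0.
Qed.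

Section self_concordance.
Variables (m0 m1 m2 m3 : R -> R) (Rm : R).
Hypothesis dm0 : forall t, is_derive t 1 m0 (m1 t).
Hypothesis dm1 : forall t, is_derive t 1 m1 (m2 t).
Hypothesis dm2 : forall t, is_derive t 1 m2 (m3 t).
Hypothesis Rm0 : 0 <= Rm.
Hypothesis sc : forall z, `|m3 z| <= Rm * m2 z.

(** A Gronwall argument: self-concordance makes m2 (z + t y) exp (t Rm |y|) nondecreasing in t. *)
Lemma sc_growth_ge z y : m2 z * expR (- (Rm * `|y|)) <= m2 (z + y).
Proof.
pose D t := m2 (z + t * y) * expR (0 + t * (Rm * `|y|)).
pose D1 t := (y * m3 (z + t * y) + Rm * `|y| * m2 (z + t * y))
  * expR (0 + t * (Rm * `|y|)).
have : D 0 <= D 1.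
  apply: (@le_of_deriv_ge0 D D1) => t.
    have d1 := @is_derive_line m2 m3 z y t dm2.
    have d2 := @is_derive_line expR expR 0 (Rm * `|y|) t (@is_derive_expR R).
    rewrite /D [X in is_derive _ _ X](_ : _ = (fun t => m2 (z + t * y)) *
      (fun t => expR (0 + t * (Rm * `|y|))))//.
    by apply: is_derive_eq; rewrite /D1 /GRing.scale/=; ring.
  move=> _; rewrite /D1 mulr_ge0 ?expR_ge0//.
  have := ler_wpM2l (normr_ge0 y) (sc (z + t * y)); rewrite -normrM.
  by rewrite ler_norml => /andP[+ _]; lra.
rewrite /D !mul0r !mul1r !addr0 add0r expR0 mulr1 => H.
by rewrite expRN ler_pdivrMr ?expR_gt0.
Qed.

Lemma sc_growth_le z y : m2 (z + y) <= m2 z * expR (Rm * `|y|).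
Proof.
have := sc_growth_ge (z + y) (- y); rewrite addrK normrN expRN.
by rewrite ler_pdivrMr ?expR_gt0.
Qed.

(** This is the origin of eta = 1 + R S: integrating [sc_growth_ge] twice gives the quadratic
    coefficient m2 z / (2 + Rm |y|), and |y| is at most the diameter 2 S of the parameter range. *)
Lemma sc_lower z y S : 0 < Rm -> 0 <= m2 z -> `|y| <= 2 * S ->
  m0 z + m1 z * y + m2 z * y ^+ 2 / (2 * (1 + Rm * S)) <= m0 (z + y).
Proof.
move=> Rm_gt0 m2z yS.
have [->|y0] := eqVneq y 0; first by rewrite expr0n /= !mulr0 mul0r !addr0.
have ny : 0 < `|y| by rewrite normr_gt0.
pose rho := Rm * `|y|; have rho0 : 0 < rho by rewrite mulr_gt0.
(* With this factor, k exp (- t rho) has second derivative y^2 m2 z exp (- t rho), which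
   [sc_growth_ge] bounds by that of m0 (z + t y). So [D] is concave and lies below its tangent at
   0. *)
pose k := y ^+ 2 * m2 z / rho ^+ 2.
pose D t := k * expR (0 + t * (- rho)) - m0 (z + t * y).
pose D1 t := k * (- rho * expR (0 + t * (- rho))) - y * m1 (z + t * y).
pose D2 t := k * (- rho * (- rho * expR (0 + t * (- rho)))) -
  y * (y * m2 (z + t * y)).
have : D 1 <= D 0 + D1 0.
  apply: (@taylor1_concave D D1 D2) => t.
  - have d1 := @is_derive_line m0 m1 z y t dm0.
    have d2 := @is_derive_line expR expR 0 (- rho) t (@is_derive_expR R).
    rewrite /D [X in is_derive _ _ X](_ : _ = cst k * (fun t => expR (0 + t * - rho)) -
      (fun t => m0 (z + t * y)))//.
    by apply: is_derive_eq; rewrite /D1 /GRing.scale/= /cst; ring.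
  - have d1 := @is_derive_line m1 m2 z y t dm1.
    have d2 := @is_derive_line expR expR 0 (- rho) t (@is_derive_expR R).
    rewrite /D1 [X in is_derive _ _ X](_ : _ =
      cst k * (cst (- rho) * (fun t => expR (0 + t * - rho))) -
      cst y * (fun t => m1 (z + t * y)))//.
    by apply: is_derive_eq; rewrite /D2 /GRing.scale/= /cst; ring.
  - move=> /andP[t0 t1]; rewrite /D2.
    have -> : k * (- rho * (- rho * expR (0 + t * - rho))) =
        y ^+ 2 * (m2 z * expR (- (t * rho))).
      by rewrite add0r mulrN /k; field; rewrite gt_eqF.
    rewrite [y * (y * _)]mulrA -expr2 -mulrBr mulr_ge0_le0 ?sqr_ge0// subr_le0.
    have := sc_growth_ge z (t * y).
    by rewrite normrM (ger0_norm t0) mulrCA.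
rewrite /D /D1 !mul1r !mul0r !addr0 !add0r expR0 mulr1 => H.
have P := expR_pade (ltW rho0).
have k0 : 0 <= k by apply: divr_ge0; [apply: mulr_ge0 => //|]; exact: sqr_ge0.
have : k * (rho ^+ 2 / (2 + rho)) <= k * (expR (- rho) - 1 + rho).
  by rewrite ler_wpM2l.
have -> : k * (rho ^+ 2 / (2 + rho)) = y ^+ 2 * m2 z / (2 + rho).
  by rewrite /k; field; rewrite !gt_eqF//; lra.
have : m2 z * y ^+ 2 / (2 * (1 + Rm * S)) <= y ^+ 2 * m2 z / (2 + rho).
  rewrite [y ^+ 2 * _]mulrC; apply: ler_wpM2l.
    by rewrite mulr_ge0 ?sqr_ge0.
  rewrite lef_pV2.
  - by have := ler_wpM2l Rm0 yS; rewrite /rho; lra.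
  - have S0 : 0 <= S by move: yS ny; lra.
    by rewrite posrE; have := mulr_ge0 Rm0 S0; lra.
  - by rewrite posrE; lra.
by move: H; lra.
Qed.

(** The exponential factor is kept because this bound is integrated over a Gaussian variable, for
    which |y| has no bound. *)
Lemma sc_upper z y : 0 <= m2 z ->
  m0 (z + y) <= m0 z + m1 z * y + m2 z * expR (Rm * `|y|) / 2 * y ^+ 2.
Proof.
move=> m2z; apply: (taylor2_le dm0 dm1) => t /andP[t0 t1].
apply: le_trans (sc_growth_le _ _) _; rewrite ler_wpM2l// ler_expR ler_wpM2l//.
by rewrite normrM (ger0_norm t0) ler_piMl.
Qed.

End self_concordance.

End calculus.

(** * Gaussian integrals and the lower bound on the mixture *)

Section gauss_mixture.
Context {R : realType}.
Local Notation leb := (@lebesgue_measure R).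

(** Integrability travels with the value, so that linear combinations can be integrated without
    separate side conditions. *)
Definition integral_is (f : R -> R) (c : R) :=
  leb.-integrable setT (EFin \o f) /\ (\int[leb]_x (f x)%:E = c%:E)%E.

Lemma integral_isD f g c e : integral_is f c -> integral_is g e ->
  integral_is (fun x => f x + g x) (c + e).
Proof.
move=> [fi fc] [gi ge]; split.
  rewrite (_ : EFin \o _ = (EFin \o f) \+ (EFin \o g))//; exact: integrableD.
by rewrite EFinD -fc -ge; exact: (integralD_EFin measurableT fi gi).
Qed.

Lemma integral_isZ f c a : integral_is f c ->
  integral_is (fun x => a * f x) (a * c).
Proof.
move=> [fi fc]; split.
  rewrite (_ : EFin \o _ = (fun x => a%:E * (EFin \o f) x)%E)//; exact: integrableZl.
by rewrite EFinM -fc; exact: (integralZl measurableT fi).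
Qed.

Lemma integral_is_le f g c e : integral_is f c -> integral_is g e ->
  (forall x, f x <= g x) -> c <= e.
Proof.
move=> [fi fc] [gi ge] fg; rewrite -lee_fin -fc -ge.
by apply: le_integral => // x _; rewrite lee_fin.
Qed.

(** The majorant [g] may have an infinite integral, whence the inequality in the extended reals; the
    minorant [f] may change sign. *)
Lemma integral_is_le_ge0 (f g : R -> R) c : integral_is f c ->
  measurable_fun setT g -> (forall x, 0 <= g x) ->
  (forall x, f x <= g x) -> (c%:E <= \int[leb]_x (g x)%:E)%E.
Proof.
move=> [fi fc] mg g0 fg; rewrite -fc integralE.
apply: (@le_trans _ _ (\int[leb]_x (EFin \o f)^\+ x)%E).
  rewrite leeBlDr ?leeDl ?integral_ge0//.
  by have := integrable_neg_fin_num measurableT fi.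
apply: ge0_le_integral => //.
- by apply: measurable_funepos; have := measurable_int leb fi.
- exact/measurable_EFinP.
- by move=> x _; rewrite funeposE /= -EFin_max lee_fin ge_max fg g0.
Qed.

Lemma integral_is_normal_pdf d s : integral_is (normal_pdf d s) 1.
Proof. by split; [exact: integrable_normal_pdf|exact: integral_normal_pdf]. Qed.

Section centered.
Variables (d s : R).
Hypothesis s0 : 0 < s.
Let p := normal_pdf d s.

Let s_neq0 : s != 0. Proof. by rewrite gt_eqF. Qed.

(** For a > 1 this reads off exponential moments of (x - d)^2 from the normalisation of a wider
    Gaussian. With u = (x - d) / s, the values a = sqrt 2 and a = sqrt (4/3) give the integrals of
    exp (u^2 / 4) and exp (u^2 / 8). *)
Lemma normal_pdf_rescale a x : 0 < a ->
  p x * expR ((1 - a ^- 2) * (x - d) ^+ 2 / (2 * s ^+ 2)) =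
  a * normal_pdf d (a * s) x.
Proof.
move=> a0; rewrite /p !normal_pdfE ?mulf_neq0 ?gt_eqF// /normal_peak /normal_fun.
have -> : a * ((Num.sqrt ((a * s) ^+ 2 * pi *+ 2))^-1 *
    expR (- (x - d) ^+ 2 / ((a * s) ^+ 2 *+ 2))) =
    (Num.sqrt (s ^+ 2 * pi *+ 2))^-1 * expR (- (x - d) ^+ 2 / ((a * s) ^+ 2 *+ 2)).
  rewrite mulrA; congr (_ * _).
  rewrite exprMn -mulrA -mulrnAr sqrtrM ?sqr_ge0// sqrtr_sqr (gtr0_norm a0).
  by rewrite invfM mulrA divff ?gt_eqF// mul1r.
rewrite -[LHS]mulrA -expRD; congr (_ * expR _).
by field; rewrite s_neq0 gt_eqF.
Qed.

Lemma normal_pdf_shift t x :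
  normal_pdf (d + t) s x = p x * expR (t * (x - d) / s ^+ 2 - t ^+ 2 / (2 * s ^+ 2)).
Proof.
rewrite /p !normal_pdfE// /normal_peak /normal_fun -[RHS]mulrA -expRD.
by congr (_ * expR _); field.
Qed.

Lemma integral_is_rescale a : 0 < a ->
  integral_is (fun x => p x * expR ((1 - a ^- 2) * (x - d) ^+ 2 / (2 * s ^+ 2))) a.
Proof.
move=> a0; under [X in integral_is X]funext do rewrite normal_pdf_rescale//.
by rewrite -[X in integral_is _ X]mulr1; apply: integral_isZ; exact: integral_is_normal_pdf.
Qed.

(* The densities of the shifted laws integrate to 1 and dominate their tangents
   at shift 0, so the first moment I satisfies t * I <= t ^+ 2 / 2 for all t. *)
Lemma integral_is_moment1 : integral_is (fun x => p x * (x - d)) 0.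
Proof.
have pi : leb.-integrable setT (EFin \o (fun x => p x * (x - d))).
  pose a := Num.sqrt 2 : R.
  have a0 : 0 < a by rewrite sqrtr_gt0.
  have [bi _] := integral_isD (integral_isZ (1 + s ^+ 2) (integral_is_normal_pdf d s))
   (integral_isZ (4 * s ^+ 2) (integral_is_rescale a0)).
  apply: le_integrable bi => //.
    apply/measurable_EFinP/measurable_funM; first exact: measurable_normal_pdf.
    exact: measurable_funB.
  move=> x _; rewrite lee_fin normrM.
  have p0 : 0 <= p x by exact: normal_pdf_ge0.
  rewrite (ger0_norm p0).
  apply: le_trans (ler_norm _).
  have E : (1 - a ^- 2) * (x - d) ^+ 2 / (2 * s ^+ 2) <= expR ((1 - a ^- 2) * (x - d) ^+ 2 / (2 * s ^+ 2)).
    by have := expR_ge1Dx ((1 - a ^- 2) * (x - d) ^+ 2 / (2 * s ^+ 2)); lra.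
  have {}E : (x - d) ^+ 2 / (4 * s ^+ 2) <= expR ((1 - a ^- 2) * (x - d) ^+ 2 / (2 * s ^+ 2)).
    apply: le_trans E; rewrite sqr_sqrtr//.
    by rewrite le_eqVlt; apply/orP; left; apply/eqP; field.
  rewrite ler_pdivrMr ?mulr_gt0 ?exprn_gt0// in E.
  have ab : `|x - d| <= 1 + (x - d) ^+ 2.
    by rewrite -real_normK ?num_real//; have := sqr_ge0 (`|x - d| - 1); have := sqr_ge0 `|x - d|; lra.
  rewrite -/p.
  have := ler_wpM2l p0 ab; have := ler_wpM2l p0 E.
  have := mulr_ge0 p0 (sqr_ge0 s); lra.
split=> //.
pose I := fine (\int[leb]_x (p x * (x - d))%:E)%E.
have II : integral_is (fun x => p x * (x - d)) I.
  by split => //; rewrite fineK//; exact: integrable_fin_num.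
have H t : t * I <= t ^+ 2 / 2.
  have := @integral_is_le (fun x => p x + (t / s ^+ 2) * (p x * (x - d)) +
    (- (t ^+ 2 / (2 * s ^+ 2))) * p x) _ _ _ _ (integral_is_normal_pdf (d + t) s).
  move=> /(_ _ (integral_isD (integral_isD (integral_is_normal_pdf _ _) (integral_isZ _ II))
    (integral_isZ _ (integral_is_normal_pdf _ _)))).
  have -> : 1 + t / s ^+ 2 * I + - (t ^+ 2 / (2 * s ^+ 2)) * 1 =
     1 + (t * I - t ^+ 2 / 2) / s ^+ 2 by field.
  move=> K; have {K} : 1 + (t * I - t ^+ 2 / 2) / s ^+ 2 <= 1.
    apply: K => x; rewrite normal_pdf_shift.
    have := ler_wpM2l (normal_pdf_ge0 d s x)
      (expR_ge1Dx (t * (x - d) / s ^+ 2 - t ^+ 2 / (2 * s ^+ 2))).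
    apply: le_trans; rewrite -/p.
    by rewrite le_eqVlt; apply/orP; left; apply/eqP; field.
  have : 0 < s ^+ 2 by rewrite exprn_gt0.
  move=> s2 K.
  have : (t * I - t ^+ 2 / 2) / s ^+ 2 <= 0 by lra.
  by rewrite pmulr_lle0 ?invr_gt0//; lra.
have I0 : I = 0.
  by have := H I; have := sqr_ge0 I; rewrite -expr2 => ? ?; apply/eqP; rewrite -sqrf_eq0; apply/eqP; lra.
by have [_ ->] := II; rewrite I0.
Qed.

End centered.

(** Follows from a |k| <= 2 a^2 + k^2 / 8 and k^2 <= 8 (exp (k^2 / 8) - 1). The right-hand side is
    chosen so that its Gaussian integral is explicit by [integral_is_rescale]. *)
Lemma gauss_cubic_bound (a k : R) : 2 * a ^+ 2 <= 7 / 16 ->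
  k ^+ 2 * expR (a * `|k|) <=
  8 * expR (7 / 16) * (expR (k ^+ 2 / 4) - expR (k ^+ 2 / 8)).
Proof.
move=> a7.
have H1 : expR (a * `|k|) <= expR (7 / 16) * expR (k ^+ 2 / 8).
  rewrite -expRD ler_expR.
  have := sqr_ge0 (a - `|k| / 4); rewrite -[k ^+ 2]real_normK ?num_real//; lra.
have H2 : k ^+ 2 <= 8 * (expR (k ^+ 2 / 8) - 1).
  by have := expR_ge1Dx (k ^+ 2 / 8); lra.
have -> : k ^+ 2 / 4 = k ^+ 2 / 8 + k ^+ 2 / 8 by field.
rewrite expRD.
have := ler_pM (sqr_ge0 k) (expR_ge0 (a * `|k|)) H2 H1.
by move/le_trans; apply; rewrite le_eqVlt; apply/orP; left; apply/eqP; ring.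
Qed.

(** The numerical fact behind the constant 7/32 of [gauss_mixture_lower], and so behind the 32/7 in
    the condition on lambda: the remainder integrates to at most [tau]. *)
Lemma expR_7_16 : 2 * expR (7 / 16) * (Num.sqrt 2 - Num.sqrt (4 / 3)) <= 1 :> R.
Proof.
have e : expR (7 / 16) <= 16 / 9 :> R.
  have := expR_ge1Dx (- (7 / 16) : R).
  rewrite expRN => /(ler_wpM2r (expR_ge0 (7 / 16))).
  by rewrite mulVf ?gt_eqF ?expR_gt0//; lra.
have s2 : Num.sqrt 2 <= 17 / 12 :> R.
  have <- : Num.sqrt ((17 / 12) ^+ 2) = 17 / 12 :> R.
    by rewrite sqrtr_sqr ger0_norm; lra.
  by apply: ler_wsqrtr; lra.
have s3 : 15 / 13 <= Num.sqrt (4 / 3) :> R.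
  have <- : Num.sqrt ((15 / 13) ^+ 2) = 15 / 13 :> R.
    by rewrite sqrtr_sqr ger0_norm; lra.
  by apply: ler_wsqrtr; lra.
have q0 : 0 <= 17 / 12 - 15 / 13 :> R by lra.
have : expR (7 / 16) * (Num.sqrt 2 - Num.sqrt (4 / 3)) <=
   expR (7 / 16) * (17 / 12 - 15 / 13) :> R.
  by rewrite ler_wpM2l ?expR_ge0//; lra.
have := ler_wpM2r q0 e; lra.
Qed.

Section mixture_bound.
Variables (m0 m1 m2 m3 : R -> R) (Rm gt r : R).
Hypothesis dm0 : forall t : R, is_derive t 1 m0 (m1 t).
Hypothesis dm1 : forall t : R, is_derive t 1 m1 (m2 t).
Hypothesis dm2 : forall t : R, is_derive t 1 m2 (m3 t).
Hypothesis Rm0 : 0 <= Rm.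
Hypothesis sc : forall z, `|m3 z| <= Rm * m2 z.
Hypothesis gt0 : 0 < gt.

Let l z := (m0 z - r * z) / gt.

(* Jensen's inequality for the law N(d, s ^+ 2) of the integration variable: in
   terms of z it is centred at z1, so the first-order terms vanish. *)
Lemma gauss_mixture_lower (z0 z1 v D al : R) : 0 < al -> 0 <= v -> 0 <= m2 z1 ->
  (z1 - z0) ^+ 2 <= v * D -> 0 <= D -> al * v * Rm ^+ 2 <= 7 / 32 ->
  ((expR (- l z1 - D / (2 * al) -
      (2 * al + 1 / 2) * ln (1 + m2 z1 / gt * v)))%:E <=
   \int[leb]_n (normal_pdf 0 1 n * expR (- l (z0 + Num.sqrt (al * v) * n)))%:E)%E.
Proof.
move=> al0 v0 m2z1 zD D0 alv.
pose hh := m2 z1 / gt; rewrite -/hh.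
have hh0 : 0 <= hh by rewrite divr_ge0// ltW.
have hhE : m2 z1 = hh * gt by rewrite /hh divfK// gt_eqF.
clearbody hh.
have mF : measurable_fun setT
    (fun n => normal_pdf 0 1 n * expR (- l (z0 + Num.sqrt (al * v) * n))).
  apply: measurable_funM; first exact: measurable_normal_pdf.
  apply: measurableT_comp => //; apply: measurableT_comp => //.
  rewrite /l; apply: measurable_funM => //.
  have mz : measurable_fun setT (fun n => z0 + Num.sqrt (al * v) * n).
    by apply: measurable_funD => //; exact: measurable_funM.
  apply: measurable_funB; last exact: measurable_funM.
  apply: measurableT_comp mz; apply: continuous_measurable_fun => t.
  by apply: differentiable_continuous; apply/derivable1_diffP; case: (dm0 t).
have [v_eq0|v_neq0] := eqVneq v 0.
  have z10 : z1 = z0.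
    move: zD; rewrite v_eq0 mul0r => zD.
    by apply/eqP; rewrite -subr_eq0 -sqrf_eq0 eq_le zD sqr_ge0.
  rewrite v_eq0 !mulr0 sqrtr0 addr0 ln1 mulr0 subr0.
  under eq_integral do rewrite mul0r addr0 mulrC.
  have [_ ->] := integral_isZ (expR (- l z0)) (integral_is_normal_pdf 0 1).
  rewrite lee_fin mulr1 z10 ler_expR gerBl divr_ge0//; lra.
have vpos : 0 < v by rewrite lt_def v_neq0.
pose sg := Num.sqrt (al * v); rewrite -/sg in mF *.
have sg0 : 0 < sg by rewrite sqrtr_gt0 mulr_gt0.
have sg2 : sg ^+ 2 = al * v by rewrite sqr_sqrtr// mulr_ge0// ltW.
pose w := 1 + hh * v; rewrite -/w.
have w1 : 1 <= w by rewrite lerDl mulr_ge0.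
have w0 : 0 < w by lra.
(* Shrinking the deviation from 1 to this value costs ln w / 2 in the normalisation and makes [tau]
   equal to 2 al (1 - 1/w), at most 2 al ln w. These are the two parts of the coefficient 2 al +
   1/2. *)
pose s := (Num.sqrt w)^-1.
have s0 : 0 < s by rewrite invr_gt0 sqrtr_gt0.
have s2 : s ^+ 2 = w^-1 by rewrite exprVn sqr_sqrtr// ltW.
pose d := (z1 - z0) / sg.
pose p := normal_pdf d s.
pose c0 := - l z1 - ln w / 2 - d ^+ 2 / 2.
pose tau := 2 * hh * sg ^+ 2 * s ^+ 2.
pose be := - (d + (m1 z1 - r) / gt * sg).
pose C := 4 * hh * sg ^+ 2 * s ^+ 2 * expR (7 / 16).
pose a1 : R := Num.sqrt 2.
pose a2 : R := Num.sqrt (4 / 3).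
have a10 : 0 < a1 by rewrite sqrtr_gt0; lra.
have a20 : 0 < a2 by rewrite sqrtr_gt0; lra.
have C0 : 0 <= C by rewrite /C !mulr_ge0 ?expR_ge0 ?(ltW sg0) ?(ltW s0).
pose q a x := p x * expR ((1 - a ^- 2) * (x - d) ^+ 2 / (2 * s ^+ 2)).
(* Jensen's inequality by hand: exp (tau + be k - E) is replaced by its tangent 1 + tau + be k - E,
   and E by its bound in terms of [q a1] and [q a2]. The first moment vanishes and [expR_7_16] says
   that C (a1 - a2) <= tau, so the bracket integrates to at least 1. *)
pose F x := expR (c0 - tau) * ((1 + tau) * p x + be * (p x * (x - d)) +
   (- C * q a1 x + C * q a2 x)).
have FI : integral_is F (expR (c0 - tau) * ((1 + tau) * 1 + be * 0 +
   (- C * a1 + C * a2))).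
  apply: integral_isZ; apply: integral_isD; apply: integral_isD; apply: integral_isZ.
  - exact: integral_is_normal_pdf.
  - exact: integral_is_moment1.
  - exact: integral_is_rescale.
  - exact: integral_is_rescale.
apply: (@le_trans _ _ (expR (c0 - tau) * ((1 + tau) * 1 + be * 0 +
   (- C * a1 + C * a2)))%:E).
  rewrite lee_fin -[leLHS]mulr1; apply: ler_pM; rewrite ?expR_ge0 ?ler_expR//.
    have dD : d ^+ 2 <= D / al.
      rewrite expr_div_n sg2 ler_pdivrMr ?mulr_gt0// (le_trans zD)//.
      by rewrite le_eqVlt; apply/orP; left; apply/eqP; field; rewrite gt_eqF.
    have lnw : 1 - w^-1 <= ln w.
      have := @le_ln1Dx R (w^-1 - 1); rewrite [1 + _]addrC subrK lnV ?posrE//.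
      by have := w0; rewrite -invr_gt0 => ? /(_ _); lra.
    have -> : D / (2 * al) = D / al / 2 by field; rewrite gt_eqF.
    have : tau <= 2 * al * ln w.
      apply: le_trans (ler_wpM2l _ lnw); last lra.
      rewrite /tau s2 sg2 le_eqVlt; apply/orP; left; apply/eqP.
      by rewrite /w; field; rewrite -/w gt_eqF.
    rewrite /c0; lra.
  have := expR_7_16; rewrite -/a1 -/a2 => H.
  have T0 : 0 <= tau by rewrite /tau !mulr_ge0 ?(ltW sg0) ?(ltW s0).
  have := ler_wpM2l T0 H; rewrite mulr1.
  have -> : tau * (2 * expR (7 / 16) * (a1 - a2)) = C * a1 - C * a2.
    by rewrite /tau /C; ring.
  lra.
apply: integral_is_le_ge0 FI mF _ _ => x.
  by rewrite mulr_ge0 ?normal_pdf_ge0 ?expR_ge0.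
pose k := x - d.
have zx : z0 + sg * x = z1 + sg * k by rewrite /k /d; field; rewrite gt_eqF.
have p0 : 0 <= p x by exact: normal_pdf_ge0.
pose E := hh / 2 * (sg * k) ^+ 2 * expR (Rm * `|sg * k|).
(* The exact ratio of the two densities has the further factor exp (k^2 (w - 1) / 2), which is at
   least 1 and is dropped. *)
have phi : p x * expR (- ln w / 2 - d ^+ 2 / 2 - d * k) <= normal_pdf 0 1 x.
  have -> : - ln w / 2 = ln s.
    by rewrite lnV ?posrE ?sqrtr_gt0// -[Num.sqrt w]powR12_sqrt ?(ltW w0)// ln_powR; lra.
  rewrite /p !normal_pdfE ?oner_eq0 ?gt_eqF// /normal_peak /normal_fun.
  rewrite -addrA expRD lnK ?posrE// expr1n mul1r subr0.
  have -> : Num.sqrt (s ^+ 2 * pi *+ 2) = s * Num.sqrt (pi *+ 2) :> R.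
    by rewrite -mulrnAr sqrtrM ?sqr_ge0// sqrtr_sqr gtr0_norm.
  rewrite invfM.
  have -> : s^-1 / Num.sqrt (pi *+ 2) * expR (- (x - d) ^+ 2 / (s ^+ 2 *+ 2)) *
    (s * expR (- (d ^+ 2 / 2) - d * k)) = (Num.sqrt (pi *+ 2))^-1 *
    (expR (- (x - d) ^+ 2 / (s ^+ 2 *+ 2)) * expR (- (d ^+ 2 / 2) - d * k)) * (s / s).
    ring.
  rewrite divff ?gt_eqF// mulr1 -expRD; apply: ler_wpM2l.
    by rewrite invr_ge0 sqrtr_ge0.
  rewrite ler_expR -/k.
  have -> : x = k + d by rewrite /k subrK.
  have -> : - k ^+ 2 / (s ^+ 2 *+ 2) = - (k ^+ 2 * w) / 2.
    by rewrite -mulr_natr s2; field; rewrite gt_eqF.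
  have := ler_wpM2l (sqr_ge0 k) w1; rewrite mulr1 -[1 *+ 2]/(2 : R); lra.
have ell : - l z1 - (m1 z1 - r) / gt * (sg * k) - E <= - l (z0 + sg * x).
  rewrite zx.
  have := sc_upper dm0 dm1 dm2 Rm0 sc (sg * k) m2z1 => U.
  suff : 0 <= (m0 z1 + m1 z1 * (sg * k) + m2 z1 * expR (Rm * `|sg * k|) / 2 * (sg * k) ^+ 2
     - m0 (z1 + sg * k)) / gt.
    rewrite /l /E => H; rewrite -subr_ge0; apply: le_trans H _.
    by rewrite hhE le_eqVlt; apply/orP; left; apply/eqP; field; rewrite gt_eqF.
  by rewrite divr_ge0 ?(ltW gt0)//; lra.
have EC : E <= C * (expR ((k / s) ^+ 2 / 4) - expR ((k / s) ^+ 2 / 8)).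
  have a7 : 2 * (Rm * sg * s) ^+ 2 <= 7 / 16.
    rewrite !exprMn sg2 s2.
    have : Rm ^+ 2 * (al * v) / w <= Rm ^+ 2 * (al * v).
      rewrite ler_pdivrMr// ler_peMr// mulr_ge0 ?sqr_ge0// mulr_ge0// ltW//.
    by lra.
  have := gauss_cubic_bound (k / s) a7.
  have c2 : 0 <= hh / 2 * sg ^+ 2 * s ^+ 2 by rewrite !mulr_ge0 ?(ltW sg0) ?(ltW s0).
  move/(ler_wpM2l c2); rewrite /E /C.
  have -> : Rm * sg * s * `|k / s| = Rm * `|sg * k|.
    rewrite !normrM normfV (gtr0_norm s0) (gtr0_norm sg0); field; rewrite gt_eqF//.
  move=> H; apply: le_trans (le_trans _ H) _; rewrite le_eqVlt; apply/orP; left; apply/eqP.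
    by field; rewrite gt_eqF.
  by field.
apply: (@le_trans _ _ (p x * expR (c0 + be * k - E))); last first.
  apply: le_trans (ler_wpM2r (expR_ge0 _) phi); rewrite -mulrA -expRD.
  rewrite ler_wpM2l// ler_expR; apply: le_trans (lerD (lexx _) ell).
  by rewrite le_eqVlt; apply/orP; left; apply/eqP; rewrite /c0 /be; field; rewrite gt_eqF.
have -> : c0 + be * k - E = (c0 - tau) + (tau + be * k - E) by ring.
rewrite expRD /F [leRHS]mulrCA; apply: ler_wpM2l; first exact: expR_ge0.
have e1 := expR_ge1Dx (tau + be * k - E).
apply: le_trans (ler_wpM2l p0 e1).
have q1 : q a1 x = p x * expR ((k / s) ^+ 2 / 4).
  rewrite /q sqr_sqrtr//; congr (_ * expR _); rewrite -/k; field; rewrite gt_eqF//.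
have q2 : q a2 x = p x * expR ((k / s) ^+ 2 / 8).
  rewrite /q sqr_sqrtr; last lra.
  by congr (_ * expR _); rewrite -/k; field; rewrite gt_eqF.
rewrite q1 q2 -/k; have := ler_wpM2l p0 EC; lra.
Qed.

End mixture_bound.

End gauss_mixture.

(** * Quadratic forms, determinants and traces *)

Section quadratic_forms.
Context {R : realType}.

Definition bilf d (M : 'M[R]_d) (x y : 'cV[R]_d) : R := (x^T *m M *m y) 0 0.

Lemma mx11_sum (A B : 'M[R]_1) : (A + B) 0 0 = A 0 0 + B 0 0.
Proof. by rewrite mxE. Qed.

Section basic.
Context {d : nat}.
Implicit Types (x y z : 'cV[R]_d) (M N : 'M[R]_d) (a : R).

Lemma dotvE x y : dotv x y = bilf 1%:M x y.
Proof. by rewrite /bilf mulmx1. Qed.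

Lemma bilfDl M x y z : bilf M (x + y) z = bilf M x z + bilf M y z.
Proof. by rewrite /bilf linearD /= !mulmxDl mxE. Qed.

Lemma bilfDr M x y z : bilf M x (y + z) = bilf M x y + bilf M x z.
Proof. by rewrite /bilf mulmxDr mxE. Qed.

Lemma bilfZl M a x y : bilf M (a *: x) y = a * bilf M x y.
Proof. by rewrite /bilf linearZ /= -!scalemxAl mxE. Qed.

Lemma bilfZr M a x y : bilf M x (a *: y) = a * bilf M x y.
Proof. by rewrite /bilf -scalemxAr mxE. Qed.

Lemma bilfNl M x y : bilf M (- x) y = - bilf M x y.
Proof. by rewrite -scaleN1r bilfZl mulN1r. Qed.

Lemma bilfNr M x y : bilf M x (- y) = - bilf M x y.
Proof. by rewrite -scaleN1r bilfZr mulN1r. Qed.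

Lemma bilf_mxD M N x y : bilf (M + N) x y = bilf M x y + bilf N x y.
Proof. by rewrite /bilf mulmxDr mulmxDl mxE. Qed.

Lemma bilf_mxZ a M x y : bilf (a *: M) x y = a * bilf M x y.
Proof. by rewrite /bilf -scalemxAr -scalemxAl mxE. Qed.

Lemma bilf_scalar a x y : bilf a%:M x y = a * dotv x y.
Proof. by rewrite -scalemx1 bilf_mxZ dotvE. Qed.

Lemma bilfC M x y : M^T = M -> bilf M x y = bilf M y x.
Proof.
move=> MT; rewrite /bilf -[in LHS](trmxK (x^T *m M *m y)) mxE.
by rewrite !trmx_mul trmxK MT mulmxA.
Qed.

Lemma bilf_dotv M x y : bilf M x y = dotv x (M *m y).
Proof. by rewrite /bilf /dotv mulmxA. Qed.

Lemma dotvC x y : dotv x y = dotv y x.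
Proof. by rewrite !dotvE bilfC// trmx1. Qed.

Lemma dotv_sum x y : dotv x y = \sum_i x i 0 * y i 0.
Proof. by rewrite /dotv mxE; apply: eq_bigr => i _; rewrite mxE. Qed.

Lemma dotv_ge0 x : 0 <= dotv x x.
Proof. by rewrite dotv_sum sumr_ge0// => i _; rewrite -expr2 sqr_ge0. Qed.

Lemma dotv_eq0 x : dotv x x = 0 -> x = 0.
Proof.
rewrite dotv_sum => /eqP; rewrite psumr_eq0; last by move=> i _; rewrite -expr2 sqr_ge0.
move=> /allP x0; apply/colP => i; rewrite mxE.
by have := x0 i (mem_index_enum i); rewrite mulf_eq0 orbb => /eqP.
Qed.

Lemma wnormE M x : wnorm M x = Num.sqrt (bilf M x x).
Proof. by []. Qed.

Lemma bilf_rank1 h x y : bilf (h *: (x *m x^T)) y y = h * (dotv x y) ^+ 2.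
Proof.
rewrite bilf_mxZ; congr (_ * _); rewrite /bilf mulmxA -mulmxA.
by rewrite mxE big_ord1 -/(dotv y x) -/(dotv x y) dotvC expr2.
Qed.

Definition psd M := M^T = M /\ forall x, 0 <= bilf M x x.

Lemma psd_CS M x y : psd M -> bilf M x y ^+ 2 <= bilf M x x * bilf M y y.
Proof.
move=> [MT M0].
(* When y is isotropic the form is affine along y, and it stays nonnegative only if the slope
   [bilf M x y] is 0. *)
have [c0|c_neq0] := eqVneq (bilf M y y) 0.
  have H t : 0 <= bilf M x x + t * bilf M x y.
    have := M0 (x + (t / 2) *: y).
    rewrite !(bilfDl, bilfDr, bilfZl, bilfZr) (bilfC y x MT) c0.
    by move/le_trans; apply; lra.
  rewrite c0 mulr0; have := H (- (bilf M x x + 1) / bilf M x y).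
  have [->|b0] := eqVneq (bilf M x y) 0; first by rewrite expr0n.
  by rewrite divfK//; lra.
have c_gt0 : 0 < bilf M y y by rewrite lt_def c_neq0 M0.
have := M0 (x + (- bilf M x y / bilf M y y) *: y).
rewrite !(bilfDl, bilfDr, bilfZl, bilfZr) (bilfC y x MT).
move=> /(mulr_ge0 (ltW c_gt0)) H; rewrite -subr_ge0; apply: le_trans H _.
by rewrite le_eqVlt; apply/orP; left; apply/eqP; field.
Qed.

Lemma dotv_CS x y : dotv x y ^+ 2 <= dotv x x * dotv y y.
Proof.
by rewrite !dotvE; apply: psd_CS; split; [exact: trmx1|move=> z; rewrite -dotvE dotv_ge0].
Qed.

Lemma norm2_sqr x : norm2 x ^+ 2 = dotv x x.
Proof. by rewrite sqr_sqrtr// dotv_ge0. Qed.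

Lemma norm2_ge0 x : 0 <= norm2 x.
Proof. exact: sqrtr_ge0. Qed.

Lemma dotv_norm2 x y : `|dotv x y| <= norm2 x * norm2 y.
Proof.
rewrite -ler_sqr ?nnegrE ?mulr_ge0 ?norm2_ge0//.
by rewrite exprMn !norm2_sqr real_normK ?num_real// dotv_CS.
Qed.

Lemma norm2D x y : norm2 (x + y) <= norm2 x + norm2 y.
Proof.
rewrite -ler_sqr ?nnegrE ?addr_ge0 ?norm2_ge0// sqrrD !norm2_sqr.
rewrite !dotvE !(bilfDl, bilfDr) -!dotvE (dotvC y x).
have := le_trans (ler_norm _) (dotv_norm2 x y); lra.
Qed.

Lemma norm2Z a x : 0 <= a -> norm2 (a *: x) = a * norm2 x.
Proof.
move=> a0; rewrite /norm2 !dotvE bilfZl bilfZr mulrA -expr2 sqrtrM ?sqr_ge0//.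
by rewrite sqrtr_sqr ger0_norm.
Qed.

Lemma norm2N x : norm2 (- x) = norm2 x.
Proof. by rewrite /norm2 !dotvE bilfNl bilfNr opprK. Qed.

End basic.

(** The bordered matrix [B] has two block triangular factorisations, eliminating one or the other
    off-diagonal block; their determinants are the two sides. *)
Lemma det_add_rank1 d (A : 'M[R]_d) (x : 'cV[R]_d) (h : R) :
  A \in unitmx ->
  \det (A + h *: (x *m x^T)) = \det A * (1 + h * bilf (invmx A) x x).
Proof.
move=> uA; pose B := block_mx (1%:M : 'M[R]_1) (- (h *: x^T)) x A.
transitivity (\det B).
  have -> : B = block_mx 1%:M 0 x 1%:M *m
      block_mx 1%:M (- (h *: x^T)) 0 (A + h *: (x *m x^T)).
    rewrite mulmx_block !mul1mx ?mul0mx ?mulmx1 ?mulmx0 ?addr0 mulmxN -scalemxAr.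
    by rewrite addrCA addNr addr0.
  by rewrite det_mulmx det_lblock det_ublock !det1 !mul1r.
have -> : B = block_mx 1%:M (- (h *: x^T *m invmx A)) 0 1%:M *m
      block_mx (1%:M + h *: (x^T *m invmx A *m x)) 0 x A.
  rewrite mulmx_block ?mul1mx ?mul0mx ?mulmx0 ?addr0 ?add0r ?mulNmx.
  by rewrite mulmxKV// -!scalemxAl addrK.
rewrite det_mulmx det_ublock det_lblock !det1 !mul1r mulrC; congr (_ * _).
by rewrite det_mx11 !mxE eqxx /bilf mxE.
Qed.


Definition posdef d (M : 'M[R]_d) :=
  M^T = M /\ forall x, x != 0 -> 0 < bilf M x x.

Lemma posdef_psd d (M : 'M[R]_d) : posdef M -> psd M.
Proof.
move=> [MT M0]; split=> // x; have [->|/M0/ltW//] := eqVneq x 0.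
by rewrite /bilf mulmx0 mxE.
Qed.

Lemma posdef_congr d (M L : 'M[R]_d) : L \in unitmx -> posdef M ->
  posdef (L *m M *m L^T).
Proof.
move=> uL [MT M0]; split; first by rewrite !trmx_mul trmxK MT mulmxA.
move=> x x0; have -> : bilf (L *m M *m L^T) x x = bilf M (L^T *m x) (L^T *m x).
  by rewrite /bilf trmx_mul trmxK !mulmxA.
apply: M0; apply: contra_neq x0 => Lx0.
have uLT : L^T \in unitmx by rewrite unitmx_tr.
by rewrite -(mulKmx uLT x) Lx0 mulmx0.
Qed.

Lemma posdef_scalar_lb d (M : 'M[R]_d) a : 0 < a -> M^T = M ->
  (forall x, a * dotv x x <= bilf M x x) -> posdef M.
Proof.
move=> a0 MT Ma; split=> // x x0; apply: lt_le_trans (Ma x).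
rewrite mulr_gt0// lt_def dotv_ge0 andbT.
by apply: contra_neq x0; exact: dotv_eq0.
Qed.

(** Both facts come from one elimination of the first coordinate, since the Schur complement is
    again positive definite. The congruence with the identity replaces a square root of [M], and the
    determinant bound is the sum of ln s <= s - 1 over the eigenvalues, obtained without a spectral
    theorem. *)
Lemma posdef_structure d (M : 'M[R]_d) : posdef M ->
  (exists2 L : 'M[R]_d, L \in unitmx & L *m M *m L^T = 1%:M) /\
  0 < \det M <= expR (\tr M - d%:R).
Proof.
elim: d M => [|d IH] M Mpos.
  split; first by exists 1%:M; [exact: unitmx1|apply/matrixP => -[]].
  by rewrite det_mx00 /mxtrace big_ord0 subrr expR0 ltr01 lexx.
rewrite -[d.+1]/(1 + d)%N in M Mpos *.
pose a := ulsubmx M 0 0; pose b := dlsubmx M; pose C := drsubmx M.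
have MT := Mpos.1.
have ME : M = block_mx a%:M b^T b C.
  rewrite -[LHS]submxK; congr block_mx; first by rewrite [LHS]mx11_scalar.
  by rewrite /b trmx_dlsub MT.
have CT : C^T = C by rewrite /C trmx_drsub MT.
have qM (t : R) (y : 'cV_d) : bilf M (col_mx t%:M y) (col_mx t%:M y) =
    t ^+ 2 * a + 2 * t * dotv b y + bilf C y y.
  rewrite ME /bilf tr_col_mx mul_row_block mul_row_col tr_scalar_mx.
  rewrite !mul_scalar_mx mul_mx_scalar mulmxDl -scalemxAl.
  have scE (k : R) (A : 'M[R]_1) : (k *: A) 0 0 = k * A 0 0 by rewrite mxE.
  rewrite !mx11_sum !scE mx11_sum !scE -/(dotv b y) -/(dotv y b) (dotvC y b).
  by rewrite mxE eqxx mulr1n; ring.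
have a0 : 0 < a.
  have := Mpos.2 (col_mx 1%:M 0); rewrite qM => H.
  have : 0 < 1 ^+ 2 * a + 2 * 1 * dotv b 0 + bilf C 0 0.
    apply: H; apply/eqP => /(congr1 (fun A => usubmx A 0 0)).
    by rewrite col_mxKu !mxE eqxx => /eqP; rewrite oner_eq0.
  have z0 : (0 : 'cV[R]_d) = 0 *: 0 by rewrite scale0r.
  by rewrite dotvE z0 !bilfZr; lra.
pose S := C - a^-1 *: (b *m b^T).
have Spos : posdef S.
  split; first by rewrite /S linearB linearZ /= trmx_mul trmxK CT.
  (* This first coordinate minimises the form of [M] for fixed y, and the minimum is the form of the
     Schur complement. *)
  move=> y y0; have := Mpos.2 (col_mx (- dotv b y / a)%:M y).
  rewrite qM /S -scaleNr bilf_mxD bilf_rank1 => H.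
  have : col_mx (- dotv b y / a)%:M y != 0.
    by apply: contra_neq y0 => /(congr1 dsubmx); rewrite col_mxKd linear0.
  move/H; congr (0 < _).
  by field; rewrite gt_eqF.
have [[L uL LS] /andP[S0 S1]] := IH S Spos.
pose E : 'M[R]_(1 + d) := block_mx 1%:M 0 (- a^-1 *: b) 1%:M.
have EM : E *m M *m E^T = block_mx a%:M 0 0 S.
  rewrite ME /E tr_block_mx !mulmx_block !trmx1 trmx0 linearZ /=.
  rewrite !mul1mx !mulmx1 !mul0mx !mulmx0 !addr0.
  have ab : - a^-1 *: b *m a%:M + b = 0.
    rewrite mul_mx_scalar scalerA mulrN divff ?gt_eqF// scaleN1r addNr//.
  rewrite ab mul0mx add0r; congr block_mx.
    rewrite mul_scalar_mx scalerA mulrN divff ?gt_eqF// scaleN1r addNr//.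
  by rewrite /S addrC -scalemxAl scaleNr.
have dE : \det E = 1 by rewrite det_lblock !det1 mulr1.
have dM : \det M = a * \det S.
  have := congr1 (fun A => \det A) EM; rewrite /= det_ublock det_scalar expr1.
  by rewrite !det_mulmx det_tr dE mul1r mulr1.
split.
  pose q := (Num.sqrt a)^-1.
  pose L' : 'M[R]_(1 + d) := block_mx q%:M 0 0 L.
  exists (L' *m E).
    rewrite unitmxE det_mulmx dE mulr1 det_ublock det_scalar expr1 unitrM.
    by rewrite -unitmxE uL andbT unitfE invr_eq0 gt_eqF// sqrtr_gt0.
  rewrite trmx_mul !mulmxA -(mulmxA L') -(mulmxA L') EM.
  rewrite tr_block_mx !trmx0 tr_scalar_mx !mulmx_block.
  rewrite !mulmx0 !mul0mx !addr0 !add0r LS -!scalar_mxM.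
  have -> : q * a * q = 1.
    by rewrite /q mulrAC -invfM -expr2 sqr_sqrtr ?(ltW a0)// mulVf ?gt_eqF.
  by rewrite !mul0mx -scalar_mx_block.
rewrite dM mulr_gt0//=.
have trM : \tr M = a + \tr C by rewrite ME mxtrace_block mxtrace_scalar mulr1n.
have trS : \tr S <= \tr C.
  rewrite /S linearB linearZ /= gerBl mulr_ge0 ?invr_ge0 ?(ltW a0)//.
  by rewrite mxtrace_mulC trace_mx11 -/(dotv b b) dotv_ge0.
apply: (@le_trans _ _ (expR (a - 1) * expR (\tr S - d%:R))).
  apply: ler_pM => //; [exact: ltW|exact: ltW|].
  by have := expR_ge1Dx (a - 1); rewrite [1 + _]addrC subrK.
by rewrite -expRD ler_expR trM natrD; lra.
Qed.

Lemma posdef_det_gt0 d (M : 'M[R]_d) : posdef M -> 0 < \det M.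
Proof. by case/posdef_structure => _ /andP[]. Qed.

Lemma posdef_unitmx d (M : 'M[R]_d) : posdef M -> M \in unitmx.
Proof. by move/posdef_det_gt0 => M0; rewrite unitmxE unitfE gt_eqF. Qed.

Lemma posdef_ln_det_le d (M : 'M[R]_d) : posdef M -> ln (\det M) <= \tr M - d%:R.
Proof.
move=> /posdef_structure[_ /andP[M0 M1]].
by rewrite -[leRHS]expRK ler_ln ?posrE ?expR_gt0.
Qed.

Lemma posdefZ d (M : 'M[R]_d) a : 0 < a -> posdef M -> posdef (a *: M).
Proof.
move=> a0 [MT M0]; split; first by rewrite linearZ /= MT.
by move=> x x0; rewrite bilf_mxZ mulr_gt0// M0.
Qed.

Lemma bilf_delta d (M : 'M[R]_d) i :
  bilf M (delta_mx i 0) (delta_mx i 0) = M i i.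
Proof. by rewrite /bilf trmx_delta -rowE -colE !mxE. Qed.

Lemma posdef_trace_gt0 d (M : 'M[R]_d) : (0 < d)%N -> posdef M -> 0 < \tr M.
Proof.
move=> d0 [_ M0]; have diag i : 0 < M i i.
  rewrite -bilf_delta M0//; apply/eqP => /matrixP/(_ i 0)/eqP.
  by rewrite !mxE !eqxx oner_eq0.
rewrite /mxtrace (bigD1 (Ordinal d0))//= ltr_wpDr// sumr_ge0// => i _.
exact: ltW.
Qed.

(** The arithmetic-geometric mean inequality for the eigenvalues: after division by their mean [c]
    the trace is d, and the bound of [posdef_ln_det_le] becomes 0. *)
Lemma ln_det_le_trace d (M : 'M[R]_d) : (0 < d)%N -> posdef M ->
  ln (\det M) <= d%:R * ln (\tr M / d%:R).
Proof.
move=> d0 Mpos; have tr0 := posdef_trace_gt0 d0 Mpos; set c := \tr M / d%:R.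
have dR : 0 < d%:R :> R by rewrite ltr0n.
have c0 : 0 < c by rewrite divr_gt0.
have ci : 0 < c^-1 by rewrite invr_gt0.
have := posdef_ln_det_le (posdefZ ci Mpos).
rewrite detZ linearZ /= lnM ?posrE ?exprn_gt0 ?posdef_det_gt0// lnXn// lnV ?posrE//.
have -> : c^-1 * \tr M = d%:R by rewrite /c invf_div divfK// gt_eqF.
by rewrite subrr mulNrn mulr_natl; lra.
Qed.

(* A congruence reduces the combination to the identity, where both terms are
   bounded by posdef_ln_det_le and the traces cancel. *)
Lemma ln_det_concave d (M N : 'M[R]_d) g : 0 <= g <= 1 -> posdef M -> posdef N ->
  posdef (g *: M + (1 - g) *: N) ->
  g * ln (\det M) + (1 - g) * ln (\det N) <= ln (\det (g *: M + (1 - g) *: N)).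
Proof.
move=> /andP[g0 g1] Mp Np; set A := _ + _ => Ap.
have [[L uL LA] _] := posdef_structure Ap.
have dL K : posdef K -> ln (\det K) + ln (\det L ^+ 2) <= \tr (L *m K *m L^T) - d%:R.
  move=> Kp; have := posdef_ln_det_le (posdef_congr uL Kp).
  rewrite !det_mulmx det_tr mulrC mulrA -expr2 mulrC lnM ?posrE ?posdef_det_gt0//.
  by rewrite exprn_even_gt0//= -unitfE -unitmxE.
have lnA : ln (\det A) + ln (\det L ^+ 2) = 0.
  rewrite -lnM ?posrE ?posdef_det_gt0//; last first.
    by rewrite exprn_even_gt0//= -unitfE -unitmxE.
  have := congr1 (fun A => \det A) LA; rewrite /= !det_mulmx det_tr det1.
  by move=> h; rewrite [X in ln X](_ : _ = 1) ?ln1// -h; ring.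
have trA : g * \tr (L *m M *m L^T) + (1 - g) * \tr (L *m N *m L^T) = d%:R.
  rewrite -!mxtraceZ -mxtraceD -(mxtrace1 R d) -LA /A mulmxDr mulmxDl.
  by rewrite -!scalemxAr -!scalemxAl.
have := ler_wpM2l g0 (dL _ Mp).
have g1' : 0 <= 1 - g by lra.
have := ler_wpM2l g1' (dL _ Np).
lra.
Qed.

End quadratic_forms.

(** * Derivatives of the loss and one step of mirror descent *)

Section loss_derivatives.
Context {R : realType} {d : nat}.
Implicit Types (x u v : 'cV[R]_d).

Lemma derive_dotv (f : R -> R) (df : R) x u v :
  is_derive (dotv x u) 1 f df ->
  'D_v (fun w => f (dotv x w)) u = dotv x v * df.
Proof.
move=> [fd <-].
transitivity ('D_(dotv x v) f (dotv x u)).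
  rewrite /derive. set F := (X in lim (X @ _) = _). set G := (X in _ = lim (X @ _)); suff -> : F = G by []. apply/funext => h; rewrite /F /G /=.
  by rewrite !dotvE bilfDr bilfZr.
have fdiff : differentiable f (dotv x u) by apply/derivable1_diffP.
by rewrite deriveE// diff1E// derive1E.
Qed.

Section loss.
Variables (m0 m1 m2 : R -> R) (gt r : R) (x : 'cV[R]_d).
Hypothesis dm0 : forall t : R, is_derive t 1 m0 (m1 t).
Hypothesis dm1 : forall t : R, is_derive t 1 m1 (m2 t).

Lemma derive_loss u v :
  'D_v (loss m0 gt x r) u = dotv x v * ((m1 (dotv x u) - r) / gt).
Proof.
have D : is_derive (dotv x u) 1 (fun z => (m0 z - r * z) / gt)
    ((m1 (dotv x u) - r) / gt).
  rewrite [X in is_derive _ _ X](_ : _ = (m0 - (cst r * id)) * cst gt^-1)//.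
  have d0 := dm0 (dotv x u).
  by apply: is_derive_eq; rewrite scaler0 add0r /GRing.scale/= /cst; ring.
by rewrite -(derive_dotv v D).
Qed.

Lemma grad_loss u : grad (loss m0 gt x r) u = ((m1 (dotv x u) - r) / gt) *: x.
Proof.
apply/colP => i; rewrite !mxE derive_loss mulrC; congr (_ * _).
rewrite dotv_sum (bigD1 i)//= big1 ?addr0; last first.
  by move=> j ji; rewrite mxE (negbTE ji) mulr0.
by rewrite mxE !eqxx mulr1.
Qed.

Lemma hess_loss u : hess (loss m0 gt x r) u = (m2 (dotv x u) / gt) *: (x *m x^T).
Proof.
have dotd k : dotv x (delta_mx k 0) = x k 0.
  rewrite dotv_sum (bigD1 k)//= big1 ?addr0; last first.
    by move=> l lk; rewrite mxE (negbTE lk) mulr0.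
  by rewrite mxE !eqxx mulr1.
apply/matrixP => i j; rewrite !mxE big_ord1 mxE.
rewrite (_ : (fun u => _) =
    (fun u => x j 0 * ((m1 (dotv x u) - r) / gt))); last first.
  by apply/funext => w; rewrite derive_loss dotd.
have D : is_derive (dotv x u) 1 (fun z => x j 0 * ((m1 z - r) / gt))
    (x j 0 * (m2 (dotv x u) / gt)).
  rewrite [X in is_derive _ _ X](_ : _ = cst (x j 0) * ((m1 - cst r) * cst gt^-1))//.
  have d1 := dm1 (dotv x u).
  by apply: is_derive_eq; rewrite !scaler0 /GRing.scale/= /cst ?fctE; ring.
by rewrite (derive_dotv _ D) dotd; ring.
Qed.
End loss.

Lemma psdZ a (M : 'M[R]_d) : 0 <= a -> psd M -> psd (a *: M).
Proof.
move=> a0 [MT M0]; split; first by rewrite linearZ /= MT.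
by move=> x; rewrite bilf_mxZ mulr_ge0.
Qed.

Lemma psd_rank1 x : psd (x *m x^T).
Proof.
split; first by rewrite trmx_mul trmxK.
by move=> y; rewrite -[x *m x^T]scale1r bilf_rank1 mul1r sqr_ge0.
Qed.

Lemma wnorm_sqr (M : 'M[R]_d) x : psd M -> wnorm M x ^+ 2 = bilf M x x.
Proof. by move=> [_ M0]; rewrite sqr_sqrtr// M0. Qed.

Lemma ball2_segment S u v e : 0 <= e <= 1 ->
  ball2 S u -> ball2 S v -> ball2 S (u + e *: (v - u)).
Proof.
move=> /andP[e0 e1]; rewrite /ball2 /= => uS vS.
have -> : u + e *: (v - u) = (1 - e) *: u + e *: v.
  by rewrite scalerBr scalerBl scale1r [LHS]addrCA [LHS]addrC.
apply: le_trans (norm2D _ _) _; rewrite !norm2Z//; last lra.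
have e1' : 0 <= 1 - e by lra.
have := ler_wpM2l e0 vS; have := ler_wpM2l e1' uS; lra.
Qed.

Lemma ge0_of_small (G K : R) :
  (forall e, 0 < e <= 1 -> 0 <= G + e * K) -> 0 <= G.
Proof.
move=> H; rewrite leNgt; apply/negP => G0.
have := H 1; rewrite ltr01 lexx => /(_ isT) H1.
have K0 : 0 < K by lra.
have := H (- G / (2 * K)); rewrite divr_gt0 ?oppr_gt0 ?mulr_gt0//=.
rewrite ler_pdivrMr ?mulr_gt0// => /(_ _).
have -> : - G / (2 * K) * K = - G / 2 by field; rewrite gt_eqF.
by move=> /(_ ltac:(lra)); lra.
Qed.

(** Optimality against th' + e (u - th'), divided by e, as e tends to 0; [K] collects the e^2 terms.
    Apart from membership in the ball, this is all that the measurability proof uses about the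
    minimiser. *)
Lemma argmin_variational_ineq (S eta c0 : R) (g th th' u : 'cV[R]_d) (B A : 'M[R]_d) :
  0 < eta -> psd B -> psd A ->
  argmin_on (ball2 S) (fun u => c0 + dotv g (u - th) + 2^-1 * wnorm B (u - th) ^+ 2
     + (2 * eta)^-1 * wnorm A (u - th) ^+ 2) th' -> ball2 S u ->
  0 <= dotv g (u - th') + bilf (B + eta^-1 *: A) (th' - th) (u - th').
Proof.
move=> eta0 Bp Ap [th'S thmin] uS.
pose K := 2^-1 * bilf (B + eta^-1 *: A) (u - th') (u - th').
apply: (@ge0_of_small _ K) => e /andP[e0 e1].
have e01 : 0 <= e <= 1 by rewrite (ltW e0).
have := thmin _ (ball2_segment e01 th'S uS).
rewrite !wnorm_sqr// [th' + _ - th]addrAC.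
set D := th' - th; set w := u - th'.
rewrite /K -/w; clearbody D w; rewrite !dotvE !(bilfDr, bilfDl, bilfZl, bilfZr) (bilfC w D Bp.1) (bilfC w D Ap.1) -!dotvE.
rewrite -subr_ge0 => H; rewrite -(pmulr_rge0 _ e0).
apply: le_trans H _; rewrite !bilf_mxD !bilf_mxZ le_eqVlt; apply/orP; left; apply/eqP.
by field; rewrite gt_eqF.
Qed.

Section one_step.
Variables (m0 m1 m2 m3 : R -> R) (Rm gt r S kmu lam : R).
Hypothesis dm0 : forall t : R, is_derive t 1 m0 (m1 t).
Hypothesis dm1 : forall t : R, is_derive t 1 m1 (m2 t).
Hypothesis dm2 : forall t : R, is_derive t 1 m2 (m3 t).
Hypothesis Rm0 : 0 < Rm.
Hypothesis sc : forall z, `|m3 z| <= Rm * m2 z.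
Hypothesis gt0 : 0 < gt.
Hypothesis S0 : 0 < S.
Hypothesis kmu0 : 0 < kmu.
Hypothesis m2_le : forall z, - S <= z <= S -> m2 z <= kmu.
Let eta := 1 + Rm * S.
Hypothesis lam_ge : 6 * eta * Rm * kmu * S / gt <= lam.

Lemma m2_ge0 z : 0 <= m2 z.
Proof. by have := le_trans (normr_ge0 _) (sc z); rewrite pmulr_rge0. Qed.

Lemma eta_gt0 : 0 < eta.
Proof. by rewrite ltr_wpDr// mulr_ge0// ltW. Qed.

Lemma dotv_ball x u : norm2 x <= 1 -> ball2 S u -> - S <= dotv x u <= S.
Proof.
move=> x1 uS; rewrite -ler_norml (le_trans (dotv_norm2 _ _))//.
rewrite -[leRHS]mul1r; apply: ler_pM => //; exact: norm2_ge0.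
Qed.

Lemma link_remainder z z' : - S <= z <= S -> - S <= z' <= S ->
  `|m1 z' - m1 z - m2 z * (z' - z)| <= Rm * kmu / 2 * (z' - z) ^+ 2.
Proof.
move=> zS z'S.
have m3_le t : 0 <= t <= 1 -> `|m3 (z + t * (z' - z))| <= Rm * kmu.
  move=> /andP[t0 t1]; apply: le_trans (sc _) _; rewrite ler_pM2l// m2_le//.
  move: zS z'S => /andP[a1 a2] /andP[b1 b2].
  have q : 0 <= 1 - t by lra.
  have := ler_wpM2l t0 b1; have := ler_wpM2l t0 b2.
  have := ler_wpM2l q a1; have := ler_wpM2l q a2.
  by move=> *; apply/andP; split; lra.
have E : z' = z + (z' - z) by rewrite addrC subrK.
have U : m1 z' <= m1 z + m2 z * (z' - z) + Rm * kmu / 2 * (z' - z) ^+ 2.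
  rewrite {1}E; apply: taylor2_le dm1 dm2 _ => t /m3_le.
  by apply: le_trans; exact: ler_norm.
have L : - m1 z' <= - m1 z + - m2 z * (z' - z) + Rm * kmu / 2 * (z' - z) ^+ 2.
  rewrite {1}E; apply: (@taylor2_le _ (- m1) (- m2) (- m3)).
  - move=> t /m3_le; apply: le_trans; rewrite -normrN; exact: ler_norm.
by rewrite ler_norml; apply/andP; split; lra.
Qed.

Lemma hess_loss_psd x u : psd (hess (loss m0 gt x r) u).
Proof.
rewrite (hess_loss gt r x dm0 dm1); apply: psdZ; last exact: psd_rank1.
by rewrite divr_ge0 ?m2_ge0// ltW.
Qed.

(** Expand the A-norm of u - th = w + D. The variational inequality controls the cross term;
    replacing the linearised slope m1 z + m2 z xD by m1 z' costs a third of the A-norm of D squared,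
    whence 2/3; and [sc_lower] at z' gives the loss difference together with the Hessian that turns
    A into the next matrix. *)
Lemma omd_step (x th th' u : 'cV[R]_d) (A : 'M[R]_d) (l := loss m0 gt x r) :
  norm2 x <= 1 -> ball2 S th -> ball2 S u -> A^T = A ->
  (forall y, lam * dotv y y <= bilf A y y) ->
  argmin_on (ball2 S) (fun u => quad_approx l th u
     + (2 * eta)^-1 * wnorm A (u - th) ^+ 2) th' ->
  bilf (A + hess l th') (u - th') (u - th') <=
  bilf A (u - th) (u - th) + 2 * eta * (l u - l th')
    - 2 / 3 * bilf A (th' - th) (th' - th).
Proof.
move=> x1 thS uS AT Alam th'min.
have eta0 := eta_gt0.
have lam0 : 0 <= lam.
  by apply: le_trans lam_ge; rewrite !mulr_ge0 ?invr_ge0 ?ltW.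
have Ap : psd A.
  by split=> // y; apply: le_trans (Alam y); rewrite mulr_ge0// dotv_ge0.
have th'S := th'min.1.
have := argmin_variational_ineq eta0 (hess_loss_psd x th) Ap th'min uS.
rewrite (grad_loss gt r x dm0) !(hess_loss gt r x dm0 dm1).
set w := u - th'; set D := th' - th.
have -> : u - th = w + D by rewrite /w /D addrA subrK.
have zw : dotv x w = dotv x u - dotv x th' by rewrite !dotvE bilfDr bilfNr.
have zD : dotv x D = dotv x th' - dotv x th by rewrite !dotvE bilfDr bilfNr.
clearbody w D.
rewrite !bilf_mxD bilf_rank1 !(bilfDl, bilfDr) (bilfC D w AT).
have -> : bilf (m2 (dotv x th) / gt *: (x *m x^T)) D w =
    m2 (dotv x th) / gt * (dotv x D * dotv x w).
  rewrite bilf_mxZ; congr (_ * _); rewrite /bilf mulmxA -mulmxA.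
  by rewrite mxE big_ord1 -/(dotv D x) -/(dotv x w) dotvC.
rewrite bilf_mxZ (bilfC D w AT) dotvE bilfZl -dotvE.
have zS := dotv_ball x1 thS; have z'S := dotv_ball x1 th'S.
have zuS := dotv_ball x1 uS.
have wS : `|dotv x w| <= 2 * S.
  by rewrite zw ler_norml; apply/andP; split; lra.
have low := sc_lower dm0 dm1 dm2 (ltW Rm0) sc Rm0 (m2_ge0 (dotv x th')) wS.
rewrite -/eta zw [_ + (dotv x u - _)]addrC subrK -zw in low.
have rem := link_remainder zS z'S; rewrite -zD in rem.
have DA : dotv x D ^+ 2 * lam <= bilf A D D.
  apply: le_trans (Alam D); rewrite mulrC ler_wpM2l//.
  apply: le_trans (dotv_CS _ _) _; rewrite ler_piMl ?dotv_ge0//.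
  by rewrite -norm2_sqr expr_le1 ?norm2_ge0.
rewrite /l /loss.
set z := dotv x th in rem *; set z' := dotv x th' in rem low zw *.
set zu := dotv x u in low zw *; set xw := dotv x w in wS low zw *.
set xD := dotv x D in rem DA *.
set Aww := bilf A w w; set AwD := bilf A w D; set ADD := bilf A D D in DA *.
move=> VI.
have VI2 : 0 <= 2 * eta * ((m1 z - r + m2 z * xD) / gt * xw) + 2 * AwD.
  have e2 : 0 <= 2 * eta by lra.
  have := mulr_ge0 e2 VI; move/le_trans; apply.
  by rewrite le_eqVlt; apply/orP; left; apply/eqP; field; rewrite !gt_eqF.
(* The first lower bound on [lam] enters here: the remainder Rm kmu xD^2 / 2 and |xw| <= 2 S give at
   most lam xD^2 / 3, and lam xD^2 <= ADD. *)
have remw : `|2 * eta * ((m1 z' - m1 z - m2 z * xD) / gt * xw)| <= ADD / 3.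
  have := ler_pM (normr_ge0 _) (normr_ge0 _) rem wS.
  rewrite -normrM => /(ler_wpM2l (_ : 0 <= 2 * eta / gt)) H.
  have {}H : 2 * eta / gt * `|(m1 z' - m1 z - m2 z * xD) * xw| <=
     2 * eta / gt * (Rm * kmu / 2 * xD ^+ 2 * (2 * S)).
    by apply: H; rewrite divr_ge0 ?(ltW gt0)//; lra.
  have -> : 2 * eta * ((m1 z' - m1 z - m2 z * xD) / gt * xw) =
     2 * eta / gt * ((m1 z' - m1 z - m2 z * xD) * xw) by ring.
  rewrite normrM ger0_norm; last by rewrite divr_ge0 ?(ltW gt0)//; lra.
  apply: le_trans H _.
  have := ler_wpM2l (sqr_ge0 xD) lam_ge.
  have -> : 2 * eta / gt * (Rm * kmu / 2 * xD ^+ 2 * (2 * S)) =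
    xD ^+ 2 * (6 * eta * Rm * kmu * S / gt) / 3 by field; rewrite gt_eqF.
  lra.
(* Multiplying by 2 eta cancels the 1 / (2 eta) of [sc_lower], so the Hessian appears with its full
   weight. *)
have low2 : 2 * eta * ((m1 z' - r) / gt * xw) + m2 z' / gt * xw ^+ 2 <=
    2 * eta * ((m0 zu - r * zu) / gt - (m0 z' - r * z') / gt).
  have e2 : 0 <= 2 * eta / gt by rewrite divr_ge0 ?(ltW gt0)//; lra.
  have := ler_wpM2l e2 low => H; rewrite -subr_ge0.
  move: H; rewrite -subr_ge0; move/le_trans; apply.
  by rewrite le_eqVlt; apply/orP; left; apply/eqP; rewrite zw; field; rewrite !gt_eqF.
move: remw; rewrite ler_norml => /andP[+ _].
have -> : 2 * eta * ((m1 z' - m1 z - m2 z * xD) / gt * xw) =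
  2 * eta * ((m1 z' - r) / gt * xw) - 2 * eta * ((m1 z - r + m2 z * xD) / gt * xw) by ring.
lra.
Qed.

End one_step.
End loss_derivatives.

(** * Discounted sums and the drift term *)

Section discounted_sums.
Context {R : realType}.

Definition disc_sum (g : R) (b : nat -> R) (t : nat) : R :=
  \sum_(1 <= s < t) g ^+ (t - 1 - s) * b s.

Lemma disc_sum1 g b : disc_sum g b 1 = 0.
Proof. by rewrite /disc_sum big_geq. Qed.

Lemma disc_sumS g b t : (1 <= t)%N ->
  disc_sum g b t.+1 = g * disc_sum g b t + b t.
Proof.
move=> t1; rewrite /disc_sum big_nat_recr//= mulr_sumr subn1 subnn expr0 mul1r.
congr (_ + _); apply: eq_big_nat => s /andP[s1 st].
by rewrite mulrA -exprS; congr (g ^+ _ * _); rewrite -subSn ?subn1 ?prednK// -ltnS prednK.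
Qed.

Lemma disc_sum_unroll g (a b : nat -> R) c :
  (forall t, (1 <= t)%N -> a t.+1 <= g * a t + b t) -> 0 <= g ->
  a 1%N <= c ->
  forall t, (1 <= t)%N -> a t <= g ^+ (t - 1) * c + disc_sum g b t.
Proof.
move=> ab g0 a1; elim=> // -[_ _|t IH _].
  by rewrite disc_sum1 subnn expr0 mul1r addr0.
apply: le_trans (ab _ _) _ => //; rewrite disc_sumS// addrA lerD2r.
rewrite !subn1 /= exprS -mulrA -mulrDr ler_wpM2l//.
by have := IH isT; rewrite subn1.
Qed.

Lemma disc_sumD g a b t : disc_sum g (fun s => a s + b s) t =
  disc_sum g a t + disc_sum g b t.
Proof. by rewrite /disc_sum -big_split/=; apply: eq_bigr => s _; rewrite mulrDr. Qed.

Lemma disc_sumZ g c b t : disc_sum g (fun s => c * b s) t = c * disc_sum g b t.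
Proof. by rewrite /disc_sum mulr_sumr; apply: eq_bigr => s _; rewrite mulrCA. Qed.

Lemma disc_sum_le g a b t : 0 <= g ->
  (forall s, (1 <= s < t)%N -> a s <= b s) -> disc_sum g a t <= disc_sum g b t.
Proof.
move=> g0 ab; rewrite /disc_sum big_nat [leRHS]big_nat.
by apply: ler_sum => s /ab; apply: ler_wpM2l; rewrite exprn_ge0.
Qed.

Lemma disc_sum_const g t : g != 1 -> (1 <= t)%N ->
  disc_sum g (fun=> 1) t = (1 - g ^+ (t - 1)) / (1 - g).
Proof.
move=> g1; have g1' : 1 - g != 0 by rewrite subr_eq0 eq_sym.
elim: t => // -[_ _|t IH _].
  by rewrite disc_sum1 subnn expr0 subrr mul0r.
rewrite disc_sumS// IH// !subn1/= exprS; field; exact: g1'.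
Qed.

Lemma disc_sum_drift g (n : nat -> R) (b : nat -> R) t : 0 < g < 1 ->
  (forall p, 0 <= n p) ->
  (forall s, (1 <= s < t)%N -> `|b s| <= \sum_(s <= p < t) n p) ->
  disc_sum g (fun s => b s ^+ 2) t <=
  (\sum_(1 <= p < t) g `^ ((t - 1 - p)%:R / 2)
    * Num.sqrt ((1 - g ^+ p) / (1 - g)) * n p) ^+ 2.
Proof.
move=> /andP[g0 g1] n0 bn.
have g1' : 1 - g != 0 by rewrite subr_eq0 eq_sym lt_eqF.
pose c p : R := g `^ ((t - 1 - p)%:R / 2) * Num.sqrt ((1 - g ^+ p) / (1 - g)).
pose W p : R := \sum_(1 <= s < t) g ^+ (t - 1 - s) * (s <= p)%N%:R.
have c0 p : 0 <= c p by rewrite mulr_ge0 ?powR_ge0 ?sqrtr_ge0.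
have gp p : 0 <= (1 - g ^+ p) / (1 - g).
  by rewrite divr_ge0 ?subr_ge0 ?(ltW g1)// exprn_ile1// ltW.
have cW p : (1 <= p < t)%N -> W p = c p ^+ 2.
  move=> /andP[p1 pt]; rewrite /c exprMn sqr_sqrtr//.
  have -> : (g `^ ((t - 1 - p)%:R / 2)) ^+ 2 = g ^+ (t - 1 - p).
    rewrite -powR_mulrn ?powR_ge0// -powRrM -powR_mulrn ?ltW//.
    by congr (_ `^ _); field.
  have := @disc_sum_const g p.+1; rewrite lt_eqF// => /(_ isT isT).
  rewrite subn1 /= => <-; rewrite /W (big_cat_nat (n := p.+1))//=.
  rewrite [X in _ + X]big1_seq ?addr0; last first.
    move=> s /=; rewrite mem_index_iota => /andP[ps _].
    by rewrite leqNgt ps mulr0.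
  rewrite mulr_sumr big_nat [RHS]big_nat; apply: eq_bigr => s /andP[s1 sp].
  rewrite -ltnS sp !mulr1 -exprD; congr (g ^+ _).
  by rewrite subn1 /=; lia.
(* Only s <= min p q survives, so the cross weight is the smaller of [W p] and [W q], hence at most
   their geometric mean [c p * c q]. *)
have Wmin p q : (1 <= p < t)%N -> (1 <= q < t)%N ->
    \sum_(1 <= s < t) g ^+ (t - 1 - s) * ((s <= p)%N%:R * (s <= q)%N%:R) <= c p * c q.
  have hW k l : (1 <= k < t)%N -> (1 <= l < t)%N -> (k <= l)%N ->
    \sum_(1 <= s < t) g ^+ (t - 1 - s) * ((s <= k)%N%:R * (s <= l)%N%:R) <= c k * c l.
    move=> kt lt kl.
    have -> : \sum_(1 <= s < t) g ^+ (t - 1 - s) *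
        ((s <= k)%N%:R * (s <= l)%N%:R) = W k.
      apply: eq_bigr => s _; case: (leqP s k) => [sk|]; last by rewrite mul0r.
      by rewrite (leq_trans sk kl) mulr1.
    rewrite cW// expr2 ler_wpM2l// -ler_sqr ?nnegrE// -!cW// ler_sum// => s _.
    rewrite ler_wpM2l ?exprn_ge0 ?(ltW g0)//.
    by case: (leqP s k) => // sk; rewrite (leq_trans sk kl).
  move=> pt qt; have [pq|/ltnW qp] := leqP p q; first exact: hW.
  rewrite mulrC; under eq_bigr do rewrite [X in _ * X]mulrC; exact: hW.
apply: (@le_trans _ _ (disc_sum g (fun s =>
  (\sum_(1 <= p < t) (s <= p)%N%:R * n p) ^+ 2) t)).
  apply: disc_sum_le; first exact: ltW.
  move=> s /[dup] st /andP[s1 s2]; have := bn s st.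
  have -> : \sum_(1 <= p < t) (s <= p)%N%:R * n p = \sum_(s <= p < t) n p.
    rewrite (big_cat_nat (n := s))//=; last exact: ltnW.
    rewrite [X in X + _]big1_seq ?add0r; last first.
      move=> p /=; rewrite mem_index_iota => /andP[_ ps].
      by rewrite leqNgt ps mul0r.
    by apply: eq_big_nat => p /andP[-> _]; rewrite mul1r.
  move=> H; rewrite -[b s ^+ 2]real_normK ?num_real// ler_sqr ?nnegrE//.
  exact: le_trans H.
have -> : disc_sum g (fun s => (\sum_(1 <= p < t) (s <= p)%N%:R * n p) ^+ 2) t =
  \sum_(1 <= p < t) \sum_(1 <= q < t) n p * n q *
   \sum_(1 <= s < t) g ^+ (t - 1 - s) * ((s <= p)%N%:R * (s <= q)%N%:R).
  rewrite /disc_sum.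
  under eq_bigr => s _.
    rewrite expr2 mulr_suml mulr_sumr.
    under eq_bigr do rewrite mulr_sumr mulr_sumr.
    over.
  rewrite exchange_big; apply: eq_bigr => p _.
  rewrite exchange_big; apply: eq_bigr => q _.
  by rewrite mulr_sumr; apply: eq_bigr => s _; ring.
rewrite expr2 mulr_suml big_nat [leRHS]big_nat; apply: ler_sum => p pt.
rewrite mulr_sumr big_nat [leRHS]big_nat; apply: ler_sum => q qt.
rewrite -/(c p) -/(c q) (_ : c p * n p * _ = n p * n q * (c p * c q)); last ring.
by rewrite ler_wpM2l ?mulr_ge0// Wmin.
Qed.

End discounted_sums.

(** * Pathwise analysis of the recursion *)

Section path.
Context {R : realType} {d : nat}.
Variables (m0 m1 m2 m3 : R -> R) (Rm gt S kmu lam g : R).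
Hypothesis dm0 : forall t : R, is_derive t 1 m0 (m1 t).
Hypothesis dm1 : forall t : R, is_derive t 1 m1 (m2 t).
Hypothesis dm2 : forall t : R, is_derive t 1 m2 (m3 t).
Hypothesis Rm0 : 0 < Rm.
Hypothesis sc : forall z, `|m3 z| <= Rm * m2 z.
Hypothesis gt0 : 0 < gt.
Hypothesis S0 : 0 < S.
Hypothesis kmu0 : 0 < kmu.
Hypothesis m2_le : forall z, - S <= z <= S -> m2 z <= kmu.
Let eta := 1 + Rm * S.
Hypothesis lam_ge : 6 * eta * Rm * kmu * S / gt <= lam.
Hypothesis g01 : 0 < g < 1.
Hypothesis d0 : (0 < d)%N.
Variables (x : nat -> 'cV[R]_d) (r : nat -> R) (th1 : 'cV[R]_d).
Variables (th : nat -> 'cV[R]_d) (H : nat -> 'M[R]_d).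
Hypothesis x1 : forall t, (1 <= t)%N -> norm2 (x t) <= 1.
Hypothesis th1S : ball2 S th1.
Let l t := loss m0 gt (x t) (r t).
Hypothesis Hdomd : domd S lam g eta th1 l th H.

Definition regularized (lam g : R) (H : 'M[R]_d) : 'M[R]_d :=
  g *: H + ((1 - g) * lam)%:M.

Let A t := regularized lam g (H t).
Let hh t := m2 (dotv (x t) (th t.+1)) / gt.
Let v t := bilf (invmx (A t)) (x t) (x t).

Let lam0 : 0 < lam.
Proof.
apply: lt_le_trans lam_ge; rewrite divr_gt0// !mulr_gt0//.
exact: eta_gt0.
Qed.

Lemma domd_ball t : (1 <= t)%N -> ball2 S (th t).
Proof.
case: Hdomd => th11 _ step; case: t => // -[_|t _]; first by rewrite th11.
by have [[]] := step t.+1 isT.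
Qed.

Lemma domd_hess t : (1 <= t)%N ->
  H t.+1 = A t + hh t *: (x t *m (x t)^T).
Proof.
move=> t1; case: Hdomd => _ _ /(_ t t1)[_ ->].
by rewrite /l (hess_loss gt (r t) (x t) dm0 dm1).
Qed.

Let hh0 t : 0 <= hh t.
Proof. by rewrite divr_ge0 ?(m2_ge0 Rm0 sc)// ltW. Qed.

Lemma domd_H t : (1 <= t)%N ->
  (H t)^T = H t /\ forall y, lam * dotv y y <= bilf (H t) y y.
Proof.
elim: t => // -[_ _|t IH _].
  by case: Hdomd => _ -> _; rewrite tr_scalar_mx; split=> // y; rewrite bilf_scalar.
have [HT Hlam] := IH isT; rewrite domd_hess//; split.
  rewrite !linearD !linearZ /= trmx_mul trmxK HT tr_scalar_mx//.
move=> y; rewrite bilf_mxD bilf_rank1 /A /regularized bilf_mxD bilf_mxZ bilf_scalar.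
have := mulr_ge0 (hh0 t.+1) (sqr_ge0 (dotv (x t.+1) y)).
case/andP: g01 => g0 _; have := ler_wpM2l (ltW g0) (Hlam y); lra.
Qed.

Lemma domd_A t : (1 <= t)%N ->
  (A t)^T = A t /\ forall y, lam * dotv y y <= bilf (A t) y y.
Proof.
move=> /domd_H[HT Hlam]; split.
  by rewrite /A linearD linearZ /= HT tr_scalar_mx.
move=> y; rewrite /A bilf_mxD bilf_mxZ bilf_scalar.
case/andP: g01 => g0 _; have := ler_wpM2l (ltW g0) (Hlam y); lra.
Qed.

Lemma domd_A_posdef t : (1 <= t)%N -> posdef (A t).
Proof. by move=> /domd_A[AT]; exact: posdef_scalar_lb lam0 AT. Qed.

Lemma domd_H_posdef t : (1 <= t)%N -> posdef (H t).
Proof. by move=> /domd_H[HT]; exact: posdef_scalar_lb lam0 HT. Qed.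

(** Cauchy-Schwarz for the form of [A t], as x = A (A^-1 x). It supplies the bound on (z1 - z0)^2
    that [gauss_mixture_lower] needs to recentre the mixture. *)
Lemma domd_v_CS t y : (1 <= t)%N ->
  dotv (x t) y ^+ 2 <= v t * bilf (A t) y y.
Proof.
move=> t1; have Ap := domd_A_posdef t1; have uA := posdef_unitmx Ap.
pose z := invmx (A t) *m x t.
have Az : A t *m z = x t by rewrite /z mulKVmx.
have -> : dotv (x t) y = bilf (A t) y z by rewrite bilf_dotv Az dotvC.
have -> : v t = bilf (A t) z z.
  by rewrite /v !bilf_dotv Az dotvC.
by rewrite mulrC; exact: psd_CS (posdef_psd Ap).
Qed.

(** With z = A^-1 x, lam |z|^2 <= z^T A z = v = x^T z <= |z|, so lam v^2 <= v. *)
Lemma domd_v_bound t : (1 <= t)%N -> 0 <= v t <= lam^-1.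
Proof.
move=> t1; have Ap := domd_A_posdef t1; have uA := posdef_unitmx Ap.
pose z := invmx (A t) *m x t.
have Az : A t *m z = x t by rewrite /z mulKVmx.
have vE : v t = bilf (A t) z z by rewrite /v !bilf_dotv Az dotvC.
have v0 : 0 <= v t by rewrite vE (posdef_psd Ap).2.
rewrite v0 /=.
have [v_eq0|v_neq0] := eqVneq (v t) 0; first by rewrite v_eq0 invr_ge0 ltW.
have vpos : 0 < v t by rewrite lt_def v_neq0.
have xx : dotv (x t) (x t) <= 1 by rewrite -norm2_sqr expr_le1 ?norm2_ge0// x1.
have zz := (domd_A t1).2 z; rewrite -vE in zz.
have vz : v t = dotv (x t) z by rewrite /v bilf_dotv.
have := dotv_CS (x t) z; rewrite -vz => H1.
have H2 : v t ^+ 2 <= dotv z z.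
  by apply: le_trans H1 _; rewrite ler_piMl ?dotv_ge0.
have H3 : lam * v t ^+ 2 <= v t.
  by apply: le_trans zz; rewrite ler_wpM2l// ltW.
rewrite -(ler_pM2l lam0) mulfV ?gt_eqF// -(ler_pM2r vpos) mul1r.
by rewrite -mulrA -expr2.
Qed.

Lemma domd_det t : (1 <= t)%N ->
  \det (H t.+1) = \det (A t) * (1 + hh t * v t).
Proof.
move=> t1; rewrite domd_hess// det_add_rank1//.
exact/posdef_unitmx/domd_A_posdef.
Qed.

Lemma domd_trace t : (1 <= t)%N ->
  \tr (H t) <= lam * d%:R + kmu / gt * ((1 - g ^+ (t - 1)) / (1 - g)).
Proof.
have [g0 g1] := andP g01.
elim: t => // -[_ _|t IH _].
  by case: Hdomd => _ -> _; rewrite subnn expr0 subrr mul0r mulr0 addr0 mxtrace_scalar mulr_natr.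
have {}IH := IH isT; rewrite domd_hess// /A /regularized !linearD /= !mxtraceZ mxtrace_scalar.
rewrite mxtrace_mulC trace_mx11 -/(dotv (x t.+1) (x t.+1)).
have xx : dotv (x t.+1) (x t.+1) <= 1 by rewrite -norm2_sqr expr_le1 ?norm2_ge0// x1.
have hk : hh t.+1 * dotv (x t.+1) (x t.+1) <= kmu / gt.
  rewrite -[leRHS]mulr1; apply: ler_pM => //; first exact: dotv_ge0.
  rewrite ler_wpM2r ?invr_ge0 ?(ltW gt0)// m2_le// dotv_ball ?x1//.
  exact: domd_ball.
have := ler_wpM2l (ltW g0) IH; rewrite !subn1 /= exprS -mulr_natr.
have -> : (1 - g * g ^+ t) / (1 - g) = g * ((1 - g ^+ t) / (1 - g)) + 1.
  by field; rewrite subr_eq0 gt_eqF.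
lra.
Qed.

Lemma domd_logdet t : (1 <= t)%N ->
  disc_sum g (fun s => ln (1 + hh s * v s)) t <=
  d%:R * ln (1 + kmu * (1 - g ^+ (t - 1)) / (lam * d%:R * gt * (1 - g))).
Proof.
have [g0 g1] := andP g01 => t1.
have dR : 0 < d%:R :> R by rewrite ltr0n.
(* Subtracting ln det of lam I makes the potential vanish at [H 1] and absorbs the share (1 - g) of
   lam I in [A], so that [g * P s] is at most ln det (A s) - d ln lam. *)
pose P t := ln (\det (H t)) - d%:R * ln lam.
have lnlam : ln (\det (lam%:M : 'M[R]_d)) = d%:R * ln lam.
  by rewrite det_scalar lnXn// mulr_natl.
have lamp : posdef (lam%:M : 'M[R]_d).
  apply: (posdef_scalar_lb lam0); first exact: tr_scalar_mx.
  by move=> y; rewrite bilf_scalar.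
have AE s : A s = g *: H s + (1 - g) *: lam%:M by rewrite scale_scalar_mx.
have Pstep s : (1 <= s)%N -> g * P s + ln (1 + hh s * v s) <= P s.+1.
  move=> s1; have hv : 0 < 1 + hh s * v s.
    by rewrite ltr_wpDr// mulr_ge0//; case/andP: (domd_v_bound s1).
  rewrite /P domd_det// lnM ?posrE//; last exact/posdef_det_gt0/domd_A_posdef.
  have g01' : 0 <= g <= 1 by rewrite !ltW.
  have := @ln_det_concave _ _ (H s) lam%:M g g01' (domd_H_posdef s1) lamp.
  by rewrite -AE lnlam => /(_ (domd_A_posdef s1)); lra.
have sumP : forall s, (1 <= s)%N -> disc_sum g (fun s => ln (1 + hh s * v s)) s <= P s.
  elim=> // -[_ _|s IH _].
    by rewrite disc_sum1 /P; case: Hdomd => _ -> _; rewrite lnlam subrr.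
  rewrite disc_sumS//; apply: le_trans (Pstep _ _) => //.
  by rewrite lerD2r ler_wpM2l ?(ltW g0)// IH.
apply: le_trans (sumP t t1) _.
have Hp := domd_H_posdef t1.
have := ln_det_le_trace d0 Hp => Htr.
have : ln (\tr (H t) / d%:R) <= ln lam +
    ln (1 + kmu * (1 - g ^+ (t - 1)) / (lam * d%:R * gt * (1 - g))).
  have gp : 0 <= 1 - g ^+ (t - 1) by rewrite subr_ge0 exprn_ile1// ltW.
  have q0 : 0 <= kmu * (1 - g ^+ (t - 1)) / (lam * d%:R * gt * (1 - g)).
    rewrite divr_ge0// ?mulr_ge0// ?ltW// subr_gt0//.
  rewrite -lnM ?posrE//; last lra.
  rewrite ler_ln ?posrE ?divr_gt0 ?mulr_gt0 ?posdef_trace_gt0//; last lra.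
  rewrite ler_pdivrMr//; apply: le_trans (domd_trace t1) _.
  rewrite le_eqVlt; apply/orP; left; apply/eqP; field.
  by rewrite subr_eq0 !gt_eqF.
move=> /(ler_wpM2l (ltW dR)); rewrite /P; lra.
Qed.

Lemma domd_unroll u t : ball2 S u -> (1 <= t)%N ->
  bilf (H t) (u - th t) (u - th t) <= 4 * lam * S ^+ 2 +
  2 * eta * disc_sum g (fun s => l s u - l s (th s.+1) -
    bilf (A s) (th s.+1 - th s) (th s.+1 - th s) / (3 * eta)) t.
Proof.
move=> uS t1; have [g0 g1] := andP g01.
have eta0 : 0 < eta := eta_gt0 Rm0 S0.
have diam s : (1 <= s)%N -> dotv (u - th s) (u - th s) <= 4 * S ^+ 2.
  move=> s1; rewrite -norm2_sqr.
  have -> : 4 * S ^+ 2 = (2 * S) ^+ 2 by ring.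
  rewrite ler_sqr ?nnegrE ?norm2_ge0 ?mulr_ge0 ?(ltW S0)//.
  apply: le_trans (norm2D _ _) _; rewrite norm2N.
  by have := domd_ball s1; rewrite /ball2/= in uS *; lra.
pose b s := 2 * eta * (l s u - l s (th s.+1) -
    bilf (A s) (th s.+1 - th s) (th s.+1 - th s) / (3 * eta)).
(* The shift is the fixed point of c |-> g c + (1 - g) lam (2 S)^2, so the regularisation reinjected
   at each round leaves no accumulated term. *)
pose a s := bilf (H s) (u - th s) (u - th s) - 4 * lam * S ^+ 2.
have step s : (1 <= s)%N -> a s.+1 <= g * a s + b s.
  move=> s1; have [AT Alam] := domd_A s1.
  have [min HE] := (let: And3 _ _ st := Hdomd in st) s s1.
  have := omd_step dm0 dm1 dm2 Rm0 sc gt0 S0 kmu0 m2_le lam_ge (x1 s1)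
    (domd_ball s1) uS AT Alam min.
  rewrite -/(l s) -HE.
  have -> : bilf (A s) (u - th s) (u - th s) =
    g * bilf (H s) (u - th s) (u - th s) + (1 - g) * lam * dotv (u - th s) (u - th s).
    by rewrite /A bilf_mxD bilf_mxZ bilf_scalar.
  have l1 : 0 <= (1 - g) * lam by rewrite mulr_ge0 ?(ltW lam0)//; lra.
  have := ler_wpM2l l1 (diam s s1); rewrite /a /b.
  have -> : 2 * eta * (l s u - l s (th s.+1) -
    bilf (A s) (th s.+1 - th s) (th s.+1 - th s) / (3 * eta)) =
    2 * eta * (l s u - l s (th s.+1)) - 2 / 3 *
      bilf (A s) (th s.+1 - th s) (th s.+1 - th s).
    by field; rewrite gt_eqF.
  rewrite -/eta; lra.
have a1 : a 1%N <= 0.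
  rewrite /a; case: Hdomd => _ -> _; rewrite bilf_scalar.
  by have := ler_wpM2l (ltW lam0) (diam 1%N isT); lra.
have := disc_sum_unroll step (ltW g0) a1 t1.
by rewrite mulr0 add0r /b disc_sumZ /a; lra.
Qed.


(* The price for comparing the loss at th' with the mixture around th. *)
Definition step_slack (lam g eta h : R) (H : 'M[R]_d) (x th th' : 'cV[R]_d) : R :=
  let A := regularized lam g H in
  bilf A (th' - th) (th' - th) / (3 * eta) +
  (3 * eta + 2^-1) * ln (1 + h * bilf (invmx A) x x).

Let slack t := step_slack lam g eta (hh t) (H t) (x t) (th t) (th t.+1).

(** Purely pathwise: the law of the rewards enters only through the last premise, whose failure is
    the event [bad]. The logarithms inside [slack] and the quadratic terms are paid for by
    [domd_logdet] and [disc_sum_drift]; the root of B + iota^2 V^2 is then split as sqrt B + iota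
    V. *)
Lemma domd_conf_set delta (ts : nat -> 'cV[R]_d) t : (1 <= t)%N -> 0 < delta < 1 ->
  (forall s, (1 <= s)%N -> ball2 S (ts s)) ->
  disc_sum g (fun s => l s (ts t) - l s (th s.+1) - slack s
     - kmu / gt * dotv (x s) (ts t - ts s) ^+ 2) t <=
  (1 + Rm ^+ 2 / (gt * kmu)) * ln (pi ^+ 2 * t%:R ^+ 2 / (3 * delta)) ->
  conf_set (th t) (H t) (beta_radius d S Rm kmu gt lam g eta delta t
    + Num.sqrt (2 * eta * kmu / gt) * drift_penalty g ts t) (ts t).
Proof.
move=> t1 /andP[de0 de1] tsS ev; have [g0 g1] := andP g01.
have eta0 : 0 < eta := eta_gt0 Rm0 S0.
have dR : 0 < d%:R :> R by rewrite ltr0n.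
have unroll := domd_unroll (tsS t t1) t1.
have logdet := domd_logdet t1.
pose n p := norm2 (ts p.+1 - ts p).
have drift : disc_sum g (fun s => dotv (x s) (ts t - ts s) ^+ 2) t <=
    drift_penalty g ts t ^+ 2.
  apply: (@disc_sum_drift _ g n) => //; first by move=> p; exact: norm2_ge0.
  move=> s /andP[s1 st]; apply: le_trans (dotv_norm2 _ _) _.
  rewrite -[leRHS]mul1r; apply: ler_pM; rewrite ?norm2_ge0 ?x1//.
  rewrite -(telescope_sumr ts (ltnW st)) big_nat [leRHS]big_nat.
  elim/big_ind2: _ => //; first by rewrite /norm2 dotvE /bilf mulmx0 mxE sqrtr0.
  by move=> ? ? ? ? h1 h2; apply: le_trans (norm2D _ _) _; exact: lerD.
pose B := 4 * lam * S ^+ 2 + 2 * eta * (1 + Rm ^+ 2 / (gt * kmu))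
       * ln (pi ^+ 2 * t%:R ^+ 2 / (3 * delta))
     + 2 * eta * (3 * eta + 2^-1) * d%:R
       * ln (1 + kmu * (1 - g ^+ (t - 1)) / (lam * d%:R * gt * (1 - g))).
have sumE : disc_sum g (fun s => l s (ts t) - l s (th s.+1) -
    bilf (A s) (th s.+1 - th s) (th s.+1 - th s) / (3 * eta)) t =
  disc_sum g (fun s => l s (ts t) - l s (th s.+1) - slack s
     - kmu / gt * dotv (x s) (ts t - ts s) ^+ 2) t
  + ((3 * eta + 2^-1) * disc_sum g (fun s => ln (1 + hh s * v s)) t
  + kmu / gt * disc_sum g (fun s => dotv (x s) (ts t - ts s) ^+ 2) t).
  rewrite -!disc_sumZ -!disc_sumD; apply: eq_bigr => s _; congr (_ * _).
  by rewrite /slack /step_slack /= -/(A s) -/(v s); ring.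
have le_B : bilf (H t) (ts t - th t) (ts t - th t) <=
    B + 2 * eta * kmu / gt * drift_penalty g ts t ^+ 2.
  apply: le_trans unroll _; rewrite sumE /B.
  have e2 : 0 <= 2 * eta by lra.
  have e3 : 0 <= 2 * eta * (3 * eta + 2^-1) by rewrite mulr_ge0//; lra.
  have e4 : 0 <= 2 * eta * kmu / gt.
    by rewrite divr_ge0 ?(ltW gt0)// mulr_ge0// ltW.
  have := ler_wpM2l e2 ev; have := ler_wpM2l e3 logdet; have := ler_wpM2l e4 drift.
  lra.
have V0 : 0 <= drift_penalty g ts t.
  by apply: sumr_ge0 => p _; rewrite !mulr_ge0 ?powR_ge0 ?sqrtr_ge0 ?norm2_ge0.
(* [Num.sqrt] sends negative numbers to 0, so squaring the radius requires this. The first logarithm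
   is nonnegative because pi^2 t^2 / (3 delta) >= 4/3. *)
have B0 : 0 <= B.
  have pi3 : 1 <= pi ^+ 2 * t%:R ^+ 2 / (3 * delta).
    have p2 := @pi_ge2 R.
    have t1' : 1 <= t%:R :> R by rewrite ler1n.
    rewrite ler_pdivlMr ?mulr_gt0// mul1r.
    have pp : 4 <= pi ^+ 2 :> R.
      have : 0 <= (pi - 2) * (pi + 2) :> R by rewrite mulr_ge0//; lra.
      by lra.
    have tt : 1 <= t%:R ^+ 2 :> R by rewrite expr_ge1.
    have := mulr_ge0 (sqr_ge0 (pi : R)) (_ : 0 <= t%:R ^+ 2 - 1).
    by rewrite subr_ge0 => /(_ tt); lra.
  have gp : 0 <= 1 - g ^+ (t - 1) by rewrite subr_ge0 exprn_ile1// ltW.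
  have q1 : 1 <= 1 + kmu * (1 - g ^+ (t - 1)) / (lam * d%:R * gt * (1 - g)).
    by rewrite lerDl divr_ge0// ?mulr_ge0// ?ltW// subr_gt0.
  have l1 := ln_ge0 pi3; have l2 := ln_ge0 q1.
  have k0 : 0 <= Rm ^+ 2 / (gt * kmu) by rewrite divr_ge0 ?sqr_ge0// mulr_ge0// ltW.
  have e3 : 0 <= 2 * eta * (3 * eta + 2^-1) * d%:R.
    by rewrite !mulr_ge0//; try lra; exact: ltW.
  have e4 : 0 <= 2 * eta * (1 + Rm ^+ 2 / (gt * kmu)) by rewrite mulr_ge0//; lra.
  have e5 : 0 <= 4 * lam * S ^+ 2 by rewrite mulr_ge0 ?sqr_ge0// mulr_ge0// ltW.
  by have := mulr_ge0 e3 l2; have := mulr_ge0 e4 l1; rewrite /B; lra.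
rewrite /conf_set /= wnormE /beta_radius -/B.
set io := Num.sqrt (2 * eta * kmu / gt).
have io2 : io ^+ 2 = 2 * eta * kmu / gt.
  by rewrite sqr_sqrtr// divr_ge0 ?(ltW gt0)// mulr_ge0 ?(ltW kmu0)//; lra.
have io0 : 0 <= io by exact: sqrtr_ge0.
have sB : Num.sqrt B ^+ 2 = B by rewrite sqr_sqrtr.
have sB0 : 0 <= Num.sqrt B by exact: sqrtr_ge0.
have rhs0 : 0 <= Num.sqrt B + io * drift_penalty g ts t.
  by rewrite addr_ge0// mulr_ge0.
rewrite -[leRHS]ger0_norm// -sqrtr_sqr ler_wsqrtr//.
apply: le_trans le_B _; rewrite sqrrD sB exprMn io2.
by have := mulr_ge0 sB0 (mulr_ge0 io0 V0); lra.
Qed.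

End path.

(** * Measurability of matrix expressions *)

Section measurable_matrices.
Context {R : realType} {dT : measure_display} {T : measurableType dT}.

Definition measurable_mx p q (A : T -> 'M[R]_(p, q)) : Prop :=
  forall i j, measurable_fun setT (fun w => A w i j).

Lemma measurable_mxD p q (A B : T -> 'M[R]_(p, q)) :
  measurable_mx A -> measurable_mx B -> measurable_mx (fun w => A w + B w).
Proof.
move=> mA mB i j; under eq_fun do rewrite mxE; exact: measurable_funD.
Qed.

Lemma measurable_mxZ p q (a : T -> R) (A : T -> 'M[R]_(p, q)) :
  measurable_fun setT a -> measurable_mx A -> measurable_mx (fun w => a w *: A w).
Proof.
move=> ma mA i j; under eq_fun do rewrite mxE; exact: measurable_funM.
Qed.

Lemma measurable_mxN p q (A : T -> 'M[R]_(p, q)) :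
  measurable_mx A -> measurable_mx (fun w => - A w).
Proof.
by move=> mA i j; under eq_fun do rewrite mxE; exact: measurable_funN.
Qed.

Lemma measurable_mxB p q (A B : T -> 'M[R]_(p, q)) :
  measurable_mx A -> measurable_mx B -> measurable_mx (fun w => A w - B w).
Proof. by move=> mA mB; apply: measurable_mxD => //; exact: measurable_mxN. Qed.

Lemma measurable_mx_tr p q (A : T -> 'M[R]_(p, q)) :
  measurable_mx A -> measurable_mx (fun w => (A w)^T).
Proof. by move=> mA i j; under eq_fun do rewrite mxE; exact: mA. Qed.

Lemma measurable_mxM p q s (A : T -> 'M[R]_(p, q)) (B : T -> 'M[R]_(q, s)) :
  measurable_mx A -> measurable_mx B -> measurable_mx (fun w => A w *m B w).
Proof.
move=> mA mB i j; under eq_fun do rewrite mxE.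
by apply: measurable_sum => k; exact: measurable_funM.
Qed.

Lemma measurable_mx_cst p q (A : 'M[R]_(p, q)) : measurable_mx (fun=> A).
Proof. by move=> i j; exact: measurable_cst. Qed.

Lemma measurable_bilf p (A : T -> 'M[R]_p) (u v : T -> 'cV[R]_p) :
  measurable_mx A -> measurable_mx u -> measurable_mx v ->
  measurable_fun setT (fun w => bilf (A w) (u w) (v w)).
Proof.
move=> mA mu mv; apply: (@measurable_mxM _ _ _ (fun w => (u w)^T *m A w)) => //.
by apply: measurable_mxM => //; exact: measurable_mx_tr.
Qed.

Lemma measurable_dotv p (u v : T -> 'cV[R]_p) :
  measurable_mx u -> measurable_mx v ->
  measurable_fun setT (fun w => dotv (u w) (v w)).
Proof. by move=> mu mv; apply: measurable_mxM => //; exact: measurable_mx_tr. Qed.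

Lemma measurable_fun_sqrt (f : T -> R) : measurable_fun setT f ->
  measurable_fun setT (fun w => Num.sqrt (f w)).
Proof.
move=> mf; apply: measurableT_comp mf.
by apply: continuous_measurable_fun; exact: sqrt_continuous.
Qed.

Lemma measurable_norm2 p (u : T -> 'cV[R]_p) :
  measurable_mx u -> measurable_fun setT (fun w => norm2 (u w)).
Proof. by move=> mu; apply: measurable_fun_sqrt; exact: measurable_dotv. Qed.

Lemma measurable_det p (A : T -> 'M[R]_p) :
  measurable_mx A -> measurable_fun setT (fun w => \det (A w)).
Proof.
move=> mA; rewrite /determinant; apply: measurable_sum => s.
by apply: measurable_funM => //; apply: measurable_prod => i _; exact: mA.
Qed.

Lemma measurable_trace p (A : T -> 'M[R]_p) :
  measurable_mx A -> measurable_fun setT (fun w => \tr (A w)).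
Proof. by move=> mA; rewrite /mxtrace; apply: measurable_sum => i; exact: mA. Qed.

(** On nonnegative reals inversion is the power -1, also at 0, where both take the value 0. *)
Lemma measurable_fun_inv (f : T -> R) : measurable_fun setT f ->
  (forall w, 0 <= f w) -> measurable_fun setT (fun w => (f w)^-1).
Proof.
move=> mf f0; under eq_fun do rewrite -powR_inv1//.
exact: (measurableT_comp (measurable_powR (-1)) mf).
Qed.

End measurable_matrices.

(** * Projected gradient iteration and measurability of the argmin *)

Section projected_gradient.
Context {R : realType} {d : nat}.
Implicit Types (u v : 'cV[R]_d) (Q : 'M[R]_d).

(** The metric projection onto the ball, written without a case distinction so that its
    measurability is immediate. *)
Definition proj_ball (S : R) u : 'cV[R]_d := (S / Num.max S (norm2 u)) *: u.

Lemma proj_ballP S u v : 0 < S -> ball2 S v ->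
  ball2 S (proj_ball S u) /\ dotv (u - proj_ball S u) (v - proj_ball S u) <= 0.
Proof.
move=> S0 vS; rewrite /ball2 /=.
have [uS|Su] := leP (norm2 u) S.
  have -> : proj_ball S u = u.
    by rewrite /proj_ball max_l// divff ?gt_eqF// scale1r.
  by split=> //; rewrite subrr /dotv trmx0 mul0mx mxE.
have u0 : 0 < norm2 u by exact: lt_trans S0 Su.
rewrite /proj_ball max_r ?(ltW Su)//; set a := S / norm2 u.
have a0 : 0 <= a by rewrite divr_ge0// ltW.
have a1 : a <= 1 by rewrite ler_pdivrMr// mul1r ltW.
have nau : norm2 (a *: u) = S by rewrite norm2Z// divfK// gt_eqF.
split; first by rewrite nau.
have -> : u - a *: u = (1 - a) *: u by rewrite scalerBl scale1r.
rewrite dotvE bilfZl mulr_ge0_le0 ?subr_ge0// bilfDr bilfNr bilfZr -!dotvE.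
rewrite -norm2_sqr subr_le0.
apply: le_trans (le_trans (ler_norm _) (dotv_norm2 _ _)) _.
have -> : a * norm2 u ^+ 2 = norm2 u * S by rewrite /a; field; rewrite gt_eqF.
by rewrite ler_pM2l.
Qed.

(** The trace stands in for the largest eigenvalue: it yields a step size 1 / tr Q that is explicit
    in the entries, hence measurable. *)
Lemma psd_sqr_le_trace Q e : psd Q ->
  dotv (Q *m e) (Q *m e) <= \tr Q * bilf Q e e.
Proof.
move=> Qp; rewrite dotv_sum /mxtrace mulr_suml; apply: ler_sum => i _.
rewrite -expr2 -[Q i i]bilf_delta.
have -> : (Q *m e) i 0 = bilf Q (delta_mx i 0) e.
  by rewrite /bilf trmx_delta -mulmxA -rowE [RHS]mxE.
exact: psd_CS.
Qed.

(** For e = u - th and e' = u' - th, the projection inequality and the variational inequality at u'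
    add up to |e'|^2 <= (e - s Q e)^T e', so |e'| <= |e - s Q e|. By [psd_sqr_le_trace] the square
    of the latter is at most |e|^2 - s e^T Q e. *)
Lemma projected_gradient_contraction (S c : R) Q (g th0 th u : 'cV[R]_d)
  (s := (\tr Q)^-1) (u' := proj_ball S (u - s *: (g + Q *m (u - th0)))) :
  0 < S -> psd Q -> 0 < \tr Q -> (forall y, c * dotv y y <= bilf Q y y) ->
  ball2 S th ->
  (forall y, ball2 S y -> 0 <= dotv g (y - th) + bilf Q (th - th0) (y - th)) ->
  norm2 (u' - th) <= Num.sqrt (1 - c / \tr Q) * norm2 (u - th).
Proof.
move=> S0 Qp tr0 Qc thS VI.
have s0 : 0 < s by rewrite invr_gt0.
set p := u - s *: (g + Q *m (u - th0)).
have [u'S proj] : ball2 S u' /\ dotv (p - u') (th - u') <= 0 := proj_ballP p S0 thS.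
have {}VI := VI _ u'S.
set e := u - th; set e' := u' - th; pose z := e - s *: (Q *m e).
have le1 : dotv e' e' <= dotv z e'.
  have -> : dotv z e' = dotv e' e' - dotv (p - u') (th - u') +
    s * (dotv g e' + bilf Q (th - th0) e').
    have -> : th - u' = - e' by rewrite opprB.
    have -> : p - u' = z - e' - s *: (g + Q *m (th - th0)).
      rewrite /p /z /e /e' !mulmxBr; apply/colP => i; rewrite !mxE; ring.
    rewrite bilfC ?Qp.1// bilf_dotv (dotvC e') !dotvE !(bilfDl, bilfNl, bilfNr, bilfZl).
    ring.
  by have := mulr_ge0 (ltW s0) VI; lra.
have le2 : dotv e' e' <= dotv z z.
  have [->|e'0] := eqVneq (dotv e' e') 0; first exact: dotv_ge0.
  have e'pos : 0 < dotv e' e' by rewrite lt_def e'0 dotv_ge0.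
  rewrite -(ler_pM2r e'pos); apply: le_trans (dotv_CS z e').
  by rewrite -expr2 ler_sqr// ?nnegrE ?dotv_ge0// (le_trans _ le1) ?dotv_ge0.
have le3 : dotv z z <= dotv e e * (1 - c / \tr Q).
  have H := psd_sqr_le_trace e Qp.
  have zE f : dotv (f - s *: (Q *m f)) (f - s *: (Q *m f)) =
      dotv f f - 2 * s * bilf Q f f + s ^+ 2 * dotv (Q *m f) (Q *m f).
    by rewrite bilf_dotv !dotvE !(bilfDl, bilfDr, bilfNl, bilfNr, bilfZl, bilfZr)
      -!dotvE (dotvC (Q *m f) f); ring.
  rewrite zE.
  have := ler_wpM2l (sqr_ge0 s) H.
  have -> : s ^+ 2 * (\tr Q * bilf Q e e) = s * bilf Q e e.
    by rewrite /s; field; rewrite gt_eqF.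
  by have := ler_wpM2l (ltW s0) (Qc e); rewrite -/s; lra.
rewrite mulrC -[norm2 (u - th)]/(Num.sqrt (dotv e e)) -sqrtrM ?dotv_ge0//.
by apply: ler_wsqrtr; exact: le_trans le3.
Qed.

End projected_gradient.

Section measurable_argmin.
Context {R : realType} {d : nat} {dT : measure_display} {T : measurableType dT}.

Lemma measurable_proj_ball (S : R) (u : T -> 'cV[R]_d) : 0 < S ->
  measurable_mx u -> measurable_mx (fun w => proj_ball S (u w)).
Proof.
move=> S0 mu; apply: measurable_mxZ => //; apply: measurable_funM => //.
apply: measurable_fun_inv; last by move=> w; rewrite le_max (ltW S0).
by apply: measurable_maxr => //; exact: measurable_norm2.
Qed.

(* th is the pointwise limit of projected gradient iterates, each an explicit
   measurable function of the data. *)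
Lemma measurable_ball_argmin (S c : R) (g th0 th : T -> 'cV[R]_d) (Q : T -> 'M[R]_d) :
  (0 < d)%N -> 0 < S -> 0 < c ->
  measurable_mx g -> measurable_mx th0 -> measurable_mx Q ->
  (forall w, (Q w)^T = Q w) ->
  (forall w y, c * dotv y y <= bilf (Q w) y y) ->
  (forall w, ball2 S (th w)) ->
  (forall w y, ball2 S y ->
     0 <= dotv (g w) (y - th w) + bilf (Q w) (th w - th0 w) (y - th w)) ->
  measurable_mx th.
Proof.
move=> d0 S0 c0 mg mth0 mQ QT Qc thS VI.
have Qpos w : posdef (Q w) := posdef_scalar_lb c0 (QT w) (Qc w).
have tr0 w : 0 < \tr (Q w) := posdef_trace_gt0 d0 (Qpos w).
pose step w u := proj_ball S (u - (\tr (Q w))^-1 *: (g w + Q w *m (u - th0 w))).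
pose it k w := iter k (step w) 0.
have mit k : measurable_mx (it k).
  elim: k => [|k IH]; first exact: measurable_mx_cst.
  apply: measurable_proj_ball => //; apply: measurable_mxB => //.
  apply: measurable_mxZ.
    by apply: measurable_fun_inv; [exact: measurable_trace|move=> w; exact: ltW].
  by apply: measurable_mxD => //; apply: measurable_mxM => //; exact: measurable_mxB.
move=> i j; apply: (measurable_fun_cvg (fun k => mit k i j)) => w _.
pose q := Num.sqrt (1 - c / \tr (Q w)).
have q0 : 0 <= q by exact: sqrtr_ge0.
have q1 : q < 1.
  rewrite -[ltRHS]sqrtr1 ltr_sqrt//.
  by have := divr_gt0 c0 (tr0 w); lra.
have dist k : norm2 (it k w - th w) <= q ^+ k * norm2 (it 0 w - th w).
  elim: k => [|k IH]; first by rewrite expr0 mul1r.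
  rewrite exprS -mulrA; apply: le_trans (ler_wpM2l q0 IH).
  exact: (projected_gradient_contraction _ S0 (posdef_psd (Qpos w)) (tr0 w) (Qc w)
    (thS w) (VI w)).
have coord (y : 'cV[R]_d) : `|y i j| <= norm2 y.
  rewrite ord1 -ler_sqr ?nnegrE ?norm2_ge0// norm2_sqr dotv_sum (bigD1 i)//=.
  rewrite real_normK ?num_real// -expr2 lerDl sumr_ge0// => k _.
  by rewrite -expr2 sqr_ge0.
apply: cvg_sub0; last exact: (cvg_cst (th w i j)).
apply/norm_cvg0P.
apply: (@squeeze_cvgr _ _ _ _ (cst 0) (geometric (norm2 (it 0 w - th w)) q)).
- apply: nearW => k /=; rewrite normr_ge0 /= mulrC; apply: le_trans (dist k).
  by apply: le_trans (coord _); rewrite !mxE.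
- exact: cvg_cst.
- by apply: cvg_geometric; rewrite ger0_norm.
Qed.

End measurable_argmin.

Section measurable_domd.
Context {R : realType} {d : nat} {dT : measure_display} {T : measurableType dT}.
Variables (m0 m1 m2 m3 : R -> R) (Rm gt S kmu lam g : R).
Hypothesis dm0 : forall t : R, is_derive t 1 m0 (m1 t).
Hypothesis dm1 : forall t : R, is_derive t 1 m1 (m2 t).
Hypothesis dm2 : forall t : R, is_derive t 1 m2 (m3 t).
Hypothesis Rm0 : 0 < Rm.
Hypothesis sc : forall z, `|m3 z| <= Rm * m2 z.
Hypothesis gt0 : 0 < gt.
Hypothesis S0 : 0 < S.
Hypothesis kmu0 : 0 < kmu.
Let eta := 1 + Rm * S.
Hypothesis lam_ge : 6 * eta * Rm * kmu * S / gt <= lam.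
Hypothesis g01 : 0 < g < 1.
Hypothesis d0 : (0 < d)%N.
Variables (x : nat -> T -> 'cV[R]_d) (r : nat -> T -> R) (th1 : 'cV[R]_d).
Variables (th : nat -> T -> 'cV[R]_d) (H : nat -> T -> 'M[R]_d).
Hypothesis Hdomd : forall w, domd S lam g eta th1
  (fun t => loss m0 gt (x t w) (r t w)) (fun t => th t w) (fun t => H t w).

Lemma measurable_of_derive (f f1 : R -> R) :
  (forall t : R, is_derive t 1 f (f1 t)) -> measurable_fun setT f.
Proof.
move=> ff1; apply: continuous_measurable_fun => t.
by apply: differentiable_continuous; apply/derivable1_diffP; case: (ff1 t).
Qed.

(** Generic in the sigma-algebra of [T]: it is used with the ambient one and with each history,
    where it makes [th t] and [H t] predictable, since only rounds before t are involved. *)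
Lemma measurable_domd t : (1 <= t)%N ->
  (forall s, (1 <= s < t)%N -> measurable_mx (x s) /\ measurable_fun setT (r s)) ->
  measurable_mx (th t) /\ measurable_mx (H t).
Proof.
have lam0 : 0 < lam.
  by apply: lt_le_trans lam_ge; rewrite divr_gt0// !mulr_gt0// eta_gt0.
have eta0 : 0 < eta := eta_gt0 Rm0 S0.
have mm1 := measurable_of_derive dm1; have mm2 := measurable_of_derive dm2.
elim: t => // -[_ _ _|t IH _ mxr].
  split=> [i j|i j].
    rewrite (_ : (fun w => _) = cst (th1 i j))//; apply/funext => w.
    by have [-> _ _] := Hdomd w.
  rewrite (_ : (fun w => _) = cst ((lam%:M : 'M[R]_d) i j))//; apply/funext => w.
  by have [_ -> _] := Hdomd w.
have [|mth mH] := IH isT.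
  by move=> s /andP[s1 st]; apply: mxr; rewrite s1 ltnW.
have [mx mr] := mxr t.+1 (ltnSn _).
pose A w := regularized lam g (H t.+1 w).
have mA : measurable_mx A.
  by apply: measurable_mxD; [exact: measurable_mxZ|exact: measurable_mx_cst].
have mxx : measurable_mx (fun w => x t.+1 w *m (x t.+1 w)^T).
  by apply: measurable_mxM => //; exact: measurable_mx_tr.
have mhess u : measurable_mx u ->
    measurable_mx (fun w => hess (loss m0 gt (x t.+1 w) (r t.+1 w)) (u w)).
  move=> mu; under eq_fun do rewrite (hess_loss gt _ _ dm0 dm1).
  apply: measurable_mxZ => //; apply: measurable_funM => //.
  by apply: (measurableT_comp mm2); exact: measurable_dotv.
have stepE w : argmin_on (ball2 S)
    (fun u => quad_approx (loss m0 gt (x t.+1 w) (r t.+1 w)) (th t.+1 w) u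
       + (2 * eta)^-1 * wnorm (A w) (u - th t.+1 w) ^+ 2) (th t.+2 w) /\
    H t.+2 w = A w + hess (loss m0 gt (x t.+1 w) (r t.+1 w)) (th t.+2 w).
  by have [_ _ /(_ t.+1 isT)] := Hdomd w.
have HA w := domd_A dm0 dm1 Rm0 sc gt0 g01 (Hdomd w) (ltn0Sn t).
have HAp w := posdef_psd (posdef_scalar_lb lam0 (HA w).1 (HA w).2).
have mth2 : measurable_mx (th t.+2).
  (* The objective has the constant Hessian hess + A / eta, which dominates (lam / eta) I; this
     strong convexity drives the contraction. *)
  apply: (@measurable_ball_argmin _ _ _ _ S (eta^-1 * lam)
    (fun w => grad (loss m0 gt (x t.+1 w) (r t.+1 w)) (th t.+1 w)) (th t.+1) _
    (fun w => hess (loss m0 gt (x t.+1 w) (r t.+1 w)) (th t.+1 w) +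
      eta^-1 *: A w)) => //.
  - by rewrite mulr_gt0 ?invr_gt0.
  - under eq_fun do rewrite (grad_loss gt _ _ dm0).
    apply: measurable_mxZ => //; apply: measurable_funM => //.
    apply: measurable_funB => //.
    by apply: (measurableT_comp mm1); exact: measurable_dotv.
  - apply: measurable_mxD; first exact: mhess.
    by apply: measurable_mxZ.
  - move=> w; rewrite linearD linearZ /= (HA w).1.
    by rewrite (hess_loss_psd _ dm0 dm1 Rm0 sc gt0 _ _).1.
  - move=> w y; rewrite bilf_mxD bilf_mxZ -mulrA.
    have := (hess_loss_psd (r t.+1 w) dm0 dm1 Rm0 sc gt0 (x t.+1 w) (th t.+1 w)).2 y.
    have ei : 0 <= eta^-1 by rewrite invr_ge0 ltW.
    by have := ler_wpM2l ei ((HA w).2 y); lra.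
  - by move=> w; have [[]] := stepE w.
  - move=> w y yS; have [min _] := stepE w.
    exact: argmin_variational_ineq eta0 (hess_loss_psd _ dm0 dm1 Rm0 sc gt0 _ _)
      (HAp w) min yS.
split=> //; rewrite (_ : H t.+2 = fun w => A w +
  hess (loss m0 gt (x t.+1 w) (r t.+1 w)) (th t.+2 w)); last first.
  by apply/funext => w; exact: (stepE w).2.
by apply: measurable_mxD => //; exact: mhess.
Qed.

End measurable_domd.

(** * The exponential family and the bound on the link derivative *)

Section probability_with_density.
Context d (T : measurableType d) (R : realType).
Context (mu : {measure set T -> \bar R}) (f : T -> R).
Context (mf : measurable_fun setT f) (f0 : forall x, 0 <= f x).
Context (f1 : (\int[mu]_x (f x)%:E = 1)%E).

Definition prob_with_density of (\int[mu]_x (f x)%:E = 1)%E :=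
  with_density mu mf f0.

HB.instance Definition _ := Measure.on (prob_with_density f1).
HB.instance Definition _ :=
  Measure_isProbability.Build _ _ _ (prob_with_density f1) f1.

Lemma integral_prob_with_density B (g : T -> R) : measurable B ->
  measurable_fun setT g -> (forall x, 0 <= g x) ->
  (\int[prob_with_density f1]_(x in B) (g x)%:E =
   \int[mu]_(x in B) (g x * f x)%:E)%E.
Proof.
move=> mB mg g0; rewrite [LHS]integral_mkcond [RHS]integral_mkcond.
transitivity (\int[with_density mu mf f0]_x (((EFin \o g) \_ B) x))%E.
  by apply: eq_measure_integral.
rewrite integral_with_density.
- apply: eq_integral => x _; rewrite !patchE.
  by case: ifPn => _ //=; rewrite mul0e.
- apply/(measurable_restrictT _ mB); apply/measurable_EFinP.
  exact: measurable_funTS.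
- by move=> x; rewrite patchE; case: ifPn => //= _; rewrite lee_fin.
Qed.

End probability_with_density.

Section exponential_family.
Context {R : realType}.
Variables (m : R -> R) (gt : R) (ht : R -> R) (nu : {measure set R -> \bar R}).
Hypothesis gt0 : 0 < gt.
Hypothesis dens : forall z, is_density nu (fun y => expfam m gt ht y z).

(* The density of p(. | z) with respect to p(. | 0). *)
Definition tilt (z y : R) : R := expR ((y * z - (m z - m 0)) / gt).

Lemma measurable_tilt z : measurable_fun setT (tilt z).
Proof.
apply: measurableT_comp => //; apply: measurable_funM => //.
by apply: measurable_funB => //; exact: measurable_funM.
Qed.

(** [Q] is p(. | 0) times [nu]. It replaces the arbitrary [nu] by a finite measure, as
    [disintegration] needs a sigma-finite one. *)
Lemma expfam_base : exists Q : probability R R,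
  forall B z, measurable B ->
  (\int[nu]_(y in B) (expfam m gt ht y z)%:E = \int[Q]_(y in B) (tilt z y)%:E)%E.
Proof.
have [mf f0 f1] := dens 0.
exists (prob_with_density mf f0 f1) => B z mB.
rewrite integral_prob_with_density//.
- apply: eq_integral => y _; congr EFin.
  by rewrite /expfam /tilt -expRD; congr expR; field; rewrite gt_eqF.
- exact: measurable_tilt.
- by move=> y; exact: expR_ge0.
Qed.


Section tilted.
Variable Q : probability R R.
Hypothesis tilt1 : forall z, (\int[Q]_y (tilt z y)%:E = 1)%E.

(** Tilting p(. | z) by exp (a y) gives a multiple of p(. | z + gt a); the multiple is read off from
    the normalisation of that density. *)
Lemma integral_expR_tilt z a c :
  (\int[Q]_y (expR (a * y + c) * tilt z y)%:E =
   (expR (c + (m (z + gt * a) - m z) / gt))%:E)%E.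
Proof.
rewrite -[RHS]mule1 -(tilt1 (z + gt * a)) -ge0_integralZl//.
- apply: eq_integral => y _; rewrite /tilt -EFinM -!expRD; congr (expR _)%:E.
  by field; rewrite gt_eqF.
- by apply/measurable_EFinP; exact: measurable_tilt.
- by move=> y _; rewrite lee_fin expR_ge0.
Qed.

(** For y in [0, Rm], (e^(a y) - 1) (e^(a Rm) - e^(a y)) >= 0, that is e^(a y) + e^(a Rm) e^(- a y)
    <= 1 + e^(a Rm). This is integrated against [tilt z]; laws on the two endpoints give
    equality. *)
Lemma tilt_second_difference Rm z a : 0 < a ->
  Q (~` `[0, Rm]) = 0%E ->
  expR ((m (z + gt * a) - m z) / gt) + expR (a * Rm) * expR ((m (z - gt * a) - m z) / gt)
    <= 1 + expR (a * Rm).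
Proof.
move=> a0 Q0.
have mt := measurable_tilt z.
have H1 : (\int[Q]_y (expR (a * y + 0) * tilt z y +
     expR (- a * y + a * Rm) * tilt z y)%:E <=
    \int[Q]_y ((1 + expR (a * Rm)) * tilt z y)%:E)%E.
  apply: ae_ge0_le_integral => //.
  - by move=> y _; rewrite lee_fin addr_ge0// mulr_ge0// expR_ge0.
  - apply/measurable_EFinP; apply: measurable_funD; apply: measurable_funM => //;
      apply: measurableT_comp => //; apply: measurable_funD => //;
      exact: measurable_funM.
  - by move=> y _; rewrite lee_fin mulr_ge0 ?addr_ge0 ?expR_ge0.
  - by apply/measurable_EFinP; apply: measurable_funM.
  exists (~` `[0, Rm]%classic); split => //.
    by apply: measurableC.
  move=> y /= yN yRm; apply: yN => _.
  rewrite lee_fin -mulrDl ler_wpM2r ?expR_ge0//.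
  move: yRm; rewrite in_itv /= => /andP[y0 yR].
  have e1 : 0 <= (expR (a * y) - 1) * (expR (a * Rm) - expR (a * y)).
    rewrite mulr_ge0// subr_ge0 ?ler_expR ?ler_wpM2l ?(ltW a0)//.
    by rewrite -expR0 ler_expR mulr_ge0 ?(ltW a0).
  rewrite addr0 expRD mulNr expRN.
  have e0 := expR_gt0 (a * y).
  rewrite -(ler_pM2r e0).
  have -> : (expR (a * y) + (expR (a * y))^-1 * expR (a * Rm)) * expR (a * y) =
      expR (a * y) ^+ 2 + expR (a * Rm) by field; rewrite gt_eqF.
  lra.
move: H1; rewrite (eq_integral (fun y => (expR (a * y + 0) * tilt z y)%:E +
     (expR (- a * y + a * Rm) * tilt z y)%:E)%E)//.
rewrite ge0_integralD//; last 4 first.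
- by move=> y _; rewrite lee_fin mulr_ge0// expR_ge0.
- apply/measurable_EFinP; apply: measurable_funM => //; apply: measurableT_comp => //.
  by apply: measurable_funD => //; exact: measurable_funM.
- by move=> y _; rewrite lee_fin mulr_ge0// expR_ge0.
- apply/measurable_EFinP; apply: measurable_funM => //; apply: measurableT_comp => //.
  by apply: measurable_funD => //; exact: measurable_funM.
rewrite !integral_expR_tilt (eq_integral (fun y => (1 + expR (a * Rm))%:E * (tilt z y)%:E)%E)//.
rewrite ge0_integralZl//; last 2 first.
- exact/measurable_EFinP.
- by move=> y _; rewrite lee_fin expR_ge0.
by rewrite tilt1 mule1 -EFinD lee_fin add0r expRD mulrN.
Qed.

(** The Taylor coefficient of t^2 is 1; the coefficient 4 is what the constant Rm^2 / gt of
    [link_derivative_le] allows, and e^t <= 1 / (1 - t) then suffices. *)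
Lemma expR_inv_bounds (t : R) : 0 < t < 1 / 2 ->
  expR t + expR (- t) < 2 + 4 * t ^+ 2.
Proof.
move=> /andP[t0 t1].
have h1 : expR t <= (1 - t)^-1.
  rewrite -[expR t]invrK -expRN lef_pV2 ?posrE ?expR_gt0//; last lra.
  exact: expR_ge1Dx.
have h2 : expR (- t) <= (1 + t)^-1.
  rewrite expRN lef_pV2 ?posrE ?expR_gt0//; last lra.
  exact: expR_ge1Dx.
have tt : t ^+ 2 < 1 / 4.
  have : t * t < (1 / 2) * (1 / 2) by apply: ltr_pM => //; exact: ltW.
  by rewrite -expr2; lra.
have t2 : 0 < t ^+ 2 by rewrite exprn_gt0.
apply: le_lt_trans (lerD h1 h2) _.
have -> : (1 - t)^-1 + (1 + t)^-1 = 2 / (1 - t ^+ 2).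
  by field; rewrite !gt_eqF//; lra.
rewrite ltr_pdivrMr; last lra.
have : 0 < t ^+ 2 * (1 / 4 - t ^+ 2) by rewrite mulr_gt0//; lra.
lra.
Qed.

Variables (m1 m2 m3 : R -> R) (Rm : R).
Hypothesis dm0 : forall t : R, is_derive t 1 m (m1 t).
Hypothesis dm1 : forall t : R, is_derive t 1 m1 (m2 t).
Hypothesis dm2 : forall t : R, is_derive t 1 m2 (m3 t).
Hypothesis Rm0 : 0 < Rm.
Hypothesis sc : forall z, `|m3 z| <= Rm * m2 z.

(* Otherwise the second difference of m near z would exceed the bound that
   tilt_second_difference puts on the cumulants of a [0, Rm]-valued variable. *)
Lemma link_derivative_le z : Q (~` `[0, Rm]) = 0%E -> m2 z <= Rm ^+ 2 / gt.
Proof.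
move=> Q0; rewrite leNgt; apply/negP => zL.
set L := Rm ^+ 2 / gt in zL.
have L0 : 0 < L by rewrite divr_gt0// exprn_gt0.
have m2z : 0 < m2 z by exact: lt_trans zL.
(* Within distance y0 of z, self-concordance keeps m2 above m2 z (1 - Rm y0) = L. The second term in
   the minimum [a] brings a Rm below 1/2, as [expR_inv_bounds] requires. *)
pose y0 := (1 - L / m2 z) / Rm.
have y00 : 0 < y0 by rewrite divr_gt0// subr_gt0 ltr_pdivrMr// mul1r.
pose a := Num.min (y0 / gt) (1 / (4 * Rm)).
have a0 : 0 < a by rewrite lt_min; apply/andP; split; apply: divr_gt0 => //; rewrite mulr_gt0.
have ay : gt * a <= y0.
  by rewrite mulrC -ler_pdivlMr// ge_min lexx.
have aR : a * Rm < 1 / 2.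
  have : a <= 1 / (4 * Rm) by rewrite ge_min lexx orbT.
  rewrite -(ler_pM2r Rm0); have -> : 1 / (4 * Rm) * Rm = 1 / 4 by field; rewrite gt_eqF.
  by lra.
have near t : `|t| <= gt * a -> L <= m2 (z + t).
  move=> ta; apply: le_trans (sc_growth_ge dm2 sc z t).
  have e := expR_ge1Dx (- (Rm * `|t|)).
  apply: le_trans (ler_wpM2l (ltW m2z) e).
  have ty := le_trans ta ay.
  have := ler_wpM2l (ltW Rm0) ty.
  have -> : Rm * y0 = 1 - L / m2 z by rewrite /y0; field; rewrite !gt_eqF.
  move=> H; have := ler_wpM2l (ltW m2z) H.
  have -> : m2 z * (1 - L / m2 z) = m2 z - L by field; rewrite gt_eqF.
  lra.
have dn0 : forall t : R, is_derive t 1 (- m) ((- m1) t).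
  by move=> t; exact: (@is_deriveN _ _ _ _ _ _ _ (dm0 t)).
have dn1 : forall t : R, is_derive t 1 (- m1) ((- m2) t).
  by move=> t; exact: (@is_deriveN _ _ _ _ _ _ _ (dm1 t)).
have low y : `|y| <= gt * a -> m z + m1 z * y + L / 2 * y ^+ 2 <= m (z + y).
  move=> ya.
  have bnd t : 0 <= t <= 1 -> (- m2) (z + t * y) <= - L.
    move=> /andP[t0 t1]; rewrite lerN2; apply: near.
    by apply: le_trans ya; rewrite normrM ger0_norm// ler_piMl.
  have := taylor2_le dn0 dn1 bnd.
  rewrite -[(- m) _]/(- m _) -[(- m) z]/(- m z) -[(- m1) z]/(- m1 z); lra.
have ga0 : 0 < gt * a by rewrite mulr_gt0.
have l1 := low (gt * a); rewrite gtr0_norm// lexx in l1; have {}l1 := l1 isT.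
have l2 := low (- (gt * a)); rewrite normrN gtr0_norm// lexx in l2; have {}l2 := l2 isT.
have := tilt_second_difference z a0 Q0.
set U := expR ((m (z + gt * a) - m z) / gt); set V := expR ((m (z - gt * a) - m z) / gt).
set E := expR (a * Rm) => UV.
have U0 : 0 < U := expR_gt0 _; have V0 : 0 < V := expR_gt0 _.
have E0 : 0 < E := expR_gt0 _.
(* From 4 E U V <= (U + E V)^2. The contradiction is with U V >= 1 + (a Rm)^2, forced by the
   curvature L, because [expR_inv_bounds] makes (1 + E)^2 / (4 E) smaller than that. *)
have UVE : 4 * E * (U * V) <= (1 + E) ^+ 2.
  have h := ler_pM (ltW (addr_gt0 U0 (mulr_gt0 E0 V0))) (ltW (addr_gt0 U0 (mulr_gt0 E0 V0))) UV UV.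
  have := sqr_ge0 (U - E * V); rewrite -!expr2 in h.
  by move: h; lra.
have UVx : 1 + (a * Rm) ^+ 2 <= U * V.
  apply: le_trans (expR_ge1Dx _) _; rewrite -expRD ler_expR.
  have : L * (gt * a) ^+ 2 <= m (z + gt * a) - m z + (m (z - gt * a) - m z) by lra.
  rewrite -mulrDl ler_pdivlMr//; apply: le_trans.
  by rewrite le_eqVlt; apply/orP; left; apply/eqP; rewrite /L; field; rewrite gt_eqF.
have Ei : expR (- (a * Rm)) = E^-1 by rewrite expRN.
have aR0 : 0 < a * Rm by rewrite mulr_gt0.
have := @expR_inv_bounds (a * Rm); rewrite aR0 aR Ei -/E => /(_ isT) B.
have E4 : 0 < 4 * E by lra.
have := ler_wpM2l (ltW E4) UVx => h3.
have h4 : E * (E + E^-1) < E * (2 + 4 * (a * Rm) ^+ 2) by rewrite ltr_pM2l.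
rewrite mulrDr mulfV ?gt_eqF// in h4.
by clear Q0; lra.
Qed.

End tilted.
End exponential_family.

(** * Conditional exponential moments of one reward *)

Section conditional_step.
Context {R : realType} {dT : measure_display} {T : measurableType dT}.
Variables (P : probability T R) (G : set (set T)) (Y : T -> R).
Hypothesis Gm : G `<=` measurable.
Local Notation TF := (g_sigma_algebraType G).
Variables (m : R -> R) (gt : R) (ht : R -> R) (nu : {measure set R -> \bar R}).
Variables (Q : probability R R) (zs : T -> R).
Hypothesis gt0 : 0 < gt.
Hypothesis mm : measurable_fun setT m.
Hypothesis mY : measurable_fun setT Y.
Hypothesis mzs : measurable_fun setT (zs : TF -> R).
Hypothesis Qnu : forall B z, measurable B ->
  (\int[nu]_(y in B) (expfam m gt ht y z)%:E = \int[Q]_(y in B) (tilt m gt z y)%:E)%E.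
Hypothesis tilt1 : forall z, (\int[Q]_y (tilt m gt z y)%:E = 1)%E.
Hypothesis PY : cond_density P <<s G>> Y nu (fun w y => expfam m gt ht y (zs w)).

(** The identity into the same set with the coarser sigma-algebra: conditioning on the history is
    conditioning on [J]. *)
Let J (w : T) : TF := w.

Lemma measurable_coarse d' (U : measurableType d') (f : T -> U) :
  measurable_fun setT (f : TF -> U) -> measurable_fun setT f.
Proof.
move=> mf _ B mB; have := mf measurableT B mB.
by apply: (smallest_sub (@sigma_algebra_measurable _ T) Gm).
Qed.

Let mJ : measurable_fun setT J.
Proof. exact: (@measurable_coarse _ TF J (@measurable_id _ TF setT)). Qed.

(** The conditional probability of leaving [0, Rm] integrates to 0, so it vanishes at some w. As
    [tilt] is strictly positive, that single w already forces [Q] to give no mass to the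
    complement. *)
Lemma support_of_ae_bounded Rm : {ae P, forall w, 0 <= Y w <= Rm} ->
  Q (~` `[0, Rm]%classic) = 0%E.
Proof.
move=> Ybd; set B := ~` _.
have mB : measurable B by apply: measurableC.
have PB : P (Y @^-1` B) = 0%E.
  apply/negligibleP; first by rewrite -[X in measurable X]setTI; exact: mY.
  by apply: negligibleS Ybd => w /=; rewrite /B /= in_itv.
have [_ /(_ setT)] := PY mB; rewrite setTI PB.
move=> /(_ (@measurableT _ TF))/esym.
under eq_integral do rewrite Qnu//.
move=> I0.
have int_ge0 (w : T) : (0 <= \int[Q]_(y in B) (tilt m gt (zs w) y)%:E)%E.
  by apply: integral_ge0 => y _; rewrite lee_fin expR_ge0.
have mint : measurable_fun setT
    (fun w => \int[Q]_(y in B) (tilt m gt (zs w) y)%:E)%E.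
  have [h _] := PY mB.
  apply: (@measurable_coarse _ (\bar R)) => _ C mC; rewrite setTI.
  have := h C mC; rewrite (_ : (fun w => _) = (fun w =>
    \int[Q]_(y in B) (tilt m gt (zs w) y)%:E)%E)//.
  by apply/funext => w; rewrite Qnu.
have [w zw] : exists w, (\int[Q]_(y in B) (tilt m gt (zs w) y)%:E = 0)%E.
  apply: contrapT => /forallNP h.
  have /ae_eq_integral_abs : measurable_fun setT
    (fun w => \int[Q]_(y in B) (tilt m gt (zs w) y)%:E)%E by [].
  move=> /(_ P measurableT)[+ _].
  under eq_integral do rewrite gee0_abs//.
  move=> /(_ I0) [N [mN N0 sub]].
  have : P setT = 0%E.
    apply/eqP; rewrite eq_le measure_ge0 andbT -N0 le_measure ?inE// => w _.
    by apply: sub => /= /(_ I); exact: h.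
  by rewrite probability_setT => /eqP; rewrite onee_eq0.
have mt : measurable_fun B (EFin \o tilt m gt (zs w)).
  by apply/measurable_EFinP/measurable_funTS; exact: measurable_tilt.
have /ae_eq_integral_abs := mt.
move=> /(_ Q mB)[+ _].
rewrite (eq_integral (EFin \o tilt m gt (zs w))); last first.
  by move=> y _; rewrite gee0_abs//= lee_fin expR_ge0.
move=> /(_ zw) [N [mN N0 sub]].
apply/eqP; rewrite eq_le measure_ge0 andbT -N0 le_measure ?inE// => y By.
apply: sub => /= /(_ By) /eqP.
by rewrite eqe gt_eqF// expR_gt0.
Qed.

Lemma integral_exp_step (M a c : T -> R) :
  measurable_fun setT (M : TF -> R) -> measurable_fun setT (a : TF -> R) ->
  measurable_fun setT (c : TF -> R) -> (forall w, 0 <= M w) ->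
  (\int[P]_w (M w * expR (a w * Y w + c w))%:E =
   \int[P]_w (M w * expR (c w + (m (zs w + gt * a w) - m (zs w)) / gt))%:E)%E.
Proof.
move=> mM ma mc M0.
pose f (z : TF * R) : R := tilt m gt (zs z.1) z.2.
pose h (z : TF * R) : \bar R := (M z.1 * expR (a z.1 * z.2 + c z.1))%:E.
have fst_meas (k : T -> R) : measurable_fun setT (k : TF -> R) ->
    measurable_fun setT (fun z : TF * R => k z.1).
  by move=> mk; exact: (measurableT_comp mk measurable_fst).
have mf : measurable_fun setT f.
  apply: measurableT_comp => //; apply: measurable_funM => //.
  apply: measurable_funB; first by apply: measurable_funM => //; exact: fst_meas.
  apply: measurable_funB => //.
  exact: (fst_meas (fun w => m (zs w)) (measurableT_comp mm mzs)).
have mh : measurable_fun setT h.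
  apply/measurable_EFinP; apply: measurable_funM; first exact: fst_meas.
  apply: measurableT_comp => //; apply: measurable_funD; last exact: fst_meas.
  by apply: measurable_funM => //; exact: fst_meas.
have f0 z : 0 <= f z by exact: expR_ge0.
have h0 z : (0 <= h z)%E by rewrite lee_fin mulr_ge0// expR_ge0.
have PJY A B : measurable A -> measurable B ->
    P ((mfun_Sub (mem_set mJ)) @^-1` A `&` Y @^-1` B) =
  (\int[P]_(w in (mfun_Sub (mem_set mJ) : T -> TF) @^-1` A)
     \int[Q]_(y in B) (f ((mfun_Sub (mem_set mJ) : T -> TF) w, y))%:E)%E.
  move=> mA mB /=; have [_ /(_ A mA) ->] := PY mB.
  by apply: eq_integral => w _; rewrite Qnu.
have := @disintegration _ _ _ T TF R R P (mfun_Sub (mem_set mJ)) Y Q f mY mf f0 PJY h mh h0.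
rewrite /h /f /= => ->.
apply: eq_integral => w _.
under eq_integral do rewrite -EFinM -mulrA EFinM.
rewrite ge0_integralZl//.
- by rewrite (integral_expR_tilt gt0 tilt1) -EFinM.
- apply/measurable_EFinP; apply: measurable_funM; last exact: measurable_tilt.
  apply: measurableT_comp => //; apply: measurable_funD => //.
- by move=> y _; rewrite lee_fin mulr_ge0// expR_ge0.
- by rewrite lee_fin.
Qed.


Local Notation leb := (@lebesgue_measure R).

(** exp (l(zs) - l(z)) is the likelihood ratio p(Y | z) / p(Y | zs), whose conditional mean is 1 for
    every predictable z. Tonelli's theorem then averages z over a Gaussian with predictable mean and
    deviation. *)
Lemma integral_mixture_step (M z0 sg : T -> R) (l := fun w z => (m z - Y w * z) / gt) :
  measurable_fun setT (M : TF -> R) -> measurable_fun setT (z0 : TF -> R) ->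
  measurable_fun setT (sg : TF -> R) -> (forall w, 0 <= M w) ->
  let mix w := (\int[leb]_n (M w * (normal_pdf 0 1 n *
     expR (l w (zs w) - l w (z0 w + sg w * n))))%:E)%E in
  measurable_fun setT mix /\ (\int[P]_w mix w = \int[P]_w (M w)%:E)%E.
Proof.
move=> mM mz0 msg M0.
have phi0 n : 0 <= normal_pdf 0 1 n :> R by exact: normal_pdf_ge0.
pose k (q : T * R) : R := M q.1 * (normal_pdf 0 1 q.2 *
  expR (l q.1 (zs q.1) - l q.1 (z0 q.1 + sg q.1 * q.2))).
have k0 q : 0 <= k q by rewrite !mulr_ge0// expR_ge0.
have fstm (f : T -> R) : measurable_fun setT f ->
    measurable_fun setT (fun q : T * R => f q.1).
  by move=> mf; exact: (measurableT_comp mf measurable_fst).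
have mpdf : measurable_fun setT (fun q : T * R => normal_pdf 0 1 q.2 : R).
  exact: (measurableT_comp (measurable_normal_pdf 0 1) measurable_snd).
have mzn : measurable_fun setT (fun q : T * R => z0 q.1 + sg q.1 * q.2).
  apply: measurable_funD; first by apply: fstm; exact: measurable_coarse.
  by apply: measurable_funM => //; apply: fstm; exact: measurable_coarse.
have mlz (f : T * R -> R) : measurable_fun setT f ->
    measurable_fun setT (fun q : T * R => l q.1 (f q)).
  move=> mf; apply: measurable_funM => //; apply: measurable_funB.
    exact: (measurableT_comp mm mf).
  by apply: measurable_funM => //; exact: fstm.
have mk : measurable_fun setT k.
  apply: measurable_funM; first by apply: fstm; exact: measurable_coarse.
  apply: measurable_funM => //; apply: measurableT_comp => //.
  by apply: measurable_funB; apply: mlz => //; apply: fstm; exact: measurable_coarse.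
split.
  apply: (@measurable_fun_fubini_tonelli_F _ _ _ _ _ leb (EFin \o k)).
    exact/measurable_EFinP.
  by move=> q; rewrite lee_fin.
rewrite (@fubini_tonelli _ _ _ _ _ P leb (EFin \o k))//; last 1 first.
- exact/measurable_EFinP.
transitivity (\int[leb]_n ((normal_pdf 0 1 n)%:E * \int[P]_w (M w)%:E))%E.
  apply: eq_integral => n _ /=.
  pose a w := (z0 w + sg w * n - zs w) / gt.
  pose c w := (m (zs w) - m (z0 w + sg w * n)) / gt.
  have mznF : measurable_fun setT (fun w : TF => z0 w + sg w * n).
    by apply: measurable_funD => //; exact: measurable_funM.
  have ma : measurable_fun setT (a : TF -> R).
    by apply: measurable_funM => //; exact: measurable_funB.
  have mc : measurable_fun setT (c : TF -> R).
    apply: measurable_funM => //; apply: measurable_funB.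
      exact: (measurableT_comp mm mzs).
    exact: (measurableT_comp mm mznF).
  have E := integral_exp_step mM ma mc M0.
  rewrite (_ : (\int[P]_w (M w)%:E = \int[P]_w (M w * expR (a w * Y w + c w))%:E)%E); last first.
    rewrite E; apply: eq_integral => w _; congr EFin.
    have -> : c w + (m (zs w + gt * a w) - m (zs w)) / gt = 0.
      have -> : zs w + gt * a w = z0 w + sg w * n by rewrite /a; field; rewrite gt_eqF.
      by rewrite /c; field; rewrite gt_eqF.
    by rewrite expR0 mulr1.
  rewrite -ge0_integralZl//.
  - apply: eq_integral => w _; rewrite -EFinM; congr EFin.
    rewrite /k /= mulrCA; congr (_ * (_ * expR _)).
    by rewrite /l /a /c; field; rewrite gt_eqF.
  - apply/measurable_EFinP; apply: measurable_funM; first exact: measurable_coarse.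
    apply: measurableT_comp => //; apply: measurable_funD; last exact: measurable_coarse.
    by apply: measurable_funM => //; exact: measurable_coarse.
  - by move=> w _; rewrite lee_fin mulr_ge0// expR_ge0.
  - by rewrite lee_fin.
rewrite ge0_integralZr//.
- by rewrite integral_normal_pdf mul1e.
- by apply/measurable_EFinP; exact: measurable_normal_pdf.
- by move=> n _; rewrite lee_fin.
- by apply: integral_ge0 => w _; rewrite lee_fin.
Qed.

End conditional_step.

Section weighted_exponential.
Context {R : realType}.

(** Jensen's inequality with the missing weight 1 - s - t placed at 0, where exp is 1. This lets
    discount weights below 1 temper the exponents without spoiling the mean bound. *)
Lemma expR_weighted_le (s t x y : R) : 0 <= s -> 0 <= t -> s + t <= 1 ->
  expR (s * x + t * y) <= s * expR x + t * expR y + (1 - s - t).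
Proof.
move=> s0 t0 st; set z := s * x + t * y.
have tangent u : expR z * (1 + (u - z)) <= expR u.
  have := ler_wpM2l (expR_ge0 z) (expR_ge1Dx (u - z)).
  by move/le_trans; apply; rewrite -expRD addrC subrK.
have st0 : 0 <= 1 - s - t by lra.
have := ler_wpM2l s0 (tangent x); have := ler_wpM2l t0 (tangent y).
have := ler_wpM2l st0 (tangent 0); rewrite expR0 => h1 h2 h3.
have : s * (expR z * (1 + (x - z))) + t * (expR z * (1 + (y - z))) +
  (1 - s - t) * (expR z * (1 + (0 - z))) = expR z by rewrite /z; ring.
lra.
Qed.

Lemma integral_weighted_exp_le {dT} {T : measurableType dT}
    (P : probability T R) (M X Y : T -> R) (s t : R) :
  measurable_fun setT M -> measurable_fun setT X -> measurable_fun setT Y ->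
  (forall w, 0 <= M w) -> 0 <= s -> 0 <= t -> s + t <= 1 ->
  (\int[P]_w (M w * expR (X w))%:E <= \int[P]_w (M w)%:E)%E ->
  (\int[P]_w (M w * expR (Y w))%:E <= \int[P]_w (M w)%:E)%E ->
  (\int[P]_w (M w * expR (s * X w + t * Y w))%:E <= \int[P]_w (M w)%:E)%E.
Proof.
move=> mM mX mY M0 s0 t0 st MX MY.
have st0 : 0 <= 1 - s - t by lra.
have mMexp (f : T -> R) : measurable_fun setT f ->
    measurable_fun setT (fun w => M w * expR (f w)).
  by move=> mf; apply: measurable_funM => //; exact: measurableT_comp.
have Mexp0 f w : 0 <= M w * expR (f w) by rewrite mulr_ge0// expR_ge0.
apply: (@le_trans _ _ (\int[P]_w (s%:E * (M w * expR (X w))%:E +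
    (t%:E * (M w * expR (Y w))%:E + (1 - s - t)%:E * (M w)%:E)))%E).
  apply: ge0_le_integral => //.
  - by move=> w _; rewrite lee_fin mulr_ge0 ?expR_ge0.
  - apply/measurable_EFinP; apply: mMexp; apply: measurable_funD;
    exact: measurable_funM.
  - apply/measurable_EFinP; apply: measurable_funD.
      by apply: measurable_funM => //; exact: mMexp.
    by apply: measurable_funD; apply: measurable_funM => //; exact: mMexp.
  - move=> w _; rewrite -!EFinM -!EFinD lee_fin.
    have := ler_wpM2l (M0 w) (expR_weighted_le (X w) (Y w) s0 t0 st); lra.
rewrite ge0_integralD//; last 4 first.
- by move=> w _; rewrite -EFinM lee_fin !mulr_ge0 ?expR_ge0.
- by apply/measurable_EFinP; apply: measurable_funM => //; exact: mMexp.
- by move=> w _; rewrite -!EFinM -EFinD lee_fin addr_ge0 ?mulr_ge0 ?expR_ge0.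
- apply/measurable_EFinP; apply: measurable_funD; apply: measurable_funM => //.
  exact: mMexp.
rewrite ge0_integralD//; last 4 first.
- by move=> w _; rewrite -EFinM lee_fin !mulr_ge0 ?expR_ge0.
- by apply/measurable_EFinP; apply: measurable_funM => //; exact: mMexp.
- by move=> w _; rewrite -EFinM lee_fin !mulr_ge0 ?expR_ge0.
- by apply/measurable_EFinP; apply: measurable_funM.
rewrite !ge0_integralZl//; try (by apply/measurable_EFinP; exact: mMexp);
  try (by move=> w _; rewrite lee_fin mulr_ge0 ?expR_ge0); try exact/measurable_EFinP;
  try (by move=> w _; rewrite lee_fin).
have I0 : (0 <= \int[P]_w (M w)%:E)%E by apply: integral_ge0 => w _; rewrite lee_fin.
apply: (@le_trans _ _ (s%:E * \int[P]_w (M w)%:E + (t%:E * \int[P]_w (M w)%:E +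
  (1 - s - t)%:E * \int[P]_w (M w)%:E))%E).
  by rewrite leeD// ?leeD// lee_wpmul2l// lee_fin.
have ts0 : 0 <= t + (1 - s - t) by lra.
rewrite -ge0_muleDl ?lee_fin// -EFinD -ge0_muleDl ?lee_fin//.
by rewrite -EFinD (_ : s + (t + (1 - s - t)) = 1) ?mul1e//; ring.
Qed.

End weighted_exponential.

Section measurable_increments.
Context {R : realType} {d : nat} {dT : measure_display} {T : measurableType dT}.

Lemma measurable_loss (m : R -> R) gt (x u : T -> 'cV[R]_d) (r : T -> R) :
  measurable_fun setT m -> measurable_mx x -> measurable_mx u ->
  measurable_fun setT r ->
  measurable_fun setT (fun w => loss m gt (x w) (r w) (u w)).
Proof.
move=> mm mx mu mr; have mxu := measurable_dotv mx mu.
apply: measurable_funM => //; apply: measurable_funB.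
  exact: (measurableT_comp mm mxu).
exact: measurable_funM.
Qed.

Lemma measurable_bilf_invmx (A : T -> 'M[R]_d) (x : T -> 'cV[R]_d) :
  measurable_mx A -> measurable_mx x -> (forall w, posdef (A w)) ->
  measurable_fun setT (fun w => bilf (invmx (A w)) (x w) (x w)).
Proof.
move=> mA mx Ap.
(* [det_add_rank1] with h = 1 expresses the form of the inverse through two determinants, which are
   polynomials in the entries. *)
rewrite (_ : (fun w => _) = fun w =>
    \det (A w + x w *m (x w)^T) * (\det (A w))^-1 - 1); last first.
  apply/funext => w; have := det_add_rank1 (x w) 1 (posdef_unitmx (Ap w)).
  rewrite scale1r mul1r => ->; rewrite mulrC mulKf ?gt_eqF ?posdef_det_gt0//.
  by rewrite addrC addrA addNr add0r.
apply: measurable_funB => //; apply: measurable_funM.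
  apply: measurable_det; apply: measurable_mxD => //; apply: measurable_mxM => //.
  exact: measurable_mx_tr.
apply: measurable_fun_inv; first exact: measurable_det.
by move=> w; exact/ltW/posdef_det_gt0.
Qed.

Lemma measurable_step_slack lam g eta (h : T -> R) (H : T -> 'M[R]_d)
    (x th th' : T -> 'cV[R]_d) :
  measurable_fun setT h -> measurable_mx H -> measurable_mx x ->
  measurable_mx th -> measurable_mx th' ->
  (forall w, posdef (regularized lam g (H w))) ->
  measurable_fun setT (fun w => step_slack lam g eta (h w) (H w) (x w) (th w) (th' w)).
Proof.
move=> mh mH mx mth mth' Ap.
have mA : measurable_mx (fun w => regularized lam g (H w)).
  by apply: measurable_mxD; [exact: measurable_mxZ|exact: measurable_mx_cst].
have md : measurable_mx (fun w => th' w - th w) by exact: measurable_mxB.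
apply: measurable_funD.
  by apply: measurable_funM => //; exact: measurable_bilf.
apply: measurable_funM => //.
apply: (measurableT_comp (@measurable_ln R)); apply: measurable_funD => //.
by apply: measurable_funM => //; exact: measurable_bilf_invmx.
Qed.

End measurable_increments.

(** * Supermartingale, Markov's inequality and union bound *)

Section confidence.
Context {R : realType} {dT : measure_display} {T : measurableType dT} {d : nat}.
Variables (P : probability T R) (Rm S gt kmu lam g delta : R).
Variables (m m1 m2 m3 : R -> R) (ht : R -> R) (nu : {measure set R -> \bar R}).
Variables (x : nat -> T -> 'cV[R]_d) (r : nat -> T -> R) (ts : nat -> T -> 'cV[R]_d).
Variables (th1 : 'cV[R]_d) (th : nat -> T -> 'cV[R]_d) (H : nat -> T -> 'M[R]_d).
Hypothesis dm0 : forall t : R, is_derive t 1 m (m1 t).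
Hypothesis dm1 : forall t : R, is_derive t 1 m1 (m2 t).
Hypothesis dm2 : forall t : R, is_derive t 1 m2 (m3 t).
Hypothesis Rm0 : 0 < Rm.
Hypothesis sc : forall z, `|m3 z| <= Rm * m2 z.
Hypothesis gt0 : 0 < gt.
Hypothesis S0 : 0 < S.
Hypothesis kmu0 : 0 < kmu.
Hypothesis m2_le : forall z, - S <= z <= S -> m2 z <= kmu.
Let eta := 1 + Rm * S.
Hypothesis lam_ge : 6 * eta * Rm * kmu * S / gt <= lam.
Hypothesis lam_ge' : 32 * (3 * eta / 2) * d%:R * Rm ^+ 2 / 7 <= lam.
Hypothesis g01 : 0 < g < 1.
Hypothesis d0 : (0 < d)%N.
Hypothesis dens : forall z, is_density nu (fun y => expfam m gt ht y z).
Hypothesis mx : forall t, (1 <= t)%N -> measurable_mx (x t).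
Hypothesis mr : forall t, (1 <= t)%N -> measurable_fun setT (r t).
Hypothesis mts : forall t, (1 <= t)%N -> measurable_mx (ts t).
Hypothesis Pr : forall t, (1 <= t)%N ->
  cond_density P (history x r ts t) (r t) nu
    (fun w y => expfam m gt ht y (dotv (x t w) (ts t w))).
Hypothesis tsS : forall t w, (1 <= t)%N -> ball2 S (ts t w).
Hypothesis x1 : forall t w, (1 <= t)%N -> norm2 (x t w) <= 1.
Hypothesis rbd : forall t, (1 <= t)%N -> {ae P, forall w, 0 <= r t w <= Rm}.
Hypothesis th1S : ball2 S th1.
Hypothesis Hdomd : forall w, domd S lam g eta th1
  (fun t => loss m gt (x t w) (r t w)) (fun t => th t w) (fun t => H t w).

Let gen t : set (set T) :=
  (\bigcup_(s in [set s | (1 <= s <= t)%N]) sigma_gen (x s))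
      `|` (\bigcup_(s in [set s | (1 <= s < t)%N])
             preimage_set_system setT (r s) measurable)
      `|` (\bigcup_(s in [set s | (1 <= s)%N]) sigma_gen (ts s)).
Local Notation F t := (g_sigma_algebraType (gen t)).

Let gen_measurable t : gen t `<=` measurable.
Proof.
move=> A [[[s /= /andP[s1 _] [i _ [B mB <-]]]|[s /= /andP[s1 _] [B mB <-]]]|
  [s /= s1 [i _ [B mB <-]]]].
- exact: (mx s1).
- exact: (mr s1).
- exact: (mts s1).
Qed.

Let mxF t s : (1 <= s <= t)%N -> measurable_mx (x s : F t -> _).
Proof.
move=> st i j _ B mB; apply: sub_sigma_algebra; left; left; exists s => //.
by rewrite ord1; exists i => //; exists B.
Qed.

Let mrF t s : (1 <= s < t)%N -> measurable_fun setT (r s : F t -> _).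
Proof.
move=> st _ B mB; apply: sub_sigma_algebra; left; right; exists s => //.
by exists B.
Qed.

(** Nothing ties [s] to [t], since every history contains the whole parameter sequence. This is what
    admits theta*_t as comparator at the rounds before t. *)
Let mtsF t s : (1 <= s)%N -> measurable_mx (ts s : F t -> _).
Proof.
move=> s1 i j _ B mB; apply: sub_sigma_algebra; right; exists s => //.
by rewrite ord1; exists i => //; exists B.
Qed.

(** The case [s = t] is included although [F t] does not generate from [r t]: [th t] is fixed once
    round t - 1 is over. *)
Let mthF t s : (1 <= s <= t)%N ->
  measurable_mx (th s : F t -> _) /\ measurable_mx (H s : F t -> _).
Proof.
move=> /andP[s1 st].
apply: (@measurable_domd R d _ (F t) m m1 m2 m3 Rm gt S kmu lam g dm0 dm1 dm2
  Rm0 sc gt0 S0 kmu0 lam_ge g01 d0 x r th1 th H Hdomd s s1).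
move=> k /andP[k1 ks]; have kt := leq_trans ks st; split.
  by apply: mxF; rewrite k1 ltnW.
by apply: mrF; rewrite k1.
Qed.

Let mth s : (1 <= s)%N -> measurable_mx (th s) /\ measurable_mx (H s).
Proof.
move=> s1.
apply: (@measurable_domd R d _ T m m1 m2 m3 Rm gt S kmu lam g dm0 dm1 dm2
  Rm0 sc gt0 S0 kmu0 lam_ge g01 d0 x r th1 th H Hdomd s s1).
by move=> k /andP[k1 ks]; split; [exact: mx|exact: mr].
Qed.

(** The scale at which [Y] has an exponential moment at most 1: after division by [K], the noise
    (through m2 <= Rm^2 / gt) and the curvature (through m2 <= kmu) each consume half of the penalty
    kmu / gt. Since [inc] is X + K Y, the factor [a] turns it into a convex combination. *)
Let K := Rm ^+ 2 / (gt * kmu).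
Let a := (1 + K)^-1.
Let l s w := loss m gt (x s w) (r s w).
Let hh s w := m2 (dotv (x s w) (th s.+1 w)) / gt.
Let slack s w := step_slack lam g eta (hh s w) (H s w) (x s w) (th s w) (th s.+1 w).

Let X s w := l s w (ts s w) - l s w (th s.+1 w) - slack s w.
Let Y t s w := K^-1 * (l s w (ts t w) - l s w (ts s w)
  - kmu / gt * dotv (x s w) (ts t w - ts s w) ^+ 2).
Let inc t s w := l s w (ts t w) - l s w (th s.+1 w) - slack s w
  - kmu / gt * dotv (x s w) (ts t w - ts s w) ^+ 2.

Let K0 : 0 < K.
Proof. by rewrite divr_gt0 ?exprn_gt0 ?mulr_gt0. Qed.

Let inc_XY t s w : a * inc t s w = a * X s w + (1 - a) * Y t s w.
Proof.
rewrite /inc /X /Y /a; field.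
by rewrite !gt_eqF// addr_gt0.
Qed.

Let HA w s (s1 : (1 <= s)%N) : posdef (regularized lam g (H s w)) :=
  domd_A_posdef dm0 dm1 Rm0 sc gt0 S0 kmu0 lam_ge g01 (Hdomd w) s1.

Let mm := measurable_of_derive dm0.
Let mm2 := measurable_of_derive dm2.


(** Round 1 alone locates the support of [Q]; the bound on m2 is then a property of the family,
    valid also outside [-S, S]. *)
Let tilted_law : exists Q : probability R R,
  [/\ forall B z, measurable B ->
     (\int[nu]_(y in B) (expfam m gt ht y z)%:E =
      \int[Q]_(y in B) (tilt m gt z y)%:E)%E,
   forall z, (\int[Q]_y (tilt m gt z y)%:E = 1)%E &
   forall z, m2 z <= Rm ^+ 2 / gt].
Proof.
have [Q Qnu] := expfam_base gt0 dens.
have tilt1 z : (\int[Q]_y (tilt m gt z y)%:E = 1)%E.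
  by rewrite -Qnu//; have [_ _ ->] := dens z.
exists Q; split=> // z.
apply: (link_derivative_le gt0 tilt1 dm0 dm1 dm2 Rm0 sc).
apply: (@support_of_ae_bounded _ _ _ P (gen 1) (r 1%N) (@gen_measurable 1%N)
  m gt ht nu Q (fun w => dotv (x 1%N w) (ts 1%N w))) => //.
- exact: mr.
- exact: Pr.
- exact: rbd.
Qed.

Let zsF k : (1 <= k)%N ->
  measurable_fun setT ((fun w => dotv (x k w) (ts k w)) : F k -> R).
Proof.
by move=> k1; apply: measurable_dotv; [apply: mxF; rewrite k1 leqnn|exact: mtsF].
Qed.

(** The domination by the mixture is pointwise in w, so [th k.+1] disappears before any integral is
    evaluated; the mean [z0] and deviation [sg] that remain are measurable for [F k]. *)
Let integral_X k (M : T -> R) : (1 <= k)%N ->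
  measurable_fun setT (M : F k -> R) -> (forall w, 0 <= M w) ->
  measurable_fun setT (X k) ->
  (\int[P]_w (M w * expR (X k w))%:E <= \int[P]_w (M w)%:E)%E.
Proof.
move=> k1 mM M0 mX.
have [Q [Qnu tilt1 _]] := tilted_law.
pose al := 3 * eta / 2.
have eta0 : 0 < eta := eta_gt0 Rm0 S0.
have al0 : 0 < al by rewrite /al; lra.
pose v w := bilf (invmx (regularized lam g (H k w))) (x k w) (x k w).
pose z0 w := dotv (x k w) (th k w).
pose sg w := Num.sqrt (al * v w).
have kk : (1 <= k <= k)%N by rewrite k1 leqnn.
have [mthk mHk] := mthF kk.
have mz0 : measurable_fun setT (z0 : F k -> R).
  by apply: measurable_dotv => //; exact: mxF.
have mv : measurable_fun setT (v : F k -> R).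
  apply: measurable_bilf_invmx; [|exact: mxF|by move=> w; exact: HA].
  by apply: measurable_mxD; [exact: measurable_mxZ|exact: measurable_mx_cst].
have msg : measurable_fun setT (sg : F k -> R).
  by apply: measurable_fun_sqrt; exact: measurable_funM.
have [mmix mixE] := @integral_mixture_step _ _ _ P (gen k) (r k) (@gen_measurable k)
  m gt ht nu Q (fun w => dotv (x k w) (ts k w)) gt0 mm (mr k1) (zsF k1) Qnu tilt1 (Pr k1)
  M z0 sg mM mz0 msg M0.
rewrite -mixE; apply: ge0_le_integral => //.
- by move=> w _; rewrite lee_fin mulr_ge0 ?expR_ge0.
- apply/measurable_EFinP; apply: measurable_funM; first exact: measurable_coarse mM.
  exact: measurableT_comp.
move=> w _; pose z1 := dotv (x k w) (th k.+1 w).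
pose D := bilf (regularized lam g (H k w)) (th k.+1 w - th k w) (th k.+1 w - th k w).
have /andP[v0 v1] := domd_v_bound dm0 dm1 Rm0 sc gt0 S0 kmu0 lam_ge g01
  (fun t => x1 w (t := t)) (Hdomd w) k1.
have lam0 : 0 < lam.
  by apply: lt_le_trans lam_ge; rewrite divr_gt0// !mulr_gt0// eta_gt0.
have zD : (z1 - z0 w) ^+ 2 <= v w * D.
  have H0 := domd_v_CS dm0 dm1 Rm0 sc gt0 S0 kmu0 lam_ge g01 (Hdomd w)
    (th k.+1 w - th k w) k1.
  have -> : z1 - z0 w = dotv (x k w) (th k.+1 w - th k w).
    by rewrite !dotvE bilfDr bilfNr -!dotvE.
  by [].
have D0 : 0 <= D by exact: (posdef_psd (HA w k1)).2.
(* The second lower bound on [lam], used with v <= 1 / lam and d >= 1. *)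
have alv : al * v w * Rm ^+ 2 <= 7 / 32.
  have dR : 1 <= d%:R :> R by rewrite ler1n.
  have q0 : 0 <= al * Rm ^+ 2 by rewrite mulr_ge0 ?sqr_ge0// ltW.
  have h1 : 32 * (al * Rm ^+ 2) / 7 <= lam.
    apply: le_trans lam_ge'; have := ler_wpM2l q0 dR; rewrite -/al; lra.
  have h2 : v w * lam <= 1.
    by rewrite -ler_pdivlMr// mul1r.
  have := ler_wpM2l v0 h1; move: h2; rewrite -/(v w); lra.
have low := gauss_mixture_lower (r k w) dm0 dm1 dm2 (ltW Rm0) sc gt0 al0 v0
  (m2_ge0 Rm0 sc z1) zD D0 alv.
have mgauss : measurable_fun setT (fun n : R => normal_pdf 0 1 n *
    expR (- ((m (z0 w + sg w * n) - r k w * (z0 w + sg w * n)) / gt))).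
  apply: measurable_funM; first exact: measurable_normal_pdf.
  apply: measurableT_comp => //; apply: measurable_funN; apply: measurable_funM => //.
  have mn : measurable_fun setT (fun n : R => z0 w + sg w * n).
    by apply: measurable_funD => //; exact: measurable_funM.
  apply: measurable_funB; last exact: measurable_funM.
  exact: (measurableT_comp mm mn).
pose e := expR (l k w (ts k w)).
have -> : (M w * expR (X k w))%:E = ((M w * e)%:E * (expR (- l k w (th k.+1 w) -
    D / (2 * al) - (2 * al + 1 / 2) * ln (1 + m2 z1 / gt * v w)))%:E)%E.
  rewrite -EFinM; congr EFin; rewrite -[RHS]mulrA -expRD; congr (_ * expR _).
  rewrite /X /slack /step_slack -/D -/(v w) /hh -/z1 /al; field.
  by rewrite gt_eqF.
apply: le_trans (lee_wpmul2l _ low) _.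
  by rewrite lee_fin mulr_ge0// expR_ge0.
rewrite -ge0_integralZl//.
- rewrite le_eqVlt; apply/orP; left; apply/eqP; apply: eq_integral => n _.
  rewrite -EFinM; congr EFin; rewrite -[LHS]mulrA; congr (_ * _).
  by rewrite [LHS]mulrCA; congr (_ * _); rewrite -expRD.
- exact/measurable_EFinP.
- by move=> n _; rewrite lee_fin mulr_ge0 ?expR_ge0 ?normal_pdf_ge0.
- by rewrite lee_fin mulr_ge0// expR_ge0.
Qed.

Let integral_Y t k (M : T -> R) : (1 <= t)%N -> (1 <= k)%N ->
  measurable_fun setT (M : F k -> R) -> (forall w, 0 <= M w) ->
  (\int[P]_w (M w * expR (Y t k w))%:E <= \int[P]_w (M w)%:E)%E.
Proof.
move=> t1 k1 mM M0.
have [Q [Qnu tilt1 m2_glob]] := tilted_law.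
pose zs w := dotv (x k w) (ts k w); pose zu w := dotv (x k w) (ts t w).
pose b w := zu w - zs w.
pose c w := K^-1 * ((m (zu w) - m (zs w)) / gt - kmu / gt * b w ^+ 2).
pose a' w := - (K^-1 * (b w / gt)).
have mzs := zsF k1.
have mzu : measurable_fun setT (zu : F k -> R).
  by apply: measurable_dotv; [apply: mxF; rewrite k1 leqnn|exact: mtsF].
have mb : measurable_fun setT (b : F k -> R) by exact: measurable_funB.
have ma' : measurable_fun setT (a' : F k -> R).
  by apply: measurable_funN; apply: measurable_funM => //; exact: measurable_funM.
have mc : measurable_fun setT (c : F k -> R).
  apply: measurable_funM => //; apply: measurable_funB.
    apply: measurable_funM => //; apply: measurable_funB.
      exact: (measurableT_comp mm mzu).
    exact: (measurableT_comp mm mzs).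
  by apply: measurable_funM => //; exact: measurable_funX.
have bE w : b w = dotv (x k w) (ts t w - ts k w).
  by rewrite /b /zu /zs !dotvE bilfDr bilfNr.
have YE w : Y t k w = a' w * r k w + c w.
  rewrite /Y /a' /c /l /loss -bE /b -/(zu w) -/(zs w); field.
  by rewrite !gt_eqF.
under eq_integral do rewrite YE.
have := integral_exp_step (@gen_measurable k) gt0 mm (mr k1) mzs Qnu tilt1 (Pr k1)
  mM ma' mc M0 => ->.
have E w : expR (c w + (m (zs w + gt * a' w) - m (zs w)) / gt) <= 1.
  rewrite -[leRHS]expR0 ler_expR.
  have zsS := dotv_ball (x1 w k1) (tsS w k1).
  have zuS := dotv_ball (x1 w k1) (tsS w t1).
  have h1 : m (zu w) <= m (zs w) + m1 (zs w) * b w + kmu / 2 * b w ^+ 2.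
    have {1}-> : zu w = zs w + b w by rewrite addrC subrK.
    apply: (taylor2_le dm0 dm1) => q /andP[q0 q1]; apply: m2_le.
    rewrite /b; move: zsS zuS; rewrite -/(zs w) -/(zu w) => /andP[p1 p2] /andP[p3 p4].
    have q' : 0 <= 1 - q by lra.
    have := ler_wpM2l q0 p3; have := ler_wpM2l q0 p4.
    have := ler_wpM2l q' p1; have := ler_wpM2l q' p2.
    by move=> *; apply/andP; split; lra.
  (* The tilted argument zs + gt a' may leave [-S, S], beyond the reach of [m2_le]; hence the global
     bound on m2 coming from the range of the rewards. *)
  have h2 := taylor2_le dm0 dm1 (x := zs w) (y := gt * a' w)
    (fun q _ => m2_glob (zs w + q * (gt * a' w))).
  have g1 : 0 <= gt^-1 by rewrite invr_ge0 ltW.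
  have Kg : 0 <= K^-1 / gt by rewrite divr_ge0 ?ltW ?invr_gt0.
  have := ler_wpM2l Kg h1; have := ler_wpM2l g1 h2.
  have -> : gt^-1 * (m (zs w) + m1 (zs w) * (gt * a' w) + Rm ^+ 2 / gt / 2 * (gt * a' w) ^+ 2)
    = gt^-1 * m (zs w) - K^-1 / gt * (m1 (zs w) * b w) + K^-1 / gt * (kmu / 2 * b w ^+ 2).
    by rewrite /a' /K; field; rewrite !gt_eqF.
  rewrite /c; lra.
apply: ge0_le_integral => //.
- by move=> w _; rewrite lee_fin mulr_ge0 ?expR_ge0.
- apply/measurable_EFinP; apply: measurable_funM; first exact: measurable_coarse mM.
  apply: (measurable_coarse (@gen_measurable k)).
  apply: measurableT_comp => //; apply: measurable_funD => //.
  apply: measurable_funM => //; apply: measurable_funB; last exact: (measurableT_comp mm mzs).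
  apply: (measurableT_comp mm); apply: measurable_funD => //.
  exact: measurable_funM.
- by apply/measurable_EFinP; exact: measurable_coarse mM.
- by move=> w _; rewrite lee_fin -[leRHS]mulr1 ler_wpM2l.
Qed.


Let mlossF k s (u : T -> 'cV[R]_d) : (1 <= s < k)%N -> measurable_mx (u : F k -> _) ->
  measurable_fun setT ((fun w => l s w (u w)) : F k -> R).
Proof.
move=> /andP[s1 sk] mu; apply: measurable_loss => //.
  by apply: mxF; rewrite s1 ltnW.
by apply: mrF; rewrite s1.
Qed.

Let mXF k s : (1 <= s < k)%N -> measurable_fun setT (X s : F k -> R).
Proof.
move=> sk; have /andP[s1 sk'] := sk.
have sk1 : (1 <= s <= k)%N by rewrite s1 ltnW.
have [mths mHs] := mthF sk1.
have [mths' _] : measurable_mx (th s.+1 : F k -> _) /\ measurable_mx (H s.+1 : F k -> _).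
  by apply: mthF.
apply: measurable_funB; first by apply: measurable_funB; apply: mlossF => //; exact: mtsF.
apply: measurable_step_slack => //; last by move=> w; exact: HA.
- apply: measurable_funM => //; apply: (measurableT_comp mm2).
  by apply: measurable_dotv => //; exact: mxF.
- exact: mxF.
Qed.

Let mYF t k s : (1 <= t)%N -> (1 <= s < k)%N ->
  measurable_fun setT (Y t s : F k -> R).
Proof.
move=> t1 sk; have /andP[s1 sk'] := sk.
apply: measurable_funM => //; apply: measurable_funB.
  by apply: measurable_funB; apply: mlossF => //; exact: mtsF.
apply: measurable_funM => //; apply: measurable_funX; apply: measurable_dotv.
  by apply: mxF; rewrite s1 ltnW.
by apply: measurable_mxB; exact: mtsF.
Qed.

(** The horizon [t] fixes the comparator and the weights, [k] is the running time. Stopping before k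
    makes it measurable for [F k]; at k = t the weights are those of [disc_sum]. *)
Let Mt t k w := expR (\sum_(1 <= s < k) g ^+ (t - 1 - s) * (a * inc t s w)).

Let mMtF t k : (1 <= t)%N -> measurable_fun setT (Mt t k : F k -> R).
Proof.
move=> t1; apply: measurableT_comp => //.
rewrite (_ : (fun w => _) = (fun w : T => \sum_(i < k | (1 <= i)%N)
    g ^+ (t - 1 - i) * (a * X i w + (1 - a) * Y t i w))); last first.
  apply/funext => w; rewrite big_geq_mkord; apply: eq_bigr => s _.
  by rewrite inc_XY.
under eq_fun do rewrite big_mkcond.
apply: measurable_sum => s; case: (boolP (1 <= s)%N) => s1 /=; last exact: measurable_cst.
have sk : (1 <= s < k)%N by rewrite s1 ltn_ord.
apply: measurable_funM => //; apply: measurable_funD; apply: measurable_funM => //.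
  exact: mXF.
exact: mYF.
Qed.

Let integral_Mt t k : (1 <= k <= t)%N -> (\int[P]_w (Mt t k w)%:E <= 1)%E.
Proof.
have [g0 g1] := andP g01.
have a0 : 0 <= a by rewrite invr_ge0 addr_ge0// ltW.
have a1 : a <= 1 by rewrite invf_le1 ?lerDl ?ltW// ltr_wpDr// ltW.
elim: k => // -[_ _|k IH /andP[_ kt]].
  rewrite /Mt; under eq_integral do rewrite big_geq// expR0.
  by rewrite integral_cst// mul1e; have := @probability_setT _ _ _ P => /= ->.
have k1 : (1 <= k.+1)%N by [].
have t1 : (1 <= t)%N by exact: leq_trans kt.
have {}IH : (\int[P]_w (Mt t k.+1 w)%:E <= 1)%E by apply: IH; apply/andP; split => //; exact: ltnW.
apply: le_trans IH.
pose q := g ^+ (t - 1 - k.+1).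
have q0 : 0 <= q by rewrite exprn_ge0// ltW.
have q1 : q <= 1 by rewrite exprn_ile1// ltW.
have ME w : Mt t k.+2 w = Mt t k.+1 w *
    expR (q * a * X k.+1 w + q * (1 - a) * Y t k.+1 w).
  rewrite /Mt big_nat_recr//= expRD; congr (_ * expR _).
  by rewrite inc_XY -/q; ring.
under eq_integral do rewrite ME.
have kk : (1 <= k.+1 < k.+2)%N by rewrite ltnSn.
have mXk : measurable_fun setT (X k.+1).
  exact: (measurable_coarse (@gen_measurable k.+2) (mXF kk)).
apply: integral_weighted_exp_le => //.
- by apply: (measurable_coarse (@gen_measurable k.+1)); exact: mMtF.
- by apply: (measurable_coarse (@gen_measurable k.+2)); exact: mYF.
- by move=> w; exact: expR_ge0.
- by rewrite mulr_ge0.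
- by rewrite mulr_ge0// subr_ge0.
- by rewrite -mulrDr addrC subrK mulr1.
- by apply: integral_X => //; [exact: mMtF|move=> w; exact: expR_ge0].
- by apply: integral_Y => //; [exact: mMtF|move=> w; exact: expR_ge0].
Qed.

Hypothesis delta01 : 0 < delta < 1.

Let level t : R := pi ^+ 2 * t%:R ^+ 2 / (3 * delta).

Let level_gt0 t : (1 <= t)%N -> 0 < level t.
Proof.
move=> t1; case/andP: delta01 => de0 _.
by rewrite divr_gt0 ?mulr_gt0 ?exprn_gt0 ?pi_gt0 ?ltr0n.
Qed.

Let bad t := [set w | (1 + K) * ln (level t) < disc_sum g (fun s => inc t s w) t].

Let Mt_disc t w : Mt t t w = expR (a * disc_sum g (fun s => inc t s w) t).
Proof.
by congr expR; rewrite /disc_sum mulr_sumr; apply: eq_bigr => s _; rewrite mulrCA.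
Qed.

Let bad_Mt t : (1 <= t)%N -> bad t = [set w | level t < Mt t t w].
Proof.
move=> t1; have aK : 0 < 1 + K by rewrite ltr_wpDr// ltW.
apply/funext => w; apply/propext; rewrite /bad /= Mt_disc.
rewrite -{2}[level t]lnK ?posrE ?level_gt0// ltr_expR -[in X in _ <-> X](ltr_pM2l aK).
by rewrite /a mulrA mulfV ?gt_eqF// mul1r.
Qed.

Let measurable_bad t : (1 <= t)%N -> measurable (bad t).
Proof.
move=> t1; rewrite bad_Mt//.
have : measurable_fun setT (Mt t t).
  by apply: (measurable_coarse (@gen_measurable t)); exact: mMtF.
move=> /(_ measurableT `]level t, +oo[%classic (measurable_itv _)).
rewrite setTI; congr measurable; apply/seteqP; split=> w /=;
  by rewrite in_itv /= andbT.
Qed.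

Let P_bad t : (1 <= t)%N -> (P (bad t) <= (level t)^-1%:E)%E.
Proof.
move=> t1; have l0 := level_gt0 t1; have mb := measurable_bad t1.
have mM : measurable_fun setT (Mt t t).
  by apply: (measurable_coarse (@gen_measurable t)); exact: mMtF.
have h : ((level t)%:E * P (bad t) <= 1)%E.
  have tt : (1 <= t <= t)%N by rewrite t1 leqnn.
  apply: le_trans (integral_Mt tt).
  rewrite -integral_cst//; apply: (@le_trans _ _ (\int[P]_(w in bad t) (Mt t t w)%:E)%E).
    apply: ge0_le_integral => //.
    - by move=> w _; rewrite lee_fin ltW.
    - by apply/measurable_EFinP; exact: measurable_funTS.
    - by move=> w; rewrite bad_Mt//= lee_fin => /ltW.
  apply: ge0_subset_integral => //; first exact/measurable_EFinP.
  by move=> w _; rewrite lee_fin expR_ge0.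
have li : (0 <= (level t)^-1%:E)%E by rewrite lee_fin invr_ge0 ltW.
by have := lee_wpmul2l li h; rewrite muleA -EFinM mulVf ?gt_eqF// mul1e mule1.
Qed.

Lemma measurable_le_set (f h : T -> R) : measurable_fun setT f -> measurable_fun setT h ->
  measurable [set w | f w <= h w].
Proof.
move=> mf mh; have := measurable_funB mh mf.
move=> /(_ measurableT `[0, +oo[%classic (measurable_itv _)); rewrite setTI.
congr measurable; apply/seteqP; split=> w /=; rewrite in_itv /= andbT subr_ge0//.
Qed.

Let conf t := [set w | conf_set (th t w) (H t w)
  (beta_radius d S Rm kmu gt lam g eta delta t
   + Num.sqrt (2 * eta * kmu / gt) * drift_penalty g (fun s => ts s w) t) (ts t w)].

(** Turns the bound on the complement into a lower bound on the probability of the event itself. *)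
Let measurable_conf t : (1 <= t)%N -> measurable (conf t).
Proof.
move=> t1; have [mtht mHt] := mth t1.
apply: measurable_le_set.
  apply: measurable_fun_sqrt; apply: measurable_bilf => //;
    by apply: measurable_mxB => //; exact: mts.
apply: measurable_funD => //; apply: measurable_funM => //.
rewrite (_ : (fun w => _) = (fun w => \sum_(p < t | (1 <= p)%N)
   (g `^ ((t - 1 - p)%:R / 2) * Num.sqrt ((1 - g ^+ p) / (1 - g))
     * norm2 (ts p.+1 w - ts p w)))); last first.
  by apply/funext => w; rewrite /drift_penalty big_geq_mkord.
under eq_fun do rewrite big_mkcond.
apply: measurable_sum => p; case: (boolP (1 <= p)%N) => p1 /=; last exact: measurable_cst.
apply: measurable_funM => //; apply: measurable_norm2.
by apply: measurable_mxB; exact: mts.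
Qed.

Let conf_of_good t w : (1 <= t)%N -> ~ bad t w -> conf t w.
Proof.
move=> t1 /negP; rewrite -leNgt => good.
have := (domd_conf_set dm0 dm1 dm2 Rm0 sc gt0 S0 kmu0 m2_le lam_ge g01 d0
  (fun s => x1 w (t := s)) th1S (Hdomd w) t1 delta01 (fun s => tsS w (t := s))).
by apply.
Qed.

(** A telescoping comparison takes the place of the Basel sum: as t starts at 2, pi >= 2 already
    gives 3 / (pi^2 (N + 1)^2) <= 1/N - 1/(N + 1). *)
Let sum_levels n : \sum_(0 <= t < n) (level t.+2)^-1 <= delta.
Proof.
have [de0 _] := andP delta01.
suff : \sum_(0 <= t < n) (level t.+2)^-1 <= delta * (1 - (n.+1)%:R^-1).
  have n1 : 0 <= n.+1%:R^-1 :> R by rewrite invr_ge0.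
  move/le_trans; apply; rewrite mulrBr mulr1 gerBl.
  exact: mulr_ge0 (ltW de0) n1.
elim: n => [|n IH]; first by rewrite big_geq// invr1 subrr mulr0.
rewrite big_nat_recr//=; apply: le_trans (lerD IH (lexx _)) _.
have n0 : 0 <= n%:R :> R by [].
have p2 : 4 <= pi ^+ 2 :> R.
  have := @pi_ge2 R => p2; have : 0 <= (pi - 2) * (pi + 2) :> R by rewrite mulr_ge0//; lra.
  by lra.
have N0 : 0 < n.+1%:R :> R by rewrite ltr0n.
have NS : n.+2%:R = n.+1%:R + 1 :> R by rewrite natr1.
rewrite /level NS; move: (n.+1%:R) N0 {IH NS} => N N0.
have p0 := @pi_gt0 R; move: (pi : R) p0 p2 => p p0 p2.
have N1 : 0 < N + 1 by lra.
have -> : (p ^+ 2 * (N + 1) ^+ 2 / (3 * delta))^-1 =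
    delta * (3 / (p ^+ 2 * (N + 1) ^+ 2)).
  by field; rewrite !gt_eqF.
rewrite -mulrDr ler_pM2l// -lerBrDl.
have -> : 1 - (N + 1)^-1 - (1 - N^-1) = (N * (N + 1))^-1.
  by field; rewrite !gt_eqF.
rewrite ler_pdivrMr ?mulr_gt0 ?exprn_gt0//.
rewrite -ler_pdivrMl ?invr_gt0 ?mulr_gt0// invrK.
have q0 : 0 <= (N + 1) ^+ 2 by rewrite sqr_ge0.
apply: le_trans (ler_wpM2r q0 p2).
by have := mulr_ge0 (ltW N0) (ltW N0); lra.
Qed.

Lemma confidence_sets : ((1 - delta)%:E <=
  P [set w | forall t, (2 <= t)%N -> conf t w])%E.
Proof.
have [de0 _] := andP delta01.
set E := [set w | _].
have EE : E = \bigcap_n conf n.+2.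
  apply/seteqP; split=> [w Ew n _|w Ew [|[|n]]//]; first exact: Ew.
  by move=> _; exact: Ew.
have mE : measurable E by rewrite EE; apply: bigcapT_measurable => n; exact: measurable_conf.
have : (P (~` E) <= delta%:E)%E.
  have sub : ~` E `<=` \bigcup_n bad n.+2.
    move=> w; rewrite EE setC_bigcap => -[n _ nc]; exists n => //.
    by apply: contrapT => nb; apply: nc; exact: conf_of_good.
  have mb n : measurable (bad n.+2) by exact: measurable_bad.
  apply: le_trans (measure_sigma_subadditive P mb (measurableC mE) sub) _.
  apply: lime_le; first by apply: is_cvg_nneseries.
  apply: nearW => n; apply: (@le_trans _ _ (\sum_(0 <= t < n) (level t.+2)^-1%:E)%E).
    by apply: lee_sum => t _; exact: P_bad.
  by rewrite sumEFin lee_fin.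
rewrite probability_setC// EFinB.
have : P E \is a fin_num by exact: fin_num_measure.
by move=> /fineK <-; rewrite -!EFinB !lee_fin; lra.
Qed.

End confidence.

Theorem theorem1 (R : realType) (dT : measure_display) (T : measurableType dT)
  (P : probability T R) (d : nat) (Rmax S : R)
  (* reward model *)
  (m : R -> R) (g : R -> R) (h : R -> R -> R) (tau : R)
  (nu : {measure set R -> \bar R})
  (* environment and learner; time starts at 1 *)
  (X : nat -> T -> set 'cV[R]_d) (x : nat -> T -> 'cV[R]_d)
  (r : nat -> T -> R) (theta_star : nat -> T -> 'cV[R]_d)
  (cmu kmu gamma delta lambda : R)
  (theta1 : 'cV[R]_d) (theta : nat -> T -> 'cV[R]_d) (H : nat -> T -> 'M[R]_d)
  (mu := m^`() : R -> R)
  (eta := 1 + Rmax * S)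
  (alpha := 3 * eta / 2)
  (iota := Num.sqrt (2 * eta * kmu / g tau)) :
  (0 < d)%N -> 0 < Rmax -> 0 < S ->
  0 < g tau ->
  convex_function (setT : set R) m ->
  C3 m ->
  (forall z : R, is_density nu (fun y => expfam m (g tau) (h ^~ tau) y z)) ->
  (forall t : nat, (1 <= t)%N -> measurable_vec (x t)) ->
  (forall t : nat, (1 <= t)%N -> measurable_fun setT (r t)) ->
  (forall t : nat, (1 <= t)%N -> measurable_vec (theta_star t)) ->
  (forall (t : nat) (w : T), (1 <= t)%N -> X t w (x t w)) ->
  (forall t : nat, (1 <= t)%N ->
     cond_density P (history x r theta_star t) (r t) nu
       (fun w y =>
          expfam m (g tau) (h ^~ tau) y (dotv (x t w) (theta_star t w)))) ->
  (* boundedness *)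
  (forall (t : nat) (w : T), (1 <= t)%N -> ball2 S (theta_star t w)) ->
  (forall (t : nat) (w : T), (1 <= t)%N ->
     forall u : 'cV[R]_d, X t w u -> norm2 u <= 1) ->
  (forall t : nat, (1 <= t)%N -> {ae P, forall w, 0 <= r t w <= Rmax}) ->
  (* bounded link *)
  0 < cmu -> 0 < kmu ->
  (forall z : R, - S <= z <= S -> cmu <= mu^`()%classic z <= kmu) ->
  (* self-concordance *)
  (forall z : R, `|mu^`(2)%classic z| <= Rmax * mu^`()%classic z) ->
  0 < gamma < 1 -> 0 < delta < 1 ->
  Num.max (6 * eta * Rmax * kmu * S / g tau)
          (32 * alpha * d%:R * Rmax ^+ 2 / 7) <= lambda ->
  ball2 S theta1 ->
  (forall w : T,
     domd S lambda gamma eta theta1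
       (fun t => loss m (g tau) (x t w) (r t w))
       (fun t => theta t w) (fun t => H t w)) ->
  ((1 - delta)%R%:E <=
   P [set w | forall t : nat, (2 <= t)%N ->
        conf_set (theta t w) (H t w)
          (beta_radius d S Rmax kmu (g tau) lambda gamma eta delta t
           + iota * drift_penalty gamma (fun s => theta_star s w) t)%R
          (theta_star t w)])%E.
Proof.
move=> d0 Rm0 S0 gt0 _ [m_der _] dens mx mr mts xX Pr tsS X1 rbd _ kmu0 link sc
  g01 delta01 lam_ge th1S Hdomd.
have dm k : (k < 3)%N -> forall z : R, is_derive z 1 (m^`(k))%classic (m^`(k.+1)%classic z).
  by move=> k3 z; split; [exact: m_der|rewrite -derive1E].
move: lam_ge; rewrite ge_max => /andP[lam_ge1 lam_ge2].
have mxv (u : nat -> T -> 'cV[R]_d) : (forall t, (1 <= t)%N -> measurable_vec (u t)) ->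
    forall t, (1 <= t)%N -> measurable_mx (u t).
  by move=> mu_ t t1 i j; rewrite ord1; exact: mu_.
apply: (@confidence_sets R dT T d P Rmax S (g tau) kmu lambda gamma delta
  m (m^`())%classic (m^`(2))%classic (m^`(3))%classic (h ^~ tau) nu x r theta_star
  theta1 theta H (dm 0 isT) (dm 1 isT) (dm 2 isT)) => //.
- by move=> z /link/andP[].
- exact: mxv.
- exact: mxv.
- by move=> t w t1; apply: (X1 t w t1); exact: xX.
Qed.
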